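(* (i) For every integer $n\geq 1$, every finite $p\geq 1$, every integer $d\ge 0$ and every analytic $f:\mathbb{C}^n\to\mathbb{C}$ with $f\in\mathcal{P}^{\geq d}$, $$d\,\|f\|_{L^p(d\gamma_{2n})} \leq \|Lf\|_{L^p(d\gamma_{2n})}.$$ (ii) Moreover, for every $p\in(1,\infty)$ there exists a finite constant $K_p$ (depending only on $p$) such that for every integer $n\ge1$, every integer $d\ge0$ and every analytic polynomial $f:\mathbb{C}^n\to\mathbb{C}$ with $f\in\mathcal{P}^{\geq d}$, $$\sqrt{d}\,\|f\|_{L^p(d\gamma_{2n})} \leq K_p\, \|\nabla f\|_{L^p(d\gamma_{2n})}.$$
   Context: Identify $\mathbb{C}^n\cong\mathbb{R}^{2n}$ via $z_j=x_j+iy_j$. For $N\ge1$, $d\gamma_N(x) = (2\pi)^{-N/2}e^{-|x|^2/2}\,dx$ is the standard Gaussian measure on $\mathbb{R}^N$ ($|\cdot|$ the Euclidean norm), and $\|f\|_{L^p(d\gamma_N)} = (\int |f|^p\,d\gamma_N)^{1/p}$; so $d\gamma_{2n}$ is the standard Gaussian measure on $\mathbb{C}^n\cong\mathbb{R}^{2n}$. For a multi-index $\alpha\in(\mathbb{Z}_+)^N$ (nonnegative integers), $|\alpha|=\alpha_1+\dots+\alpha_N$, and the Hermite polynomial is $H_\alpha(x)=\int_{\mathbb{R}^N}\prod_{j=1}^N (x_j+iy_j)^{\alpha_j}\,d\gamma_N(y)$. $\mathcal{P}^{\geq d}$ (on $\mathbb{R}^N$) is the space of all finite sums $\sum_{|\alpha|\ge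 d}c_\alpha H_\alpha$ with $c_\alpha\in\mathbb{C}$; here it is used with $N=2n$. $\nabla$ and $\Delta$ are the usual gradient and Laplacian on $\mathbb{R}^{N}$, with respect to all $N=2n$ real coordinates; $\|\nabla f\|_{L^p(d\gamma_N)}$ is the $L^p(d\gamma_N)$ norm of $|\nabla f| = (\sum_{j}|\partial_{j}f|^2)^{1/2}$. $L = -(\Delta - x\cdot\nabla)$, with $x\cdot\nabla=\sum_{j=1}^N x_j\partial_{x_j}$, is the (positive) generator of the Ornstein--Uhlenbeck semigroup, so $LH_\alpha=|\alpha|H_\alpha$. An analytic polynomial on $\mathbb{C}^n$ is a function of the form $f(z)=\sum_{\alpha} c_\alpha z^\alpha$ (finite sum over $\alpha\in(\mathbb{Z}_+)^n$, $c_\alpha\in\mathbb{C}$), where $z^\alpha=\prod_{j=1}^n z_j^{\alpha_j}$; it is regarded as a complex-valued polynomial on $\mathbb{R}^{2n}$. *)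

(* Defs.v *)
From HB Require Import structures.
From mathcomp Require Import all_boot all_order all_algebra.
From mathcomp Require Import complex.
From mathcomp Require Import all_classical all_reals all_analysis measurable_realfun.
Import Order.TTheory GRing.Theory Num.Theory.
Import numFieldNormedType.Exports.
Set Implicit Arguments.
Unset Strict Implicit.
Unset Printing Implicit Defensive.
Local Open Scope classical_set_scope.
Local Open Scope ring_scope.

(* Image of (Lebesgue measure on R) x m under (x, t) |-> x :: t. Iterating it
   gives Lebesgue measure on R^N, carried by N.-tuple R. *)
Section cons_measure.
Context {R : realType} {N : nat}.
Variable m : {sigma_finite_measure set (N.-tuple R) -> \bar R}.

Definition cons_pair (z : R * N.-tuple R) : N.+1.-tuple R :=
  [tuple of z.1 :: z.2].

Lemma measurable_cons_pair : measurable_fun [set: R * N.-tuple R] cons_pair.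
Proof. exact: (measurable_cons measurable_fst measurable_snd). Qed.

Definition cons_measure : set (N.+1.-tuple R) -> \bar R :=
  pushforward (lebesgue_measure \x m)%E cons_pair.

Let cons_measure0 : cons_measure set0 = 0%E.
Proof. by rewrite /cons_measure /pushforward preimage_set0 measure0. Qed.

Let cons_measure_ge0 A : (0 <= cons_measure A)%E.
Proof. by rewrite /cons_measure /pushforward measure_ge0. Qed.

Let cons_measure_sigma_additive : semi_sigma_additive cons_measure.
Proof.
move=> F mF tF mUF; rewrite /cons_measure /pushforward preimage_bigcup.
apply: measure_semi_sigma_additive.
- by move=> n; rewrite -[X in measurable X]setTI; exact: measurable_cons_pair.
- apply/trivIsetP => /= i j _ _ ij; rewrite -preimage_setI.
  by move/trivIsetP : tF => /(_ i j Logic.I Logic.I ij) ->; rewrite preimage_set0.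
- rewrite -preimage_bigcup -[X in measurable X]setTI.
  exact: measurable_cons_pair.
Qed.

HB.instance Definition _ := isMeasure.Build _ _ _
  cons_measure cons_measure0 cons_measure_ge0 cons_measure_sigma_additive.

Let uncons (t : N.+1.-tuple R) : R * N.-tuple R := (thead t, [tuple of behead t]).

Let measurable_uncons : measurable_fun [set: N.+1.-tuple R] uncons.
Proof.
apply: measurable_fun_pair => /=.
- exact: measurable_tnth.
- exact: measurable_behead.
Qed.

Let cons_measure_sigma_finite : sigma_finite setT cons_measure.
Proof.
have /sigma_finiteP[F [TF ndF Foo]] :=
  sigma_finiteT (@lebesgue_measure R : {sigma_finite_measure set _ -> \bar R}).
have /sigma_finiteP[G [TG ndG Goo]] := sigma_finiteT m.
exists (fun k => uncons @^-1` (F k `*` G k)).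
  rewrite -preimage_bigcup; apply/esym/seteqP; split=> // t _.
  have [i _ Fi] : (\bigcup_i F i) (uncons t).1 by rewrite -TF.
  have [k _ Gk] : (\bigcup_i G i) (uncons t).2 by rewrite -TG.
  exists (maxn i k) => //; split.
  - by apply: (subsetPset _ _ (ndF _ _ (leq_maxl i k))).
  - by apply: (subsetPset _ _ (ndG _ _ (leq_maxr i k))).
move=> k; have [mF Fk] := Foo k; have [mG Gk] := Goo k; split.
  rewrite -[X in measurable X]setTI; apply: measurable_uncons => //.
  exact: measurableX.
rewrite /cons_measure /pushforward -comp_preimage.
rewrite (_ : uncons \o cons_pair = id) ?preimage_id.
  by rewrite product_measure1E// lte_mul_pinfty// ge0_fin_numE.
by apply/funext => -[x t]; congr pair; exact/val_inj.
Qed.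

HB.instance Definition _ := Measure_isSigmaFinite.Build _ _ _
  cons_measure cons_measure_sigma_finite.

End cons_measure.

Fixpoint lebesgueN (R : realType) (N : nat) :
    {sigma_finite_measure set (N.-tuple R) -> \bar R} :=
  match N with
  | 0 => \d_([tuple] : 0.-tuple R)
  | N'.+1 => cons_measure (lebesgueN R N')
  end.

Section gaussian_measure.
Context {R : realType} {N : nat}.

Definition gauss_density (x : N.-tuple R) : R :=
  (2 * pi) `^ (- (N%:R / 2)) * expR (- (\sum_(j < N) tnth x j ^+ 2) / 2).

Lemma gauss_density_ge0 x : 0 <= gauss_density x.
Proof. by rewrite mulr_ge0 ?powR_ge0 ?expR_ge0. Qed.

Lemma measurable_gauss_density : measurable_fun [set: N.-tuple R] gauss_density.
Proof.
apply: measurable_funM => //; apply: measurableT_comp => //.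
apply: measurable_funM => //; apply: measurableT_comp => //.
by apply: measurable_sum => j; apply: measurable_funX; exact: measurable_tnth.
Qed.

Definition gauss_measure (A : set (N.-tuple R)) : \bar R :=
  (\int[lebesgueN R N]_(x in A) (gauss_density x)%:E)%E.

Let gauss_measure0 : gauss_measure set0 = 0%E.
Proof. by rewrite /gauss_measure integral_set0. Qed.

Let gauss_measure_ge0 A : (0 <= gauss_measure A)%E.
Proof. by apply: integral_ge0 => x _; rewrite lee_fin gauss_density_ge0. Qed.

Let gauss_measure_sigma_additive : semi_sigma_additive gauss_measure.
Proof.
move=> F mF tF mUF; rewrite /gauss_measure ge0_integral_bigcup//.
- apply: is_cvg_ereal_nneg_natsum_cond => n _ _; exact: gauss_measure_ge0.
- apply: measurable_funTS; apply/measurable_EFinP.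
  exact: measurable_gauss_density.
- by move=> x _; rewrite lee_fin gauss_density_ge0.
Qed.

HB.instance Definition _ := isMeasure.Build _ _ _
  gauss_measure gauss_measure0 gauss_measure_ge0 gauss_measure_sigma_additive.

End gaussian_measure.
Arguments gauss_measure : clear implicits.

Local Open Scope complex_scope.

Section gaussian_calculus.
Context {R : realType} {N : nat}.
Implicit Type F : 'rV[R]_N -> R[i].

(* The measurable structure lives on tuples, the normed one on row vectors. *)
Definition vec (t : N.-tuple R) : 'rV[R]_N := \row_j tnth t j.

Definition gauss_Cintegral F : R[i] :=
  (\int[gauss_measure R N]_t complex.Re (F (vec t))) +i*
  (\int[gauss_measure R N]_t complex.Im (F (vec t))).

Definition gauss_norm (p : R) (g : 'rV[R]_N -> R) : \bar R :=
  ('N[gauss_measure R N]_(p%:E) [EFin \o g \o vec])%E.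

Definition hermite (a : {ffun 'I_N -> nat}) : 'rV[R]_N -> R[i] :=
  fun x => gauss_Cintegral
    (fun y => \prod_(j < N) (x ord0 j +i* y ord0 j) ^+ a j).

Definition hermite_ge (d : nat) F : Prop :=
  exists (s : seq {ffun 'I_N -> nat}) (c : {ffun 'I_N -> nat} -> R[i]),
    (forall a, a \in s -> (d <= \sum_(j < N) a j)%N) /\
    forall x, F x = \sum_(a <- s) c a * hermite a x.

Definition partial (j : 'I_N) F : 'rV[R]_N -> R[i] :=
  fun x => 'D_(delta_mx ord0 j) (fun y => complex.Re (F y)) x +i*
           'D_(delta_mx ord0 j) (fun y => complex.Im (F y)) x.

Definition laplacian F : 'rV[R]_N -> R[i] :=
  fun x => \sum_(j < N) partial j (partial j F) x.

Definition ou_generator F : 'rV[R]_N -> R[i] :=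
  fun x => - (laplacian F x - \sum_(j < N) (x ord0 j)%:C * partial j F x).

Definition grad_mod F : 'rV[R]_N -> R :=
  fun x => Num.sqrt (\sum_(j < N) ComplexField.Normc.normc (partial j F x) ^+ 2).

End gaussian_calculus.

Section analytic.
Context {R : realType} {n : nat}.
Implicit Type f : 'rV[R[i]]_n -> R[i].

(* z_j = x_j + i y_j, where (x, y) are the two halves of a vector of R^{2n}. *)
Definition to_complex (v : 'rV[R]_(n + n)) : 'rV[R[i]]_n :=
  \row_j (v ord0 (lshift n j) +i* v ord0 (rshift n j)).

Definition on_real f : 'rV[R]_(n + n) -> R[i] := f \o to_complex.

(* Here R[i] is the scalar field, so differentiability is complex: the
   differential at z is C-linear. *)
Definition analytic f : Prop :=
  forall z, differentiable
    (f : 'rV[(R[i] : numFieldType)]_n -> (R[i] : numFieldType)^o) z.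

Definition analytic_polynomial f : Prop :=
  exists (s : seq {ffun 'I_n -> nat}) (c : {ffun 'I_n -> nat} -> R[i]),
    forall z, f z = \sum_(a <- s) c a * \prod_(j < n) z ord0 j ^+ a j.

End analytic.

(* Main.v *)
Require Import Defs.
From HB Require Import structures.
From mathcomp Require Import all_boot all_order all_algebra.
From mathcomp Require Import complex.
From mathcomp Require Import all_classical all_reals all_analysis measurable_realfun.
From mathcomp Require Import ring lra zify.
From mathcomp Require cyclic separable cyclotomic.
Import Order.TTheory GRing.Theory Num.Theory.
Import numFieldNormedType.Exports.
Local Open Scope classical_set_scope.
Local Open Scope ring_scope.

(** Let [f] be analytic on [C^n] and a combination of Hermite polynomials of
    degree at least [d] in the [2n] real coordinates.

    Shape of [f].  Such an [f] is a polynomial in the real coordinates, and by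
    the Cauchy-Riemann equations its restriction to a complex line is a
    polynomial in one complex variable ([analytic_line_polynomial]).  For a
    standard Gaussian [x], the mean of [f (u + x)] is therefore [f u], because
    the law of [x] is invariant under [x |-> e^(i theta) x]; on the other hand
    the mean of [H_a (u + x)] is the monomial [u^a] ([hermite_mean]).  Hence
    the homogeneous components [f_k] of [f] vanish for [k < d]
    ([hermite_ge_vanish]).  As [f] is harmonic, [L f = sum_k k f_k] by Euler's
    identity ([ou_generator_coef]).

    Multipliers.  If [a] is nonnegative, decreasing and convex, then [a 0],
    [a 1], ... are Fourier coefficients of a positive measure of mass [a 0] on
    the circle (a mixture of Fejer kernels).  Rotation invariance and the
    triangle inequality then bound the [L^p] norm of [sum_j a_j f_(d+j)] by
    [a 0] times that of [f] ([Lpc_multiplier]).  The measure is taken on a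
    finite group of roots of unity, so that only finite sums occur.

    First inequality.  The sequence [a_j = 1 / (d + j)] recovers [f] from
    [L f] ([generator_lower_bound]).

    Second inequality.  For [d > 0] put [a = 1 / sqrt d], [r = cos a].  The
    sequence [r^(d+j)] gives [||f (r .)|| <= r^d ||f||] with [r^d] bounded
    away from [1], so [||f||] is at most a constant times [||f - f (r .)||].
    The number [f (r z)] is the mean over unit [u] of [f (cos a z + u sin a
    w)], so this difference is at most the norm of [f z - f (cos a z + sin a
    w)] for two independent Gaussian vectors [z], [w]
    ([Lpc_radial_difference]).  Cutting the arc from [0] to [a] into [K]
    equal pieces, rotating the pair [(z, w)] and letting [K] grow bounds
    that norm by [a] times the norm of the derivative of [f] at [z] in the
    direction [w] ([Lpc_chord]).  Given [z], this is a linear form in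
    Gaussian variables, whose [p]-th moment is bounded by a constant times
    [|grad f z|^p] in every dimension ([Lpc_dir_deriv]).  Since [a sqrt d =
    1], the inequality follows. *)

Set Implicit Arguments.
Unset Strict Implicit.
Unset Printing Implicit Defensive.

Local Open Scope complex_scope.
Local Notation normc := (@ComplexField.Normc.normc _).
Local Notation Re := (@complex.Re _).
Local Notation Im := (@complex.Im _).

(** * Densities and translations of Lebesgue measure *)

Section density.
Context d (T : measurableType d) (R : realType).
Variables (mu nu : {measure set T -> \bar R}) (g : T -> R).
Hypotheses (mg : measurable_fun [set: T] g) (g0 : forall x, 0 <= g x).
Hypothesis nuE : forall A, measurable A -> nu A = (\int[mu]_(x in A) (g x)%:E)%E.
Import HBNNSimple.

(** Both sides are monotone limits along simple functions, and they agree on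
    indicators by hypothesis. *)
Lemma integral_density (F : T -> \bar R) :
  measurable_fun [set: T] F -> (forall x, 0 <= F x)%E ->
  (\int[nu]_x F x = \int[mu]_x (F x * (g x)%:E))%E.
Proof.
move=> mF F0.
pose h := nnsfun_approx measurableT mF.
have mgE : measurable_fun [set: T] (EFin \o g) by exact/measurable_EFinP.
have cvF x : F x = lim ((EFin \o h n) x @[n --> \oo]).
  by apply/esym/cvg_lim => //; exact: cvg_nnsfun_approx.
have -> : (\int[nu]_x F x =
    lim (\int[nu]_x (EFin \o h n) x @[n --> \oo]))%E.
  under eq_integral do rewrite cvF.
  apply: monotone_convergence => //.
  - by move=> n; apply/measurable_EFinP.
  - by move=> n x _ /=; rewrite lee_fin.
  - by move=> x _ a b ab; rewrite lee_fin; exact/lefP/nd_nnsfun_approx.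
have -> : (\int[mu]_x (F x * (g x)%:E) =
    lim (\int[mu]_x ((h n x)%:E * (g x)%:E) @[n --> \oo]))%E.
  transitivity (\int[mu]_x lim ((h n x)%:E * (g x)%:E @[n --> \oo]))%E.
    apply: eq_integral => x _; apply/esym/cvg_lim => //.
    by apply: cvgeZr => //; exact: cvg_nnsfun_approx.
  apply: monotone_convergence => //.
  - by move=> n; apply/emeasurable_funM => //; apply/measurable_EFinP.
  - by move=> n x _ /=; rewrite mule_ge0 ?lee_fin.
  - move=> x _ a b ab; rewrite lee_wpmul2r ?lee_fin//.
    exact/lefP/nd_nnsfun_approx.
suff suf n : (\int[nu]_x (EFin \o h n) x =
    \int[mu]_x ((h n x)%:E * (g x)%:E))%E by under eq_fun do rewrite suf.
have hE x : ((h n x)%:E =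
    \sum_(y \in range (h n)) (y * \1_(h n @^-1` [set y]) x)%:E)%E.
  by rewrite fimfunE -fsumEFin.
have indich r : measurable_fun [set: T]
    (fun x => (r * \1_(h n @^-1` [set r]) x)%:E).
  by apply/measurable_EFinP; apply: measurable_funM.
transitivity (\int[nu]_x
    (\sum_(y \in range (h n)) (y * \1_(h n @^-1` [set y]) x)%:E))%E.
  by apply: eq_integral => x _; rewrite /= hE.
transitivity (\int[mu]_x (\sum_(y \in range (h n))
    (y * \1_(h n @^-1` [set y]) x)%:E * (g x)%:E))%E; last first.
  apply: eq_integral => x _; rewrite hE ge0_mule_fsuml// => y.
  exact: nnfun_muleindic_ge0.
rewrite ge0_integral_fsum//; last by move=> m y _; exact: nnfun_muleindic_ge0.
rewrite ge0_integral_fsum//; last 2 first.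
  - by move=> y; apply: emeasurable_funM.
  - by move=> m y _; rewrite mule_ge0 ?lee_fin ?g0// -lee_fin nnfun_muleindic_ge0.
apply: eq_fsbigr => r /[!inE] -[t _ rE].
have r0 : 0 <= r by rewrite -rE.
have mr : measurable (h n @^-1` [set r]) by [].
under eq_integral do rewrite EFinM.
rewrite integralZl_indic_nnsfun// integral_indic// setIT nuE//.
under [RHS]eq_integral do rewrite EFinM -muleA.
rewrite ge0_integralZl//; last 2 first.
- by apply: emeasurable_funM => //; apply/measurable_EFinP.
- by move=> x _; rewrite mule_ge0 ?lee_fin.
congr (_ * _)%E; rewrite integral_mkcond; apply: eq_integral => x _.
by rewrite epatch_indic muleC.
Qed.

End density.

Section lebesgue_translation.
Context (R : realType).

Lemma measurable_shiftR (c : R) :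
  measurable_fun [set: measurableTypeR R] (fun x : measurableTypeR R => x + c : measurableTypeR R).
Proof. by apply: measurable_funD. Qed.

(** Lebesgue measure is determined by half-open intervals, whose lengths a
    translation preserves. *)
Lemma lebesgue_translation (c : R) (F : measurableTypeR R -> \bar R) :
  measurable_fun [set: measurableTypeR R] F -> (forall x, 0 <= F x)%E ->
  (\int[lebesgue_measure]_x F (x + c)%R = \int[lebesgue_measure]_x F x)%E.
Proof.
move=> mF F0.
have -> : (\int[lebesgue_measure]_x F (x + c)%R =
  \int[pushforward lebesgue_measure (fun x : measurableTypeR R => x + c : measurableTypeR R)%R]_x F x)%E.
  by rewrite ge0_integral_pushforward//; exact: measurable_shiftR.
apply: eq_measure_integral => [|mf A mA _]; first exact: measurable_shiftR.
symmetry; move: A mA.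
apply: lebesgue_measure_unique => X [[a b] _ <-] /=.
rewrite /pushforward (_ : _ @^-1` _ = `](a - c), (b - c)]%classic); last first.
  by apply/seteqP; split => x /=; rewrite !in_itv/= ltrBlDr lerBrDr.
by rewrite !lebesgue_measure_itv/= !lte_fin ltrD2r -!EFinD opprB addrA subrK.
Qed.
End lebesgue_translation.

Section tuples.
Context (R : realType).
Implicit Types N : nat.

Definition tuple_lin N (a b : R) (x y : N.-tuple R) : N.-tuple R :=
  [tuple a * tnth x i + b * tnth y i | i < N].

Lemma measurable_tuple_lin d (T : measurableType d) N (a b : R) (f g : T -> N.-tuple R) :
  measurable_fun [set: T] f -> measurable_fun [set: T] g ->
  measurable_fun [set: T] (fun t => tuple_lin a b (f t) (g t)).
Proof.
move=> mf mg; apply/measurable_fun_tnthP => i /=.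
rewrite (_ : _ \o _ = fun t => a * tnth (f t) i + b * tnth (g t) i); last first.
  by apply/funext => t /=; rewrite tnth_mktuple.
by apply: measurable_funD; apply: measurable_funM => //;
  apply: (measurableT_comp (measurable_tnth i)).
Qed.

Lemma lebesgueN_cons N (F : N.+1.-tuple R -> \bar R) :
  measurable_fun [set: N.+1.-tuple R] F -> (forall x, 0 <= F x)%E ->
  (\int[lebesgueN R N.+1]_t F t =
   \int[lebesgue_measure]_s \int[lebesgueN R N]_t F [tuple of s :: t])%E.
Proof.
move=> mF F0.
transitivity (\int[lebesgue_measure \x lebesgueN R N]_z F (cons_pair z))%E.
  have mc : measurable_fun [set: measurableTypeR R * N.-tuple R] (@cons_pair R N).
    exact: measurable_cons_pair.
  by rewrite -(ge0_integral_pushforward mc (lebesgue_measure \x lebesgueN R N)%E measurableT mF).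
rewrite fubini_tonelli1//.
by apply: measurableT_comp => //; exact: measurable_cons_pair.
Qed.

Lemma measurable_sections N (F : N.+1.-tuple R -> \bar R) :
  measurable_fun [set: N.+1.-tuple R] F ->
  measurable_fun [set: R * N.-tuple R] (fun z => F [tuple of z.1 :: z.2]).
Proof.
by move=> mF; apply: (measurableT_comp mF); exact: measurable_cons_pair.
Qed.

Lemma tuple_lin_cons N (b s : R) (x : N.-tuple R) (c : N.+1.-tuple R) :
  tuple_lin 1 b [tuple of s :: x] c =
  [tuple of s + b * thead c :: tuple_lin 1 b x [tuple of behead c]].
Proof.
apply: eq_from_tnth => i; rewrite tnth_mktuple.
case: (unliftP ord0 i) => [j ->|->]; last by rewrite !tnth0 mul1r.
rewrite !tnthS tnth_mktuple !mul1r; congr (_ + b * _).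
by rewrite [in LHS](tuple_eta c) tnthS.
Qed.

(** Tonelli separates the first coordinate, translated by the one-dimensional
    statement, from the others, translated by induction. *)
Lemma lebesgueN_translation N (b : R) (c : N.-tuple R) (F : N.-tuple R -> \bar R) :
  measurable_fun [set: N.-tuple R] F -> (forall x, 0 <= F x)%E ->
  (\int[lebesgueN R N]_t F (tuple_lin 1 b t c) = \int[lebesgueN R N]_t F t)%E.
Proof.
elim: N c F => [|N IH] c F mF F0.
  by apply: eq_integral => t _; rewrite [tuple_lin _ _ _ _]tuple0 [t]tuple0.
have mt : measurable_fun [set: N.+1.-tuple R] (fun t => F (tuple_lin 1 b t c)).
  by apply: (measurableT_comp mF); apply: measurable_tuple_lin.
rewrite !lebesgueN_cons//.
have mG : measurable_fun [set: measurableTypeR R]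
    (fun s : measurableTypeR R => \int[lebesgueN R N]_t F [tuple of s :: t])%E.
  apply: (@measurable_fun_fubini_tonelli_F _ _ (measurableTypeR R) _ _ _
    (fun z : measurableTypeR R * N.-tuple R => F [tuple of z.1 :: z.2])) => //.
  exact: measurable_sections.
rewrite -[RHS](lebesgue_translation (b * thead c) mG); last first.
  by move=> x; apply: integral_ge0.
apply: eq_integral => s _.
under eq_integral do rewrite tuple_lin_cons.
apply: (IH [tuple of behead c] (fun x => F [tuple of s + b * thead c :: x])) => //.
by apply: (measurableT_comp mF); apply: measurable_cons.
Qed.

End tuples.

(** * Rotation invariance of a Gaussian pair *)

Section shears.
Context (R : realType) (N : nat).
Local Notation T := (N.-tuple R).
Local Notation l := (lebesgueN R N).

(** With the second block fixed, a shear is a translation of the first one. *)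
Lemma lebesgueN_shear_fst (b : R) (F : T * T -> \bar R) :
  measurable_fun [set: T * T] F -> (forall z, 0 <= F z)%E ->
  (\int[l \x l]_z F (tuple_lin 1 b z.1 z.2, z.2) = \int[l \x l]_z F z)%E.
Proof.
move=> mF F0.
rewrite (fubini_tonelli2 F mF F0) fubini_tonelli2//; last first.
  apply: (measurableT_comp mF); apply: measurable_fun_pair => //.
  exact: measurable_tuple_lin.
apply: eq_integral => y _; rewrite /fubini_G /=.
apply: (lebesgueN_translation b y (F := fun x => F (x, y))) => //.
by apply: (measurableT_comp mF); apply: measurable_fun_pair.
Qed.

Lemma lebesgueN_shear_snd (b : R) (F : T * T -> \bar R) :
  measurable_fun [set: T * T] F -> (forall z, 0 <= F z)%E ->
  (\int[l \x l]_z F (z.1, tuple_lin 1 b z.2 z.1) = \int[l \x l]_z F z)%E.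
Proof.
move=> mF F0.
rewrite (fubini_tonelli1 F mF F0) fubini_tonelli1//; last first.
  apply: (measurableT_comp mF); apply: measurable_fun_pair => //.
  exact: measurable_tuple_lin.
apply: eq_integral => x _; rewrite /fubini_F /=.
apply: (lebesgueN_translation b x (F := fun y => F (x, y))) => //.
by apply: (measurableT_comp mF); apply: measurable_fun_pair.
Qed.

Definition pair_rot (c s : R) (z : T * T) : T * T :=
  (tuple_lin c (- s) z.1 z.2, tuple_lin s c z.1 z.2).

Lemma measurable_pair_rot c s : measurable_fun [set: T * T] (pair_rot c s).
Proof. by apply: measurable_fun_pair; apply: measurable_tuple_lin. Qed.

Lemma tuple_linE a b (x y : T) i : tnth (tuple_lin a b x y) i = a * tnth x i + b * tnth y i.
Proof. by rewrite tnth_mktuple. Qed.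

(** A rotation other than the half turn is a product of three shears. *)
Let lebesgueN_rot_generic (c s : R) (F : T * T -> \bar R) :
  c ^+ 2 + s ^+ 2 = 1 -> 1 + c != 0 ->
  measurable_fun [set: T * T] F -> (forall z, 0 <= F z)%E ->
  (\int[l \x l]_z F (pair_rot c s z) = \int[l \x l]_z F z)%E.
Proof.
move=> cs c1 mF F0; pose t := s / (1 + c).
(* [t] is the tangent of half the angle *)
pose f1 (z : T * T) := (tuple_lin 1 (- t) z.1 z.2, z.2).
pose f2 (z : T * T) := (z.1, tuple_lin 1 s z.2 z.1).
have mf1 : measurable_fun [set: T * T] f1.
  by apply: measurable_fun_pair => //; apply: measurable_tuple_lin.
have mf2 : measurable_fun [set: T * T] f2.
  by apply: measurable_fun_pair => //; apply: measurable_tuple_lin.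
have tc : t * (1 + c) = s by rewrite /t divfK.
have ts : t * s = 1 - c.
  apply: (mulIf c1); rewrite mulrAC tc -expr2 -(addrK (c ^+ 2) (s ^+ 2)) (addrC (s ^+ 2)) cs.
  ring.
have E z : pair_rot c s z = f1 (f2 (f1 z)).
  case: z => x y; congr pair; apply: eq_from_tnth => i; rewrite /= !tuple_linE /=.
  - set X := tnth x i; set Y := tnth y i.
    have -> : 1 * (1 * X + - t * Y) + - t * (1 * Y + s * (1 * X + - t * Y)) =
       (1 - t * s) * X - (t + t - t * (t * s)) * Y by ring.
    rewrite ts; have -> : t + t - t * (1 - c) = t * (1 + c) by ring.
    by rewrite tc; ring.
  - set X := tnth x i; set Y := tnth y i.
    have -> : 1 * Y + s * (1 * X + - t * Y) = s * X + (1 - t * s) * Y by ring.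
    by rewrite ts; ring.
under eq_integral do rewrite E.
rewrite -[RHS](lebesgueN_shear_fst (- t))//.
rewrite -[RHS](lebesgueN_shear_snd s (F := F \o f1)); last 2 first.
- exact: (measurableT_comp mF mf1).
- by move=> z; exact: F0.
rewrite -[RHS](lebesgueN_shear_fst (- t) (F := F \o f1 \o f2))//; last first.
  by move=> z; exact: F0.
exact: (measurableT_comp (measurableT_comp mF mf1) mf2).
Qed.

(** The half turn, which the shears miss, is the square of a quarter turn. *)
Lemma lebesgueN_rot (c s : R) (F : T * T -> \bar R) :
  c ^+ 2 + s ^+ 2 = 1 ->
  measurable_fun [set: T * T] F -> (forall z, 0 <= F z)%E ->
  (\int[l \x l]_z F (pair_rot c s z) = \int[l \x l]_z F z)%E.
Proof.
move=> cs mF F0.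
have [c1|] := eqVneq (1 + c) 0; last by move=> ?; exact: lebesgueN_rot_generic.
have {}c1 : c = -1 by apply/eqP; rewrite -addr_eq0 addrC c1.
have s0 : s = 0.
  by apply/eqP; rewrite -sqrf_eq0 -(addrK (c ^+ 2) (s ^+ 2)) addrC (addrC (s ^+ 2))
    cs c1 sqrrN expr1n addNr.
have i1 : 0 ^+ 2 + 1 ^+ 2 = 1 :> R by rewrite expr0n expr1n add0r.
have i0 : 1 + 0 != 0 :> R by rewrite addr0 oner_neq0.
have E z : pair_rot c s z = pair_rot 0 1 (pair_rot 0 1 z).
  by case: z => x y; congr pair; apply: eq_from_tnth => i; rewrite /= !tuple_linE c1 s0; ring.
under eq_integral do rewrite E.
rewrite (lebesgueN_rot_generic (F := F \o pair_rot 0 1) i1 i0); last 2 first.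
- by apply: (measurableT_comp mF); exact: measurable_pair_rot.
- by move=> z; exact: F0.
exact: (lebesgueN_rot_generic (F := F)).
Qed.

End shears.

Section gaussian.
Context (R : realType).
Implicit Types N : nat.

Lemma integral_gauss N (F : N.-tuple R -> \bar R) :
  measurable_fun [set: N.-tuple R] F -> (forall x, 0 <= F x)%E ->
  (\int[gauss_measure R N]_x F x =
   \int[lebesgueN R N]_x (F x * (gauss_density x)%:E))%E.
Proof.
by move=> mF F0; apply: integral_density => //;
  [exact: measurable_gauss_density|exact: gauss_density_ge0].
Qed.

Lemma gauss_density_cons N (s : R) (t : N.-tuple R) :
  gauss_density [tuple of s :: t] = normal_pdf 0 1 s * gauss_density t.
Proof.
rewrite /gauss_density big_ord_recl tnth0.
under eq_bigr do rewrite tnthS.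
rewrite normal_pdfE ?oner_neq0// /normal_peak /normal_fun subr0 expr1n mul1r.
have p0 : 0 <= 2 * pi :> R by rewrite mulr_ge0// pi_ge0.
have p1 : 2 * pi != 0 :> R by rewrite mulf_neq0// gt_eqF// pi_gt0.
have -> : - (N.+1%:R / 2) = - (1/2) + - (N%:R / 2) :> R by rewrite -natr1; field.
rewrite powRD; last by rewrite (negbTE p1) implybT.
rewrite powRN mul1r powR12_sqrt// -(mulr_natl pi 2).
rewrite [in RHS]mulrACA -expRD; congr (_ * expR _).
by rewrite -mulrDl opprD.
Qed.

Lemma gauss_measureT N : gauss_measure R N [set: N.-tuple R] = 1%E.
Proof.
rewrite /gauss_measure; elim: N => [|N IH].
  rewrite /= integral_dirac//=; last first.
    by apply/measurable_EFinP; exact: measurable_gauss_density.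
  by rewrite diracT mul1e /gauss_density big_ord0 mul0r oppr0 powRr0 mul0r expR0 mulr1.
rewrite lebesgueN_cons; last 2 first.
- by apply/measurable_EFinP; exact: measurable_gauss_density.
- by move=> x; rewrite lee_fin gauss_density_ge0.
rewrite -[RHS](integral_normal_pdf 0 1); apply: eq_integral => s _.
under eq_integral do rewrite gauss_density_cons EFinM.
rewrite ge0_integralZl//; last 3 first.
- by apply/measurable_EFinP; exact: measurable_gauss_density.
- by move=> x _; rewrite lee_fin gauss_density_ge0.
- by rewrite lee_fin normal_pdf_ge0.
by rewrite IH mule1.
Qed.

HB.instance Definition _ N := Measure_isProbability.Build _ _ R
  (gauss_measure R N) (gauss_measureT N).

Lemma integral_gauss2 n m (F : n.-tuple R * m.-tuple R -> \bar R) :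
  measurable_fun [set: n.-tuple R * m.-tuple R] F -> (forall z, 0 <= F z)%E ->
  (\int[gauss_measure R n \x gauss_measure R m]_z F z =
   \int[lebesgueN R n \x lebesgueN R m]_z
     (F z * (gauss_density z.1 * gauss_density z.2)%:E))%E.
Proof.
move=> mF F0.
have mg k : measurable_fun [set: k.-tuple R] (EFin \o @gauss_density R k).
  by apply/measurable_EFinP; exact: measurable_gauss_density.
rewrite fubini_tonelli1// integral_gauss//; last 2 first.
- exact: measurable_fun_fubini_tonelli_F.
- by move=> x; apply: integral_ge0.
rewrite fubini_tonelli1//; last 2 first.
- apply: emeasurable_funM => //; apply/measurable_EFinP; apply: measurable_funM.
    by apply: measurableT_comp => //; exact: measurable_gauss_density.
  by apply: measurableT_comp => //; exact: measurable_gauss_density.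
- by move=> z; rewrite mule_ge0// lee_fin mulr_ge0// gauss_density_ge0.
apply: eq_integral => x _; rewrite /fubini_F /= integral_gauss//; last first.
  by apply: (measurableT_comp mF); apply: measurable_fun_pair.
rewrite muleC -ge0_integralZl//; last 3 first.
- apply: emeasurable_funM; last exact: mg.
  by apply: (measurableT_comp mF); apply: measurable_fun_pair.
- by move=> y _; rewrite mule_ge0// lee_fin gauss_density_ge0.
- by rewrite lee_fin gauss_density_ge0.
by apply: eq_integral => y _; rewrite EFinM muleCA.
Qed.

Section rotation.
Variable N : nat.
Local Notation T := (N.-tuple R).
Local Notation g := (gauss_measure R N).
Local Notation l := (lebesgueN R N).

(** The density of the pair depends on the sums [x_i ^+ 2 + y_i ^+ 2] only,
    and rotations preserve Lebesgue measure. *)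
Lemma gauss2_rot (c s : R) (F : T * T -> \bar R) :
  c ^+ 2 + s ^+ 2 = 1 ->
  measurable_fun [set: T * T] F -> (forall z, 0 <= F z)%E ->
  (\int[g \x g]_z F (pair_rot c s z) = \int[g \x g]_z F z)%E.
Proof.
move=> cs mF F0.
rewrite (integral_gauss2 mF F0) integral_gauss2//; last first.
  by apply: (measurableT_comp mF); exact: measurable_pair_rot.
rewrite -[RHS](lebesgueN_rot cs); last 2 first.
- apply: emeasurable_funM => //; apply/measurable_EFinP; apply: measurable_funM.
    by apply: measurableT_comp => //; exact: measurable_gauss_density.
  by apply: measurableT_comp => //; exact: measurable_gauss_density.
- by move=> z; rewrite mule_ge0// lee_fin mulr_ge0// gauss_density_ge0.
apply: eq_integral => -[x y] _; congr (_ * _%:E)%E.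
rewrite /gauss_density /= [LHS]mulrACA [RHS]mulrACA; congr (_ * _).
rewrite -!expRD; congr expR; rewrite -[LHS]mulrDl -[RHS]mulrDl; congr (_ / _).
rewrite -[LHS]opprD -[RHS]opprD; congr (- _).
rewrite -!big_split; apply: eq_bigr => i _; rewrite !tuple_linE /=.
transitivity ((c ^+ 2 + s ^+ 2) * (tnth x i ^+ 2 + tnth y i ^+ 2)).
  by rewrite cs mul1r.
rewrite /=; ring.
Qed.

End rotation.

End gaussian.

(** * Rotations of complex coordinates *)

Section cat.
Context (R : realType).
Implicit Types n m N : nat.

Lemma measurable_cat d (T : measurableType d) n m
    (f : T -> n.-tuple R) (g : T -> m.-tuple R) :
  measurable_fun [set: T] f -> measurable_fun [set: T] g ->
  measurable_fun [set: T] (fun t => [the (n + m).-tuple R of f t ++ g t]).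
Proof.
move=> mf mg; apply/measurable_fun_tnthP => i /=.
case: (split_ordP i) => j ->.
- rewrite (_ : _ \o _ = fun t => tnth (f t) j); last first.
    by apply/funext => t /=; rewrite tnth_lshift.
  exact: (measurableT_comp (measurable_tnth j)).
- rewrite (_ : _ \o _ = fun t => tnth (g t) j); last first.
    by apply/funext => t /=; rewrite tnth_rshift.
  exact: (measurableT_comp (measurable_tnth j)).
Qed.

(** The two halves [(x, y)] of a vector of [R^(n + n)] carry the complex
    structure, so Gaussian integrals over it are reduced to pairs of blocks. *)
Lemma lebesgueN_cat n m (F : (n + m).-tuple R -> \bar R) :
  measurable_fun [set: (n + m).-tuple R] F -> (forall x, 0 <= F x)%E ->
  (\int[lebesgueN R (n + m)]_t F t =
   \int[lebesgueN R n \x lebesgueN R m]_z F [tuple of z.1 ++ z.2])%E.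
Proof.
move=> mF F0.
have mFc k (G : (k + m).-tuple R -> \bar R) : measurable_fun [set: (k + m).-tuple R] G ->
    measurable_fun [set: k.-tuple R * m.-tuple R] (fun z => G [tuple of z.1 ++ z.2]).
  by move=> mG; apply: (measurableT_comp mG); exact: measurable_cat.
rewrite fubini_tonelli1//; last exact: mFc.
elim: n F mF F0 => [|n IH] F mF F0.
  rewrite [RHS](integral_dirac _ measurableT)/=; last first.
    apply: measurable_fun_fubini_tonelli_F => //.
    exact: mFc.
  rewrite diracT mul1e; apply: eq_integral => y _ /=.
  by congr F; apply: val_inj.
rewrite [LHS](@lebesgueN_cons _ (n + m) F mF F0).
rewrite [RHS]lebesgueN_cons; last 2 first.
- apply: measurable_fun_fubini_tonelli_F => //.
  exact: mFc.
- by move=> x; apply: integral_ge0.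
apply: eq_integral => s _.
have mFs : measurable_fun [set: (n + m).-tuple R] (fun t => F [tuple of s :: t]).
  by apply: (measurableT_comp mF); apply: measurable_cons.
transitivity (\int[lebesgueN R (n + m)]_t F [tuple of s :: t])%E; first by [].
rewrite [LHS](IH _ mFs (fun t => F0 _)).
apply: eq_integral => x _; apply: eq_integral => y _ /=.
by congr F; apply: val_inj.
Qed.

Lemma gauss_density_cat n m (x : n.-tuple R) (y : m.-tuple R) :
  gauss_density [tuple of x ++ y] = gauss_density x * gauss_density y.
Proof.
rewrite /gauss_density big_split_ord /=.
under eq_bigr do rewrite tnth_lshift.
under [X in _ + X]eq_bigr do rewrite tnth_rshift.
rewrite [in RHS]mulrACA -expRD; congr (_ * expR _); last first.
  by rewrite -[RHS]mulrDl opprD.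
have p1 : 2 * pi != 0 :> R by rewrite mulf_neq0// gt_eqF// pi_gt0.
rewrite -powRD; last by rewrite p1 implybT.
by congr (_ `^ _); rewrite (natrD _ n m); lra.
Qed.

Lemma gauss_cat n m (F : (n + m).-tuple R -> \bar R) :
  measurable_fun [set: (n + m).-tuple R] F -> (forall x, 0 <= F x)%E ->
  (\int[gauss_measure R (n + m)]_t F t =
   \int[gauss_measure R n \x gauss_measure R m]_z F [tuple of z.1 ++ z.2])%E.
Proof.
move=> mF F0.
have mg N : measurable_fun [set: N.-tuple R] (EFin \o @gauss_density R N).
  by apply/measurable_EFinP; exact: measurable_gauss_density.
have mFc : measurable_fun [set: n.-tuple R * m.-tuple R] (fun z => F [tuple of z.1 ++ z.2]).
  by apply: (measurableT_comp mF); exact: measurable_cat.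
rewrite integral_gauss// lebesgueN_cat; last 2 first.
- by apply: emeasurable_funM => //; exact: mg.
- by move=> x; rewrite mule_ge0// lee_fin gauss_density_ge0.
rewrite integral_gauss2//; apply: eq_integral => z _.
by rewrite gauss_density_cat.
Qed.

Definition tfst n m (t : (n + m).-tuple R) : n.-tuple R :=
  [tuple tnth t (lshift m i) | i < n].
Definition tsnd n m (t : (n + m).-tuple R) : m.-tuple R :=
  [tuple tnth t (rshift n i) | i < m].

Lemma tfst_cat n m (x : n.-tuple R) (y : m.-tuple R) : tfst [tuple of x ++ y] = x.
Proof. by apply: eq_from_tnth => i; rewrite tnth_mktuple tnth_lshift. Qed.

Lemma tsnd_cat n m (x : n.-tuple R) (y : m.-tuple R) : tsnd [tuple of x ++ y] = y.
Proof. by apply: eq_from_tnth => i; rewrite tnth_mktuple tnth_rshift. Qed.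

Lemma measurable_tfst n m : measurable_fun [set: (n + m).-tuple R] (@tfst n m).
Proof.
apply/measurable_fun_tnthP => i /=.
rewrite (_ : _ \o _ = (@tnth _ R)^~ (lshift m i)); first exact: measurable_tnth.
by apply/funext => t /=; rewrite tnth_mktuple.
Qed.

Lemma measurable_tsnd n m : measurable_fun [set: (n + m).-tuple R] (@tsnd n m).
Proof.
apply/measurable_fun_tnthP => i /=.
rewrite (_ : _ \o _ = (@tnth _ R)^~ (rshift n i)); first exact: measurable_tnth.
by apply/funext => t /=; rewrite tnth_mktuple.
Qed.

(** Multiplication by the complex number [c + i s] on [C^n], read on the
    real coordinates [(x, y)]. *)
Definition complex_rot n (c s : R) (t : (n + n).-tuple R) : (n + n).-tuple R :=
  let z := pair_rot c s (tfst t, tsnd t) in [tuple of z.1 ++ z.2].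

Lemma measurable_complex_rot n c s : measurable_fun [set: (n + n).-tuple R] (@complex_rot n c s).
Proof.
by apply: measurable_cat; apply: measurable_tuple_lin;
  (exact: measurable_tfst || exact: measurable_tsnd).
Qed.

Lemma gauss_complex_rot n (c s : R) (F : (n + n).-tuple R -> \bar R) :
  c ^+ 2 + s ^+ 2 = 1 ->
  measurable_fun [set: (n + n).-tuple R] F -> (forall x, 0 <= F x)%E ->
  (\int[gauss_measure R (n + n)]_t F (complex_rot c s t) =
   \int[gauss_measure R (n + n)]_t F t)%E.
Proof.
move=> cs mF F0.
rewrite [RHS]gauss_cat// [LHS]gauss_cat//; last first.
  by apply: (measurableT_comp mF); exact: measurable_complex_rot.
rewrite -[RHS](gauss2_rot cs)//; last first.
  by apply: (measurableT_comp mF); exact: measurable_cat.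
apply: eq_integral => z _; rewrite /complex_rot tfst_cat tsnd_cat.
by case: z.
Qed.

Lemma vec_complex_rot n c s (t : (n + n).-tuple R) :
  to_complex (vec (complex_rot c s t)) = Complex c s *: to_complex (vec t).
Proof.
apply/rowP => j; rewrite !mxE tnth_lshift tnth_rshift !tuple_linE !tnth_mktuple /=.
by congr (_ +i* _); rewrite ?mulNr// addrC.
Qed.

Lemma vec_cat n m (x : n.-tuple R) (y : m.-tuple R) :
  vec [tuple of x ++ y] = row_mx (vec x) (vec y).
Proof.
apply/rowP => j; rewrite mxE; case: (split_ordP j) => k ->.
- by rewrite tnth_lshift row_mxEl mxE.
- by rewrite tnth_rshift row_mxEr mxE.
Qed.

Lemma vec_tuple_lin N a b (x y : N.-tuple R) : vec (tuple_lin a b x y) = a *: vec x + b *: vec y.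
Proof. by apply/rowP => j; rewrite !mxE tuple_linE. Qed.

End cat.

(** * Norms of complex-valued functions *)

Section cmeasurable.
Context (R : realType) d (T : measurableType d).
Implicit Types F G : T -> R[i].

Definition cmeasurable F :=
  measurable_fun [set: T] (Re \o F) /\ measurable_fun [set: T] (Im \o F).

Lemma cmeasurable_cst c : cmeasurable (fun=> c).
Proof. by split; apply: measurable_cst. Qed.

Lemma cmeasurableD F G : cmeasurable F -> cmeasurable G -> cmeasurable (fun t => F t + G t).
Proof.
move=> [F1 F2] [G1 G2]; split.
- rewrite (_ : _ \o _ = (Re \o F) \+ (Re \o G)); last first.
    by apply/funext => t /=; case: (F t) (G t) => [? ?] [? ?].
  exact: measurable_funD.
- rewrite (_ : _ \o _ = (Im \o F) \+ (Im \o G)); last first.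
    by apply/funext => t /=; case: (F t) (G t) => [? ?] [? ?].
  exact: measurable_funD.
Qed.

Lemma cmeasurableM F G : cmeasurable F -> cmeasurable G -> cmeasurable (fun t => F t * G t).
Proof.
move=> [F1 F2] [G1 G2]; split.
- rewrite (_ : _ \o _ = (Re \o F) \* (Re \o G) \- (Im \o F) \* (Im \o G)); last first.
    by apply/funext => t /=; case: (F t) (G t) => [? ?] [? ?].
  by apply: measurable_funB; apply: measurable_funM.
- rewrite (_ : _ \o _ = (Re \o F) \* (Im \o G) \+ (Im \o F) \* (Re \o G)); last first.
    by apply/funext => t /=; case: (F t) (G t) => [? ?] [? ?].
  by apply: measurable_funD; apply: measurable_funM.
Qed.

Lemma cmeasurable_sum (I : Type) (r : seq I) (F : I -> T -> R[i]) :
  (forall i, cmeasurable (F i)) -> cmeasurable (fun t => \sum_(i <- r) F i t).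
Proof.
move=> mF; elim: r => [|i r IH].
  rewrite (_ : (fun t => _) = fun=> 0); last by apply/funext => t; rewrite big_nil.
  exact: cmeasurable_cst.
rewrite (_ : (fun t => _) = fun t => F i t + \sum_(j <- r) F j t); last first.
  by apply/funext => t; rewrite big_cons.
exact: cmeasurableD.
Qed.

Lemma cmeasurable_real (f : T -> R) : measurable_fun [set: T] f ->
  cmeasurable (fun t => (f t)%:C).
Proof. by move=> mf; split => //=; apply: measurable_cst. Qed.

Lemma normcE (z : R[i]) :
  normc z = Num.sqrt (Re z ^+ 2 + Im z ^+ 2).
Proof. by case: z. Qed.

Lemma normc_ge0 (z : R[i]) : 0 <= normc z.
Proof. by rewrite normcE sqrtr_ge0. Qed.

Lemma normcR (x : R) : normc (x%:C) = `|x|.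
Proof. by rewrite normcE /= expr0n addr0 sqrtr_sqr. Qed.

Lemma normcX (z : R[i]) k : normc (z ^+ k) = normc z ^+ k.
Proof.
elim: k => [|k IH]; first by rewrite !expr0 ComplexField.Normc.normc1.
by rewrite !exprS ComplexField.Normc.normcM IH.
Qed.

Lemma measurable_normc F : cmeasurable F -> measurable_fun [set: T] (normc \o F).
Proof.
move=> [F1 F2].
rewrite (_ : _ \o _ = (fun x => x `^ 2^-1) \o
    (fun t => Re (F t) ^+ 2 + Im (F t) ^+ 2)); last first.
  by apply/funext => t; rewrite /= normcE powR12_sqrt// addr_ge0// sqr_ge0.
apply: (measurableT_comp (measurable_powR _)).
by apply: measurable_funD; apply: measurable_funX.
Qed.

End cmeasurable.

Lemma cmeasurable_comp (R : realType) d d' (T : measurableType d) (T' : measurableType d')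
    (F : T' -> R[i]) (h : T -> T') :
  cmeasurable F -> measurable_fun [set: T] h -> cmeasurable (F \o h).
Proof. by move=> [F1 F2] mh; split; [exact: (measurableT_comp F1)|exact: (measurableT_comp F2)]. Qed.

Section Lp.
Context (R : realType) d (T : measurableType d) (mu : {measure set T -> \bar R}) (p : R).
Hypothesis p1 : 1 <= p.
Implicit Types F G : T -> R[i].

Definition Lpc F : \bar R := ('N[mu]_(p%:E) [EFin \o (normc \o F)])%E.

Let p0 : 0 < p. Proof. exact: lt_le_trans p1. Qed.

Lemma LpcE F : Lpc F = ((\int[mu]_t ((normc (F t)) `^ p)%:E) `^ p^-1)%E.
Proof.
rewrite /Lpc Lnorm.unlock; congr (_ `^ _)%E; apply: eq_integral => t _.
by rewrite /= ger0_norm ?normc_ge0.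
Qed.

Lemma Lpc_ge0 F : (0 <= Lpc F)%E. Proof. exact: Lnorm_ge0. Qed.

Lemma measurable_normcX F : cmeasurable F ->
  measurable_fun [set: T] (fun t => ((normc (F t)) `^ p)%:E).
Proof.
move=> mF; apply/measurable_EFinP.
exact: (measurableT_comp (measurable_powR _) (measurable_normc mF)).
Qed.

Lemma Lnorm_le (g h : T -> R) : measurable_fun [set: T] g -> measurable_fun [set: T] h ->
  (forall t, 0 <= g t) -> (forall t, g t <= h t) ->
  ('N[mu]_(p%:E) [EFin \o g] <= 'N[mu]_(p%:E) [EFin \o h])%E.
Proof.
move=> mg mh g0 gh; rewrite Lnorm.unlock.
have h0 t : 0 <= h t by exact: le_trans (gh t).
have me (k : T -> R) : measurable_fun [set: T] k ->
    measurable_fun [set: T] (fun t => (`|(EFin \o k) t| `^ p)%E).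
  move=> mk; apply: (measurableT_comp (measurable_poweR _)).
  by apply: measurableT_comp => //; exact/measurable_EFinP.
apply: gt0_ler_poweR.
- by rewrite invr_ge0 ltW.
- by rewrite in_itv /= leey integral_ge0// => t _; exact: poweR_ge0.
- by rewrite in_itv /= leey integral_ge0// => t _; exact: poweR_ge0.
apply: ge0_le_integral => //; [by move=> t _; exact: poweR_ge0|exact: me|exact: me|].
move=> t _ /=; rewrite lee_fin !ger0_norm//.
by apply: ge0_ler_powR; rewrite ?nnegrE// ltW.
Qed.

Lemma Lpc_le F G : cmeasurable F -> cmeasurable G ->
  (forall t, normc (F t) <= normc (G t)) -> (Lpc F <= Lpc G)%E.
Proof.
move=> mF mG FG; apply: Lnorm_le => //; try exact: measurable_normc.
by move=> t; exact: normc_ge0.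
Qed.

Lemma eq_Lpc F G : F =1 G -> Lpc F = Lpc G.
Proof. by move=> /funext ->. Qed.

Lemma LpcD F G : cmeasurable F -> cmeasurable G ->
  (Lpc (fun t => F t + G t)%R <= Lpc F + Lpc G)%E.
Proof.
move=> mF mG.
have mF' := measurable_normc mF; have mG' := measurable_normc mG.
apply: le_trans (minkowski_EFin mu mF' mG' p1).
apply: Lnorm_le.
- exact: (measurable_normc (cmeasurableD mF mG)).
- exact: measurable_funD.
- by move=> t; exact: normc_ge0.
- by move=> t; exact: le_normcD.
Qed.

Lemma LpcZ c F : cmeasurable F ->
  (Lpc (fun t => c * F t)%R = (normc c)%:E * Lpc F)%E.
Proof.
move=> mF; rewrite !LpcE.
under eq_integral do rewrite ComplexField.Normc.normcM powRM ?normc_ge0// EFinM.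
rewrite ge0_integralZl//; last 3 first.
- exact: measurable_normcX.
- by move=> t _; rewrite lee_fin powR_ge0.
- by rewrite lee_fin powR_ge0.
rewrite poweRM; last 2 first.
- by rewrite lee_fin powR_ge0.
- by apply: integral_ge0 => t _; rewrite lee_fin powR_ge0.
congr (_ * _)%E; rewrite poweR_EFin -powRrM mulfV ?gt_eqF// powRr1//.
exact: normc_ge0.
Qed.

Lemma Lpc0 : Lpc (fun=> 0) = 0%E.
Proof.
rewrite LpcE; under eq_integral do rewrite ComplexField.Normc.normc0 powR0 ?gt_eqF//.
by rewrite integral0 poweR0r// invr_eq0 gt_eqF.
Qed.

Lemma Lpc_sum (I : Type) (r : seq I) (F : I -> T -> R[i]) :
  (forall i, cmeasurable (F i)) ->
  (Lpc (fun t => \sum_(i <- r) F i t)%R <= \sum_(i <- r) Lpc (F i))%E.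
Proof.
move=> mF; elim: r => [|i r IH].
  rewrite big_nil (eq_Lpc (G := fun=> 0)) ?Lpc0// => t.
  by rewrite big_nil.
rewrite big_cons (eq_Lpc (G := fun t => F i t + \sum_(j <- r) F j t)); last first.
  by move=> t; rewrite big_cons.
apply: le_trans (LpcD _ _) _ => //; first exact: cmeasurable_sum.
exact: leeD2l.
Qed.

Lemma LpcX F : (Lpc F `^ p = \int[mu]_t ((normc (F t)) `^ p)%:E)%E.
Proof.
rewrite LpcE -poweRrM mulVf ?gt_eqF// poweRe1//.
by apply: integral_ge0 => t _; rewrite lee_fin powR_ge0.
Qed.

End Lp.

(** The norm of a function depends on its law only. *)
Lemma Lpc_map (R : realType) d d' (T : measurableType d) (T' : measurableType d')
    (mu : {measure set T -> \bar R}) (nu : {measure set T' -> \bar R}) (h : T -> T') (p : R)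
    (F : T' -> R[i]) :
  (forall H : T' -> \bar R, measurable_fun [set: T'] H -> (forall x, 0 <= H x)%E ->
    \int[mu]_t H (h t) = \int[nu]_t H t)%E ->
  cmeasurable F -> Lpc mu p (F \o h) = Lpc nu p F.
Proof.
move=> hE mF; rewrite !LpcE; congr (_ `^ _)%E.
apply: (hE (fun t => ((normc (F t)) `^ p)%:E)).
  exact: measurable_normcX.
by move=> x; rewrite lee_fin powR_ge0.
Qed.

(** * Convex sequences as Fourier coefficients *)

Section multiplier.
Context (R : realType).
Implicit Types (M J : nat) (w : R[i]) (a b : nat -> R).

Lemma complex_prim_root M : (0 < M)%N -> exists w : R[i], M.-primitive_root w.
Proof.
pose p : {poly R[i]} := 'X^M - 1; have [r Dp] := closed_field_poly_normal p.
move=> M0; rewrite (monicP _) ?monicXnsubC // scale1r in Dp.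
have rM : all M.-unity_root r by apply/allP=> z; rewrite -root_prod_XsubC -Dp.
have sz_r : (M < (size r).+1)%N.
  by rewrite -(size_prod_XsubC r id) -Dp size_XnsubC.
have [|w] := hasP (cyclic.has_prim_root M0 rM _ sz_r); last by exists w.
rewrite -separable.separable_prod_XsubC -Dp cyclotomic.separable_Xn_sub_1//.
by rewrite pnatr_eq0 -lt0n.
Qed.

Lemma sum_prim_root M w k : M.-primitive_root w ->
  \sum_(l < M) w ^+ (l * k) = if (M %| k)%N then M%:R else 0.
Proof.
move=> wp; have M0 := prim_order_gt0 wp.
under eq_bigr do rewrite mulnC exprM.
case: ifP => Mk.
  move: Mk; rewrite (prim_order_dvd wp) => /eqP ->.
  under eq_bigr do rewrite expr1n.
  by rewrite sumr_const card_ord.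
have x1 : w ^+ k - 1 != 0 by rewrite subr_eq0 -(prim_order_dvd wp) Mk.
apply: (mulfI x1); rewrite mulr0 -subrX1 exprAC (prim_expr_order wp) expr1n.
by rewrite subrr.
Qed.

Lemma normc_sqr (z : R[i]) : (normc z)%:C ^+ 2 = z * z^*.
Proof. exact: sqr_normc. Qed.

Lemma normc_unity M w : M.-primitive_root w -> normc w = 1.
Proof.
move=> wp; have M0 := prim_order_gt0 wp.
have := congr1 normc (prim_expr_order wp).
rewrite normcX ComplexField.Normc.normc1 => /eqP.
by rewrite pexpr_eq1 ?normc_ge0// => /eqP.
Qed.

(** [a 0], ..., [a J] are the first Fourier coefficients of a nonnegative
    measure on the [M]-th roots of unity; its mass is [a 0]. *)
Definition fourier_seq M J w a := exists2 wt : 'I_M -> R, forall l, 0 <= wt l &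
  forall j, (j <= J)%N -> \sum_(l < M) (wt l)%:C * w ^+ (l * j) = (a j)%:C.

Lemma fourier_seq_cst M J w c : (0 < M)%N -> 0 <= c -> fourier_seq M J w (fun=> c).
Proof.
case: M => // M _ c0; exists (fun l => if l == ord0 then c else 0).
  by move=> l; case: ifP.
move=> j _; rewrite (bigD1 ord0)//= mul0n expr0 mulr1 big1 ?addr0// => l l0.
by rewrite (negbTE l0) mul0r.
Qed.

Lemma fourier_seqD M J w a b : fourier_seq M J w a -> fourier_seq M J w b ->
  fourier_seq M J w (fun j => a j + b j).
Proof.
move=> [f f0 fE] [g g0 gE]; exists (fun l => f l + g l).
  by move=> l; rewrite addr_ge0.
move=> j jJ; rewrite rmorphD /= -fE// -gE// -big_split; apply: eq_bigr => l _.
by rewrite rmorphD mulrDl.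
Qed.

Lemma fourier_seqZ M J w c a : 0 <= c -> fourier_seq M J w a -> fourier_seq M J w (fun j => c * a j).
Proof.
move=> c0 [f f0 fE]; exists (fun l => c * f l).
  by move=> l; rewrite mulr_ge0.
move=> j jJ; rewrite rmorphM /= -fE// mulr_sumr; apply: eq_bigr => l _.
by rewrite rmorphM mulrA.
Qed.

Lemma fourier_seq_sum M J w (I : Type) (r : seq I) (F : I -> nat -> R) : (0 < M)%N ->
  (forall i, fourier_seq M J w (F i)) -> fourier_seq M J w (fun j => \sum_(i <- r) F i j).
Proof.
move=> M0 pF; elim: r => [|i r [f f0 fE]].
  have [f f0 fE] := @fourier_seq_cst M J w 0 M0 (lexx _).
  by exists f => // j jJ; rewrite big_nil fE.
have [g g0 gE] := fourier_seqD (pF i) (ex_intro2 _ _ f f0 fE).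
by exists g => // j jJ; rewrite big_cons gE.
Qed.

(** The triangular sequence is the Fourier transform of the Fejer kernel,
    a squared modulus.  The bound on [J] keeps the frequencies that occur from
    coinciding modulo [M]. *)
Lemma fourier_seq_tent M J w i : M.-primitive_root w -> (J + J < M)%N -> (i <= J)%N ->
  fourier_seq M J w (fun j => (i - j)%N%:R).
Proof.
move=> wp JM iJ; have M0 := prim_order_gt0 wp.
exists (fun l : 'I_M => normc (\sum_(s < i) w ^+ (l * s)) ^+ 2 / M%:R).
  by move=> l; rewrite divr_ge0 ?sqr_ge0.
move=> j jJ.
have M1 : M%:R != 0 :> R[i] by rewrite pnatr_eq0 -lt0n.
have cw k : (k <= M)%N -> forall l, (w ^+ (l * k))^* = w ^+ (l * (M - k)).
  move=> kM l; rewrite rmorphXn /=.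
  have ww : w * w^* = 1.
    by rewrite -normc_sqr (normc_unity wp) expr1n.
  apply: (mulfI (x := w ^+ (l * k))).
    by rewrite expf_neq0// (prim_root_eq0 wp) -lt0n.
  rewrite -exprMn ww expr1n -exprD -mulnDr subnKC// mulnC exprM.
  by rewrite (prim_expr_order wp) expr1n.
transitivity (M%:R^-1 * \sum_(s < i) \sum_(s' < i) \sum_(l < M) w ^+ (l * (s + (M - s') + j))).
  rewrite [in RHS](eq_bigr (fun s : 'I_i =>
      \sum_(l < M) \sum_(s' < i) w ^+ (l * (s + (M - s') + j)))); last first.
    by move=> s _; rewrite exchange_big.
  rewrite [in RHS]exchange_big /= mulr_sumr; apply: eq_bigr => l _.
  rewrite rmorphM fmorphV rmorph_nat rmorphXn /= normc_sqr.
  rewrite mulrAC mulrC; congr (_ * _).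
  rewrite rmorph_sum /= mulr_suml mulr_suml; apply: eq_bigr => s _.
  rewrite mulr_sumr mulr_suml; apply: eq_bigr => s' _.
  rewrite -[Num.conj _]/(conjc _) cw; last first.
    rewrite (leq_trans (ltnW (ltn_ord s')))// (leq_trans iJ)//.
    by rewrite (leq_trans (leq_addr J J))// ltnW.
  by rewrite -!exprD -!mulnDr.
have E (s s' : 'I_i) : (M %| s + (M - s') + j)%N = (s' == (s + j)%N :> nat).
  have := ltn_ord s; have := ltn_ord s' => s1 s2.
  apply/idP/eqP => [/dvdnP[q qE]|->].
    have : (q < 2)%N by rewrite -(ltn_pmul2r M0) -qE; lia.
    have : (0 < q)%N by rewrite -(ltn_pmul2r M0) -qE; lia.
    by case: q qE => [|[|]] // qE _ _; lia.
  suff -> : (s + (M - (s + j)) + j)%N = M by [].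
  have := ltn_ord s'; lia.
under eq_bigr do under eq_bigr do rewrite (sum_prim_root _ wp) E.
under eq_bigr => s _.
  rewrite -big_mkcond /= (big_ord1_eq _ (fun=> M%:R) (s + j)%N i).
  rewrite ?addr0 (_ : (s + j < i)%N = (s < i - j)%N); last by rewrite ltn_subRL addnC.
  over.
rewrite -big_mkcond /= (big_ord_narrow (leq_subr j i)) sumr_const card_ord.
by rewrite -[M%:R *+ _]mulr_natr mulKf// rmorph_nat.
Qed.

(** Summation by parts writes a convex sequence as a positive combination of
    triangular ones, up to an affine remainder at the end of the range. *)
Lemma sum_second_difference (a : nat -> R) L j : (j <= L)%N ->
  a j = a L + (L - j)%:R * (a L - a L.+1) +
        \sum_(i < L) (a i - a i.+1 *+ 2 + a i.+2) * (i.+1 - j)%:R.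
Proof.
elim: L => [|L IH] jL.
  by move: jL; rewrite leqn0 => /eqP ->; rewrite big_ord0 mul0r !addr0.
rewrite big_ord_recr /=; move: jL; rewrite leq_eqVlt => /predU1P[->|jL].
  rewrite subnn mul0r mulr0 !addr0 big1 ?addr0// => i _.
  by rewrite (_ : (i.+1 - L.+1)%N = 0%N) ?mulr0//; have := ltn_ord i; lia.
rewrite [LHS]IH; last by [].
rewrite subSn// -natr1; ring.
Qed.

(** A positive combination of a constant and of triangular sequences. *)
Lemma fourier_seq_convex M J w a : M.-primitive_root w -> (J + J < M)%N ->
  (forall j, 0 <= a j) -> (forall j, a j.+1 <= a j) ->
  (forall j, a j.+1 *+ 2 <= a j + a j.+2) -> fourier_seq M J w a.
Proof.
move=> wp JM a0 ad ac; have M0 := prim_order_gt0 wp.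
have pd : fourier_seq M J w (fun j => a J + (a J - a J.+1) * (J - j)%:R +
    \sum_(i < J) (a i - a i.+1 *+ 2 + a i.+2) * (i.+1 - j)%:R).
  apply: fourier_seqD.
    apply: fourier_seqD; first exact: fourier_seq_cst.
    by apply: fourier_seqZ; [rewrite subr_ge0|exact: fourier_seq_tent].
  apply: (@fourier_seq_sum M J w 'I_J (index_enum _)
    (fun i j => (a i - a i.+1 *+ 2 + a i.+2) * (i.+1 - j)%:R)) => // i.
  by apply: fourier_seqZ; [rewrite addrAC subr_ge0|exact: fourier_seq_tent].
case: pd => wt wt0 wtE; exists wt => // j jJ; rewrite wtE//.
by congr (_%:C); rewrite [RHS](sum_second_difference a jJ) (mulrC (a J - _)).
Qed.

End multiplier.

(** * Convex multipliers of the degree *)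

Section rotation_multiplier.
Context (R : realType) (n : nat) (p : R).
Hypothesis p1 : 1 <= p.
Local Notation g := (gauss_measure R (n + n)).
Implicit Types F G : 'rV[R[i]]_n -> R[i].

Lemma unit_sqr (u : R[i]) : normc u = 1 -> Re u ^+ 2 + Im u ^+ 2 = 1.
Proof.
move=> u1; rewrite -(sqr_sqrtr (a := _ + _)) ?addr_ge0 ?sqr_ge0//.
by rewrite -normcE u1 expr1n.
Qed.

Lemma on_real_complex_rot F (u : R[i]) (t : (n + n).-tuple R) :
  on_real F (vec (complex_rot (Re u) (Im u) t)) = F (u *: to_complex (vec t)).
Proof. by rewrite /on_real /= vec_complex_rot; case: u. Qed.

Lemma cmeasurable_scale F (u : R[i]) : cmeasurable (on_real F \o @vec R (n + n)) ->
  cmeasurable (fun t => F (u *: to_complex (vec t))).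
Proof.
move=> mF; rewrite (_ : (fun t => _) = on_real F \o @vec R (n + n) \o complex_rot (Re u) (Im u)).
  exact: (cmeasurable_comp mF (@measurable_complex_rot _ _ _ _)).
by apply/funext => t; rewrite /= on_real_complex_rot.
Qed.

Lemma Lpc_unit_scale F (u : R[i]) : normc u = 1 ->
  cmeasurable (on_real F \o @vec R (n + n)) ->
  Lpc g p (fun t => F (u *: to_complex (vec t))) = Lpc g p (on_real F \o vec).
Proof.
move=> u1 mF; rewrite -(@Lpc_map _ _ _ _ _ g g (complex_rot (Re u) (Im u)) p _ _ mF).
  by apply: eq_Lpc => t; rewrite /= on_real_complex_rot.
by move=> H mH H0; apply: gauss_complex_rot => //; exact: unit_sqr.
Qed.

(** The new function is a combination of the rotates of [F] with the weights
    given by [fourier_seq], divided by the characters of degree [d].  All the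
    rotates have the norm of [F], and the weights add up to [a 0]. *)
Lemma Lpc_multiplier F G (a : nat -> R) (d J : nat) :
  (forall j, 0 <= a j) -> (forall j, a j.+1 <= a j) ->
  (forall j, a j.+1 *+ 2 <= a j + a j.+2) ->
  cmeasurable (on_real F \o @vec R (n + n)) ->
  (forall Z, exists2 c : nat -> R[i],
     forall u, F (u *: Z) = \sum_(j < J.+1) c j * u ^+ (d + j) &
     G Z = \sum_(j < J.+1) (a j)%:C * c j) ->
  (Lpc g p (on_real G \o vec) <= (a 0%N)%:E * Lpc g p (on_real F \o vec))%E.
Proof.
move=> a0 ad ac mF FG.
pose M := (J + J).+1.
have [w wp] := complex_prim_root R (ltn0Sn (J + J)).
have [wt wt0 wtE] := @fourier_seq_convex R M J w a wp (ltnSn _) a0 ad ac.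
have wn0 : w != 0 by rewrite (prim_root_eq0 wp).
have w1 : normc w = 1 := normc_unity wp.
have GE t : (on_real G \o vec) t =
    \sum_(l < M) (wt l)%:C * w ^- (l * d) * F (w ^+ l *: to_complex (vec t)).
  have [c FE GZ] := FG (to_complex (vec t)); rewrite /on_real /= GZ.
  under [RHS]eq_bigr do rewrite FE mulr_sumr.
  rewrite exchange_big; apply: eq_bigr => j _ /=.
  rewrite -wtE; last by rewrite -ltnS.
  rewrite mulr_suml; apply: eq_bigr => l _.
  rewrite -exprM mulnDr exprD; set x := w ^+ (l * d).
  have x0 : x != 0 by rewrite expf_neq0.
  by field.
rewrite (eq_Lpc _ _ GE).
have mFw l : cmeasurable (fun t : (n + n).-tuple R => F (w ^+ l *: to_complex (vec t))).
  exact: cmeasurable_scale.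
apply: le_trans (Lpc_sum _ p1 _ _) _.
  by move=> l; apply: cmeasurableM => //; exact: cmeasurable_cst.
have -> : a 0%N = \sum_(l < M) wt l.
  have := wtE 0%N (leq0n _); under eq_bigr do rewrite muln0 expr0 mulr1.
  by rewrite -rmorph_sum => /complexI.
rewrite -sumEFin ge0_sume_distrl; last by move=> l _; rewrite lee_fin.
apply: lee_sum => l _; rewrite LpcZ//.
rewrite ComplexField.Normc.normcM ComplexField.Normc.normcV !normcX w1 !expr1n invr1 mulr1.
rewrite normcR ger0_norm// Lpc_unit_scale//.
by rewrite normcX w1 expr1n.
Qed.

End rotation_multiplier.

(** * Polynomial functions and their derivatives *)

Section polynomial_functions.
Context (R : realType).

(** Complex polynomials in the real coordinates, as a class of functions
    closed under four clauses, so that each property of polynomials below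
    is proved by induction on them. *)
Inductive polyfun (N : nat) : ('rV[R]_N -> R[i]) -> Prop :=
| polyfun_cst c : polyfun (fun=> c)
| polyfun_coord j : polyfun (fun x => (x ord0 j)%:C)
| polyfunD F G : polyfun F -> polyfun G -> polyfun (fun x => F x + G x)
| polyfunM F G : polyfun F -> polyfun G -> polyfun (fun x => F x * G x).

Lemma eq_polyfun N (F G : 'rV[R]_N -> R[i]) : F =1 G -> polyfun F -> polyfun G.
Proof. by move=> /funext ->. Qed.

Lemma polyfun_sum N (I : Type) (r : seq I) (F : I -> 'rV[R]_N -> R[i]) :
  (forall i, polyfun (F i)) -> polyfun (fun x => \sum_(i <- r) F i x).
Proof.
move=> pF; elim: r => [|i r IH].
  by apply: eq_polyfun (polyfun_cst _ 0) => x; rewrite big_nil.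
by apply: eq_polyfun (polyfunD (pF i) IH) => x; rewrite big_cons.
Qed.

Lemma polyfun_prod N (I : Type) (r : seq I) (F : I -> 'rV[R]_N -> R[i]) :
  (forall i, polyfun (F i)) -> polyfun (fun x => \prod_(i <- r) F i x).
Proof.
move=> pF; elim: r => [|i r IH].
  by apply: eq_polyfun (polyfun_cst _ 1) => x; rewrite big_nil.
by apply: eq_polyfun (polyfunM (pF i) IH) => x; rewrite big_cons.
Qed.

Lemma polyfunX N (F : 'rV[R]_N -> R[i]) k : polyfun F -> polyfun (fun x => F x ^+ k).
Proof.
move=> pF; elim: k => [|k IH]; first by apply: eq_polyfun (polyfun_cst _ 1) => x; rewrite expr0.
by apply: eq_polyfun (polyfunM pF IH) => x; rewrite exprS.
Qed.

Lemma polyfun_comp N M (F : 'rV[R]_N -> R[i]) (h : 'rV[R]_M -> 'rV[R]_N) :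
  polyfun F -> (forall j, polyfun (fun x => (h x ord0 j)%:C)) -> polyfun (F \o h).
Proof.
move=> pF ph; elim: pF => [c|j|F1 F2 _ IH1 _ IH2|F1 F2 _ IH1 _ IH2].
- exact: polyfun_cst.
- exact: ph.
- exact: polyfunD IH1 IH2.
- exact: polyfunM IH1 IH2.
Qed.

Lemma cmeasurable_polyfun N (F : 'rV[R]_N -> R[i]) :
  polyfun F -> cmeasurable (F \o @vec R N).
Proof.
elim=> [c|j|F1 F2 _ IH1 _ IH2|F1 F2 _ IH1 _ IH2].
- exact: cmeasurable_cst.
- apply: (@cmeasurable_real _ _ _ (fun t => vec t ord0 j)).
  rewrite (_ : (fun t => _) = (@tnth N R)^~ j); first exact: measurable_tnth.
  by apply/funext => t; rewrite mxE.
- exact: cmeasurableD IH1 IH2.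
- exact: cmeasurableM IH1 IH2.
Qed.

(** Derivatives of polynomial functions are read off as coefficients of their
    restrictions to lines. *)
Definition on_line N (F : 'rV[R]_N -> R[i]) x w (p : {poly R[i]}) :=
  forall t : R, F (x + t *: w) = p.[t%:C].

(** A polynomial that vanishes on the reals has infinitely many roots. *)
Lemma poly_real_inj (p q : {poly R[i]}) : (forall t : R, p.[t%:C] = q.[t%:C]) -> p = q.
Proof.
move=> pq; apply/eqP; rewrite -subr_eq0; apply/negPn/negP => r0.
pose rs : seq R[i] := [seq k%:R | k <- iota 0 (size (p - q))].
suff : (size rs < size (p - q)%R)%N by rewrite size_map size_iota ltnn.
apply: max_poly_roots => //.
  apply/allP => _ /mapP[k _ ->]; rewrite /root hornerD hornerN.
  by rewrite -(rmorph_nat (real_complex R)) pq subrr.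
by rewrite map_inj_uniq ?iota_uniq// => a b /eqP; rewrite eqr_nat => /eqP.
Qed.

Lemma on_line_inj N (F : 'rV[R]_N -> R[i]) x w p q :
  on_line F x w p -> on_line F x w q -> p = q.
Proof. by move=> Fp Fq; apply: poly_real_inj => t; rewrite -Fp Fq. Qed.

Lemma on_line0 N (F : 'rV[R]_N -> R[i]) x w p : on_line F x w p -> p`_0 = F x.
Proof. by move=> /(_ 0); rewrite scale0r addr0 rmorph0 horner_coef0 => ->. Qed.

Lemma on_lineD N (F G : 'rV[R]_N -> R[i]) x w p q :
  on_line F x w p -> on_line G x w q -> on_line (fun y => F y + G y) x w (p + q).
Proof. by move=> Fp Gq t; rewrite Fp Gq hornerD. Qed.

Lemma on_lineM N (F G : 'rV[R]_N -> R[i]) x w p q :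
  on_line F x w p -> on_line G x w q -> on_line (fun y => F y * G y) x w (p * q).
Proof. by move=> Fp Gq t; rewrite Fp Gq hornerM. Qed.

Lemma on_line_coord N x w (j : 'I_N) :
  on_line (fun x => (x ord0 j)%:C) x w ((x ord0 j)%:C%:P + (w ord0 j)%:C *: 'X).
Proof.
by move=> t; rewrite !mxE hornerD hornerC hornerZ hornerX rmorphD rmorphM mulrC.
Qed.

Lemma polyfun_on_line N (F : 'rV[R]_N -> R[i]) : polyfun F ->
  exists D : nat, forall x w, exists2 p : {poly R[i]}, (size p <= D)%N & on_line F x w p.
Proof.
elim=> [c|j|F1 F2 _ [D1 H1] _ [D2 H2]|F1 F2 _ [D1 H1] _ [D2 H2]].
- by exists 1%N => x w; exists c%:P => [|t]; [exact: size_polyC_leq1|rewrite hornerC].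
- exists 2%N => x w; exists ((x ord0 j)%:C%:P + (w ord0 j)%:C *: 'X); last exact: on_line_coord.
  rewrite (leq_trans (size_polyD _ _))// geq_max (leq_trans (size_polyC_leq1 _))//=.
  by rewrite (leq_trans (size_scale_leq _ _))// size_polyX.
- exists (maxn D1 D2) => x w; have [p sp Fp] := H1 x w; have [q sq Fq] := H2 x w.
  exists (p + q); last exact: on_lineD.
  by rewrite (leq_trans (size_polyD _ _))// geq_max !leq_max sp sq orbT.
- exists (D1 + D2)%N => x w; have [p sp Fp] := H1 x w; have [q sq Fq] := H2 x w.
  exists (p * q); last exact: on_lineM.
  by rewrite (leq_trans (size_polyMleq _ _))// (leq_trans (leq_pred _))// leq_add.
Qed.

Lemma ReM_real (z : R[i]) (t : R) : Re (z * t%:C) = Re z * t.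
Proof. by case: z => a b /=; rewrite mulr0 subr0. Qed.

Lemma ImM_real (z : R[i]) (t : R) : Im (z * t%:C) = Im z * t.
Proof. by case: z => a b /=; rewrite mulr0 add0r. Qed.

Lemma ReD (z w : R[i]) : Re (z + w) = Re z + Re w. Proof. by case: z w => ? ? []. Qed.
Lemma ImD (z w : R[i]) : Im (z + w) = Im z + Im w. Proof. by case: z w => ? ? []. Qed.

(** Splitting into real and imaginary parts reduces complex-valued
    derivatives to those of real polynomials. *)
Lemma horner_real (p : {poly R[i]}) (t : R) :
  p.[t%:C] = (\poly_(k < size p) Re p`_k).[t] +i* (\poly_(k < size p) Im p`_k).[t].
Proof.
rewrite !horner_poly horner_coef; elim: (size p) => [|k IH]; first by rewrite !big_ord0.
rewrite !big_ord_recr /= IH -rmorphXn /= [in RHS]/= -ReM_real -ImM_real.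
by case: (p`_k * _).
Qed.

Lemma derive_on_line N (f : 'rV[R]_N -> R) x w (q : {poly R}) :
  (forall t, f (x + t *: w) = q.[t]) -> 'D_w f x = q`_1.
Proof.
move=> fq; transitivity ('D_1 (horner q) 0).
  rewrite /derive; set a := (fun _ : R => _); set b := (fun _ : R => _).
  suff -> : a = b by [].
  apply/funext => h; rewrite /a /b /=.
  have -> : f x = q.[0] by rewrite -fq scale0r addr0.
  have -> : h *: (1 : R) = h by exact: mulr1.
  by rewrite (addrC _ x) fq addr0.
by rewrite -derive1E -derivE horner_coef0 coef_deriv mulr1n.
Qed.

Lemma partial_on_line N (F : 'rV[R]_N -> R[i]) x j p :
  on_line F x (delta_mx ord0 j) p -> partial j F x = p`_1.
Proof.
move=> Fp; rewrite /partial.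
rewrite (derive_on_line (q := \poly_(k < size p) Re p`_k)); last first.
  by move=> t; rewrite Fp horner_real.
rewrite (derive_on_line (q := \poly_(k < size p) Im p`_k)); last first.
  by move=> t; rewrite Fp horner_real.
rewrite !coef_poly; case: ifPn => [_|]; first by case: (p`_1).
by rewrite -leqNgt => sp; rewrite nth_default.
Qed.

Lemma partial_cst N j c x : partial j (fun _ : 'rV[R]_N => c) x = 0.
Proof. by rewrite (partial_on_line (p := c%:P)) ?coefC// => t; rewrite hornerC. Qed.

Lemma partial_coord N (j k : 'I_N) x :
  partial j (fun y : 'rV[R]_N => (y ord0 k)%:C) x = (k == j)%:R.
Proof.
rewrite (partial_on_line (on_line_coord _ _ _)) coefD coefC coefZ coefX /= add0r mulr1.
by rewrite mxE eqxx rmorph_nat.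
Qed.

Lemma partialD N j (F G : 'rV[R]_N -> R[i]) x : polyfun F -> polyfun G ->
  partial j (fun y => F y + G y) x = partial j F x + partial j G x.
Proof.
move=> /polyfun_on_line[D1 H1] /polyfun_on_line[D2 H2].
have [p _ Fp] := H1 x (delta_mx ord0 j); have [q _ Gq] := H2 x (delta_mx ord0 j).
by rewrite (partial_on_line (on_lineD Fp Gq)) coefD (partial_on_line Fp) (partial_on_line Gq).
Qed.

Lemma partialM N j (F G : 'rV[R]_N -> R[i]) x : polyfun F -> polyfun G ->
  partial j (fun y => F y * G y) x = F x * partial j G x + partial j F x * G x.
Proof.
move=> /polyfun_on_line[D1 H1] /polyfun_on_line[D2 H2].
have [p _ Fp] := H1 x (delta_mx ord0 j); have [q _ Gq] := H2 x (delta_mx ord0 j).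
rewrite (partial_on_line (on_lineM Fp Gq)) (partial_on_line Fp) (partial_on_line Gq).
by rewrite coefM big_ord_recl big_ord1 /= (on_line0 Fp) (on_line0 Gq).
Qed.

Lemma polyfun_partial N j (F : 'rV[R]_N -> R[i]) : polyfun F -> polyfun (partial j F).
Proof.
elim=> [c|k|F1 F2 p1 IH1 p2 IH2|F1 F2 p1 IH1 p2 IH2].
- by apply: eq_polyfun (polyfun_cst _ 0) => x; rewrite partial_cst.
- by apply: eq_polyfun (polyfun_cst _ (k == j)%:R) => x; rewrite partial_coord.
- by apply: eq_polyfun (polyfunD IH1 IH2) => x; rewrite partialD.
- apply: eq_polyfun (polyfunD (polyfunM p1 IH2) (polyfunM IH1 p2)) => x.
  by rewrite partialM.
Qed.

Definition dir_deriv N (F : 'rV[R]_N -> R[i]) (x w : 'rV[R]_N) : R[i] :=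
  \sum_(j < N) (w ord0 j)%:C * partial j F x.

Lemma dir_deriv_cst N c (x w : 'rV[R]_N) : dir_deriv (fun=> c) x w = 0.
Proof. by rewrite /dir_deriv big1// => j _; rewrite partial_cst mulr0. Qed.

Lemma dir_deriv_coord N j (x w : 'rV[R]_N) : dir_deriv (fun y => (y ord0 j)%:C) x w = (w ord0 j)%:C.
Proof.
rewrite /dir_deriv (bigD1 j)//= partial_coord eqxx mulr1 big1 ?addr0// => k kj.
by rewrite partial_coord eq_sym (negbTE kj) mulr0.
Qed.

Lemma dir_derivD N (F G : 'rV[R]_N -> R[i]) x w : polyfun F -> polyfun G ->
  dir_deriv (fun y => F y + G y) x w = dir_deriv F x w + dir_deriv G x w.
Proof.
move=> pF pG; rewrite /dir_deriv -big_split; apply: eq_bigr => j _.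
by rewrite partialD// mulrDr.
Qed.

Lemma dir_derivM N (F G : 'rV[R]_N -> R[i]) x w : polyfun F -> polyfun G ->
  dir_deriv (fun y => F y * G y) x w = F x * dir_deriv G x w + dir_deriv F x w * G x.
Proof.
move=> pF pG; rewrite /dir_deriv mulr_sumr mulr_suml -big_split; apply: eq_bigr => j _.
by rewrite partialM//=; ring.
Qed.

(** Both sides are derivations, so it is enough to compare them on
    coordinates. *)
Lemma dir_deriv_on_line N (F : 'rV[R]_N -> R[i]) x w p : polyfun F ->
  on_line F x w p -> p`_1 = dir_deriv F x w.
Proof.
move=> pF; elim: pF p => [c|k|F1 F2 p1 IH1 p2 IH2|F1 F2 p1 IH1 p2 IH2] p Fp.
- rewrite (on_line_inj (q := c%:P) Fp) ?coefC => [|t]; last by rewrite hornerC.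
  by rewrite dir_deriv_cst.
- rewrite (on_line_inj Fp (on_line_coord _ _ _)) coefD coefC coefZ coefX add0r mulr1.
  by rewrite dir_deriv_coord.
- have [D1 /(_ x w)[q1 _ H1]] := polyfun_on_line p1.
  have [D2 /(_ x w)[q2 _ H2]] := polyfun_on_line p2.
  by rewrite (on_line_inj Fp (on_lineD H1 H2)) coefD (IH1 _ H1) (IH2 _ H2) dir_derivD.
- have [D1 /(_ x w)[q1 _ H1]] := polyfun_on_line p1.
  have [D2 /(_ x w)[q2 _ H2]] := polyfun_on_line p2.
  rewrite (on_line_inj Fp (on_lineM H1 H2)) coefM big_ord_recl big_ord1 /=.
  by rewrite (on_line0 H1) (on_line0 H2) (IH1 _ H1) (IH2 _ H2) dir_derivM.
Qed.

End polynomial_functions.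

(** * Holomorphic functions polynomial in the real coordinates *)

Section cauchy_riemann.
Context (R : realType).

(** Since [Re u = u - i Im u], a polynomial in [Re u] and [Im u] is a
    polynomial in [Im u] whose coefficients are polynomials in [u].  Being
    holomorphic means that [Im u] does not occur. *)
Definition on_plane N (F : 'rV[R]_N -> R[i]) x w w' (B : {poly {poly R[i]}}) :=
  forall u : R[i], F (x + Re u *: w + Im u *: w') = (B.[(Im u)%:C%:P]).[u].

Lemma Re_Im (u : R[i]) : (Re u)%:C = u - 'i%C * (Im u)%:C.
Proof. by rewrite [X in _ = X - _]complexE addrK. Qed.

Lemma polyfun_on_plane N (F : 'rV[R]_N -> R[i]) x w w' : polyfun F ->
  exists B, on_plane F x w w' B.
Proof.
elim=> [c|j|F1 F2 _ [B1 H1] _ [B2 H2]|F1 F2 _ [B1 H1] _ [B2 H2]].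
- by exists c%:P%:P => u; rewrite !hornerC.
- exists (((x ord0 j)%:C%:P + (w ord0 j)%:C *: 'X)%:P +
    ((w' ord0 j)%:C - 'i%C * (w ord0 j)%:C)%:P *: 'X) => u.
  rewrite !mxE !hornerD !hornerC !hornerZ !hornerX !hornerD !hornerC !hornerM !hornerZ !hornerC !hornerX.
  rewrite !rmorphD !rmorphM /= Re_Im; ring.
- by exists (B1 + B2) => u; rewrite H1 H2 !hornerD.
- by exists (B1 * B2) => u; rewrite H1 H2 !hornerM.
Qed.

(** Continuity at the origin of the real and imaginary parts. *)
Lemma poly_limit0 (P : {poly R[i]}) :
  (forall e : R, 0 < e -> exists2 d : R, 0 < d &
     forall t : R, 0 < `|t| -> `|t| < d -> normc P.[t%:C] < e) -> P.[0] = 0.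
Proof.
move=> small.
have rsmall (a : {poly R}) : (forall t : R, `|a.[t]| <= normc P.[t%:C]) -> a.[0] = 0.
  move=> aP; apply/eqP/negPn/negP => a0.
  have e0 : 0 < `|a.[0]| / 2 by rewrite divr_gt0// normr_gt0.
  have [d d0 dP] := small _ e0.
  have /cvgrPdist_lt/(_ _ e0) := @continuous_horner _ a 0.
  move=> /nbhs_ballP[d' /= d'0 d'P].
  pose t := Num.min d d' / 2.
  have m0 : 0 < Num.min d d' by rewrite lt_min d0 d'0.
  have t0 : 0 < t by rewrite divr_gt0.
  have tm : t < Num.min d d' by rewrite /t ltr_pdivrMr// mulr_natr mulr2n ltrDr.
  have td : t < d by rewrite (lt_le_trans tm)// ge_min lexx.
  have td' : t < d' by rewrite (lt_le_trans tm)// ge_min lexx orbT.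
  have h1 : `|a.[t]| < `|a.[0]| / 2.
    by apply: le_lt_trans (aP t) _; apply: dP; rewrite gtr0_norm.
  have h2 : `|a.[0] - a.[t]| < `|a.[0]| / 2.
    by apply: d'P; rewrite /ball /= sub0r normrN gtr0_norm.
  have := ler_normD (a.[0] - a.[t]) a.[t]; rewrite subrK => h3.
  lra.
have PE t := horner_real P t.
have := PE 0; rewrite rmorph0 => ->.
have nRe (z : R[i]) : `|Re z| <= normc z.
  by rewrite normcE -sqrtr_sqr ler_wsqrtr// lerDl sqr_ge0.
have nIm (z : R[i]) : `|Im z| <= normc z.
  by rewrite normcE -sqrtr_sqr ler_wsqrtr// lerDr sqr_ge0.
rewrite !rsmall// => t.
- by rewrite (le_trans _ (nIm _))// PE.
- by rewrite (le_trans _ (nRe _))// PE.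
Qed.

(** Letting the increment tend to [0] along the real multiples of [v] computes
    the complex derivative from the first coefficient of the restriction. *)
Lemma derivative_along (g : R[i] -> R[i]) (u0 L v : R[i]) (p : {poly R[i]}) :
  v != 0 ->
  (forall e : R, 0 < e -> exists2 d : R, 0 < d &
     forall h : R[i], h != 0 -> normc h < d ->
       normc ((g (u0 + h) - g u0) / h - L) < e) ->
  (forall t : R, g (u0 + t%:C * v) = p.[t%:C]) -> p`_1 = L * v.
Proof.
move=> v0 gL gp.
have [r pr] : exists r, p = (p`_0)%:P + r * 'X.
  have /factor_theorem[r rE] : root (p - (p`_0)%:P) 0.
    by rewrite /root hornerD hornerN hornerC horner_coef0 subrr.
  by exists r; rewrite -['X]subr0 -polyC0 -rE addrC subrK.
have p1 : p`_1 = r.[0] by rewrite pr coefD coefC coefMX /= add0r horner_coef0.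
rewrite p1; apply/eqP; rewrite -subr_eq0; apply/eqP.
have -> : r.[0] - L * v = (r - (L * v)%:P).[0] by rewrite hornerD hornerN hornerC.
apply: poly_limit0 => e e0.
have nv0 : 0 < normc v.
  rewrite lt_neqAle normc_ge0 andbT eq_sym.
  by apply: contra v0 => /eqP /ComplexField.Normc.eq0_normc ->.
have [d d0 dP] := gL (e / normc v) (divr_gt0 e0 nv0).
exists (d / normc v); first exact: divr_gt0.
move=> t t0 td.
have tC0 : t%:C != 0 :> R[i].
  by move: t0; rewrite normr_gt0 eq_complex /= eqxx andbT.
have tv0 : t%:C * v != 0 by rewrite mulf_neq0.
have := dP _ tv0; rewrite ComplexField.Normc.normcM normcR -ltr_pdivlMr// => /(_ td).
have -> : (g (u0 + t%:C * v) - g u0) / (t%:C * v) - L = (r - (L * v)%:P).[t%:C] / v.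
  rewrite gp (_ : g u0 = p.[0]); last by have := gp 0; rewrite rmorph0 mul0r addr0.
  rewrite {1 2}pr !hornerD !hornerN !hornerM !hornerC !hornerX mulr0 addr0.
  by field; rewrite tC0 v0.
by rewrite ComplexField.Normc.normcM ComplexField.Normc.normcV ltr_pM2r ?invr_gt0.
Qed.

Lemma horner2_line (B : {poly {poly R[i]}}) (y0 u0 v : R[i]) :
  exists s : {poly R[i]}, forall t, (B.[(y0 + t)%:P]).[u0 + t * v] = s.[t].
Proof.
elim/poly_ind: B => [|B c [s sE]]; first by exists 0 => t; rewrite !horner0.
exists (s * (y0%:P + 'X) + (c \Po (u0%:P + v *: 'X))) => t.
rewrite !hornerD !hornerM !hornerC !hornerX horner_comp !hornerD !hornerZ !hornerC !hornerX.
by rewrite sE (mulrC t).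
Qed.

Lemma comp_affine1 (q : {poly R[i]}) u0 v : (q \Po (u0%:P + v *: 'X))`_1 = q^`().[u0] * v.
Proof.
have -> : (q \Po (u0%:P + v *: 'X))`_1 = (q \Po (u0%:P + v *: 'X))^`().[0].
  by rewrite horner_coef0 coef_deriv mulr1n.
rewrite deriv_comp derivD derivC derivZ derivX add0r hornerM horner_comp.
by rewrite !hornerD !hornerZ !hornerC hornerX mulr0 addr0 mulr1.
Qed.

(** On the line [Im u = y] write [B = C0 + B1 (Y - y)].  The derivative in
    the direction [1] is that of [C0], whereas the direction [i] contributes
    [B1] at [y] in addition.  Hence the derivative of [B] in [Im u] vanishes at
    every real [y], and [B] is constant in [Im u]. *)
Lemma holomorphic_plane (g : R[i] -> R[i]) (B : {poly {poly R[i]}}) :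
  (forall u, g u = (B.[(Im u)%:C%:P]).[u]) ->
  (forall u0, exists L, forall e : R, 0 < e -> exists2 d : R, 0 < d &
     forall h : R[i], h != 0 -> normc h < d ->
       normc ((g (u0 + h) - g u0) / h - L) < e) ->
  exists q : {poly R[i]}, forall u, g u = q.[u].
Proof.
move=> gB gL.
have i0 : 'i%C != 0 :> R[i] by rewrite complexiE neq0Ci.
have dB0 (y : R) : (B^`()).[y%:C%:P] = 0.
  set c := y%:C%:P.
  (* first order expansion of [B] around the line of height [y] *)
  have [C0 [B1 BE]] : exists (C0 : {poly R[i]}) B1, B = C0%:P + B1 * ('X - c%:P).
    have /factor_theorem[B1 BE] : root (B - (B.[c])%:P) c.
      by rewrite /root hornerD hornerN hornerC subrr.
    by exists B.[c], B1; rewrite -BE addrC subrK.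
  have C0E : B.[c] = C0.
    by rewrite BE hornerD hornerM hornerC hornerD hornerN hornerX hornerC subrr mulr0 addr0.
  have -> : (B^`()).[c] = B1.[c].
    have -> : B^`() = B1^`() * ('X - c%:P) + B1.
      by rewrite BE derivD derivC add0r derivM derivXsubC mulr1.
    by rewrite hornerD hornerM hornerD hornerN hornerX hornerC subrr mulr0 add0r.
  have B1x (x : R) : (B1.[c]).[x +i* y] = 0.
    have [L uL] := gL (x +i* y).
    have L1 : C0^`().[x +i* y] = L.
      have /= := @derivative_along g (x +i* y) L 1 (C0 \Po ((x +i* y)%:P + 1 *: 'X)) (oner_neq0 _) uL.
      rewrite comp_affine1 !mulr1; apply=> t.
      rewrite gB mulr1 (_ : Im _ = y); last by rewrite ImD /= addr0.
      by rewrite -/c C0E horner_comp !hornerD !hornerZ !hornerC hornerX mul1r.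
    have [s sE] := horner2_line B1 y%:C (x +i* y) 'i%C.
    have s0 : s`_0 = (B1.[c]).[x +i* y].
      by rewrite -horner_coef0 -sE addr0 mul0r addr0.
    have /= := @derivative_along g (x +i* y) L 'i%C
      ((C0 \Po ((x +i* y)%:P + 'i%C *: 'X)) + s * 'X) i0 uL.
    rewrite coefD comp_affine1 coefMX /= s0 L1 => H.
    have : L * 'i%C + (B1.[c]).[x +i* y] = L * 'i%C.
      apply: H => t; rewrite gB (_ : Im _ = y + t); last by rewrite ImD ImiRe.
      have -> : (y + t)%:C%:P = (y%:C + t%:C)%:P :> {poly R[i]} by rewrite rmorphD.
      rewrite {1}BE !hornerD !hornerM sE !hornerD !hornerN !hornerX !hornerC.
      rewrite horner_comp !hornerD !hornerZ !hornerC !hornerX.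
      by rewrite (addrC y%:C) addrK (mulrC 'i%C).
    by rewrite -[RHS]addr0 => /addrI.
  have : B1.[c] \Po ('X + (y%:C * 'i%C)%:P) = 0.
    apply: poly_real_inj => t; rewrite horner_comp hornerD hornerX hornerC horner0.
    have -> : t%:C + y%:C * 'i%C = t +i* y by rewrite [RHS]complexE /= mulrC.
    exact: B1x.
  move=> /(congr1 (fun q => q \Po ('X - (y%:C * 'i%C)%:P))).
  by rewrite comp_poly0 -comp_polyA comp_polyD comp_polyX comp_polyC subrK comp_polyXr.
(* the integers are infinitely many roots *)
have dB : B^`() = 0.
  apply/eqP/negPn/negP => r0.
  pose rs : seq {poly R[i]} := [seq k%:R | k <- iota 0 (size B^`())].
  suff : (size rs < size B^`())%N by rewrite size_map size_iota ltnn.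
  apply: max_poly_roots => //.
    apply/allP => _ /mapP[k _ ->]; rewrite /root.
    by rewrite -(polyC_natr _ k) -(rmorph_nat (real_complex R)) dB0.
  rewrite map_inj_uniq ?iota_uniq// => a b /eqP.
  by rewrite -!polyC_natr (inj_eq polyC_inj) eqr_nat => /eqP.
have BE : B = (B`_0)%:P.
  apply/polyP => -[|k]; rewrite coefC//=.
  have /eqP := congr1 (fun q : {poly {poly R[i]}} => q`_k) dB.
  rewrite coef_deriv coef0 -mulr_natr mulf_eq0 => /orP[/eqP//|].
  by rewrite -polyC_natr polyC_eq0 pnatr_eq0.
by exists B`_0 => u; rewrite gB {1}BE hornerC.
Qed.

End cauchy_riemann.

(** * Polynomials along complex lines *)

Section line_polynomials.
Context (R : realType) (n : nat).
Implicit Types (f : 'rV[R[i]]_n -> R[i]) (Z W : 'rV[R[i]]_n).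

Definition of_complex Z : 'rV[R]_(n + n) :=
  row_mx (map_mx Re Z) (map_mx Im Z).

Lemma of_complexK Z : to_complex (of_complex Z) = Z.
Proof.
apply/rowP => j; rewrite mxE /of_complex row_mxEl row_mxEr !mxE.
by case: (Z _ _).
Qed.

Lemma to_complexD (x y : 'rV[R]_(n + n)) : to_complex (x + y) = to_complex x + to_complex y.
Proof. by apply/rowP => j; rewrite !mxE. Qed.

Lemma to_complexZ (t : R) (x : 'rV[R]_(n + n)) : to_complex (t *: x) = t%:C *: to_complex x.
Proof. by apply/rowP => j; rewrite !mxE /=; congr (_ +i* _); rewrite ?mul0r ?subr0 ?addr0. Qed.

(** The degree bound is uniform so that one group of roots of unity serves
    all points at once. *)
Definition line_polynomial f := exists D : nat, forall Z W,
  exists2 q : {poly R[i]}, (size q <= D)%N & forall u, f (Z + u *: W) = q.[u].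

(** The restriction to the real points of the line, where [on_real f] is
    polynomial, determines the polynomial and bounds its degree. *)
Lemma line_polynomial_uniform f : polyfun (on_real f) ->
  (forall Z W, exists q : {poly R[i]}, forall u, f (Z + u *: W) = q.[u]) ->
  line_polynomial f.
Proof.
move=> /polyfun_on_line[D HD] Hf; exists D => Z W.
have [q qE] := Hf Z W; exists q => //.
have [p sp pE] := HD (of_complex Z) (of_complex W).
rewrite (_ : q = p)//; apply: poly_real_inj => t.
by rewrite -qE -pE /on_real /= to_complexD to_complexZ !of_complexK.
Qed.

Lemma normC_normc (z : R[i]) : `|z| = (normc z)%:C.
Proof. by []. Qed.

Lemma analytic_difference_quotient f Z W : analytic f ->
  forall u0, exists L, forall e : R, 0 < e -> exists2 d : R, 0 < d &
    forall h : R[i], h != 0 -> normc h < d ->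
      normc ((f (Z + (u0 + h) *: W) - f (Z + u0 *: W)) / h - L) < e.
Proof.
move=> /[swap] u0 /(_ (Z + u0 *: W)) df.
have /cvg_ex[/= L cL] := diff_derivable (v := W) df.
exists L => e e0.
have eC : 0 < e%:C by rewrite ltcR.
move/cvgrPdist_lt : cL => /(_ _ eC) /nbhs_ballP[d /= d0 dP].
have /complex_realP[r rE] : d \is Num.real by exact: gtr0_real.
rewrite {}rE ltcR in d0 dP.
exists r => // h h0 hr.
have := dP h; rewrite /ball /= sub0r normrN.
have hC : `|h| < r%:C by rewrite normC_normc ltcR.
move=> /(_ hC h0); rewrite distrC normC_normc ltcR.
have -> : h *: W + (Z + u0 *: W) = Z + (u0 + h) *: W.
  by rewrite addrCA -scalerDl (addrC h).
by rewrite [_ *: _]mulrC.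
Qed.

Lemma analytic_line_polynomial f : analytic f -> polyfun (on_real f) -> line_polynomial f.
Proof.
move=> af pf; apply: line_polynomial_uniform => // Z W.
have [B HB] := polyfun_on_plane (of_complex Z) (of_complex W) (of_complex ('i%C *: W)) pf.
apply: (@holomorphic_plane _ (fun u => f (Z + u *: W)) B).
  move=> u; rewrite -HB /on_real /= !to_complexD !to_complexZ !of_complexK.
  by rewrite scalerA -addrA -scalerDl (mulrC (Im u)%:C) -complexE.
exact: analytic_difference_quotient.
Qed.

Lemma horner_prod_affine (a b : 'rV[R[i]]_n) (e : {ffun 'I_n -> nat}) u :
  \prod_(j < n) (a ord0 j + u * b ord0 j) ^+ e j =
  (\prod_(j < n) ((a ord0 j)%:P + b ord0 j *: 'X) ^+ e j).[u].
Proof.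
rewrite horner_prod; apply: eq_bigr => j _.
by rewrite horner_exp hornerD hornerC hornerZ hornerX mulrC.
Qed.

Lemma analytic_polynomial_line f : analytic_polynomial f -> polyfun (on_real f) ->
  line_polynomial f.
Proof.
move=> [s [c fE]] pf; apply: line_polynomial_uniform => // Z W.
exists (\sum_(a <- s) c a *: \prod_(j < n) ((Z ord0 j)%:P + W ord0 j *: 'X) ^+ a j) => u.
rewrite fE horner_sum; apply: eq_bigr => a _; rewrite hornerZ -horner_prod_affine.
by congr (_ * _); apply: eq_bigr => j _; rewrite !mxE.
Qed.

End line_polynomials.

(** * Gaussian moments *)

Section moments.
Context (R : realType) (N : nat).
Local Notation g := (gauss_measure R N).
Implicit Types (t u : N.-tuple R).

Definition tuple_dot u t : R := \sum_(j < N) tnth u j * tnth t j.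

Lemma measurable_tuple_dot u : measurable_fun [set: N.-tuple R] (tuple_dot u).
Proof.
apply: measurable_sum => j; apply: measurable_funM => //.
exact: measurable_tnth.
Qed.

(** Completing the square turns the exponential into a translation of the
    density. *)
Lemma gauss_mgf u :
  (\int[g]_t (expR (tuple_dot u t))%:E = (expR (tuple_dot u u / 2))%:E)%E.
Proof.
have me : measurable_fun [set: N.-tuple R] (fun t => (expR (tuple_dot u t))%:E).
  by apply/measurable_EFinP; apply: measurableT_comp => //; exact: measurable_tuple_dot.
have md : measurable_fun [set: N.-tuple R] (EFin \o @gauss_density R N).
  by apply/measurable_EFinP; exact: measurable_gauss_density.
rewrite integral_gauss; [|by []|by move=> t; rewrite lee_fin expR_ge0].
transitivity (\int[lebesgueN R N]_t
   ((expR (tuple_dot u u / 2))%:E * (gauss_density (tuple_lin 1 (-1) t u))%:E))%E.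
  apply: eq_integral => t _; rewrite -!EFinM; congr _%:E.
  rewrite /gauss_density ![_ * (_ `^ _ * _)]mulrCA; congr (_ * _).
  rewrite -!expRD; congr expR.
  under [in RHS]eq_bigr => j _.
    rewrite tuple_linE (_ : (_ + _) ^+ 2 = tnth t j ^+ 2 +
      (- 2 * (tnth u j * tnth t j) + tnth u j * tnth u j)); last by ring.
    over.
  rewrite !big_split -mulr_sumr -/(tuple_dot u t) -/(tuple_dot u u) /=.
  by set A := tuple_dot u t; set B := tuple_dot u u; set S := \sum_(_ < _) _; lra.
rewrite ge0_integralZl//; last 2 first.
- by apply: (measurableT_comp md); apply: measurable_tuple_lin.
- by move=> t _; rewrite lee_fin gauss_density_ge0.
rewrite (lebesgueN_translation (-1) u (F := EFin \o @gauss_density R N))//; last first.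
  by move=> t; rewrite lee_fin gauss_density_ge0.
have /= := gauss_measureT R N; rewrite /gauss_measure => ->.
by rewrite mule1.
Qed.

(** Raise [y / q <= expR (y / q)] to the power [q]. *)
Lemma powR_le_expR (q y : R) : 0 < q -> 0 <= y -> y `^ q <= q `^ q * expR y.
Proof.
move=> q0 y0.
have yq : y / q <= expR (y / q).
  by apply: le_trans (expR_ge1Dx _); rewrite lerDr.
have yq0 : 0 <= y / q by rewrite divr_ge0// ltW.
have -> : y = q * (y / q) by rewrite mulrC divfK// gt_eqF.
rewrite powRM//; last exact: ltW.
apply: ler_wpM2l; first exact: powR_ge0.
have -> : expR (q * (y / q)) = expR (y / q) `^ q by rewrite -expRM mulrC.
by apply: ge0_ler_powR; rewrite ?nnegrE ?expR_ge0// ltW.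
Qed.

(** After normalising the coefficients, the power [q] of the linear form is
    dominated by the sum of two exponentials of mean [expR 2^-1]: the bound
    does not see the dimension. *)
Lemma gauss_linear_moment (q : R) u : 0 < q ->
  (\int[g]_t (`|tuple_dot u t| `^ q)%:E <=
   (2 * (q `^ q * expR 2^-1) * Num.sqrt (tuple_dot u u) `^ q)%:E)%E.
Proof.
move=> q0; set s := Num.sqrt _.
have uu0 : 0 <= tuple_dot u u by apply: sumr_ge0 => j _; rewrite -expr2 sqr_ge0.
have [s0|s0] := eqVneq s 0.
  have u0 j : tnth u j = 0.
    have : tuple_dot u u == 0 by rewrite eq_le uu0 andbT -sqrtr_eq0 -/s s0.
    rewrite psumr_eq0 => [/allP/(_ j (mem_index_enum _))|k _]; last by rewrite -expr2 sqr_ge0.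
    by rewrite /= -expr2 sqrf_eq0 => /eqP.
  rewrite (eq_integral (fun=> 0%E)) ?integral0.
    by rewrite lee_fin mulr_ge0 ?powR_ge0// mulr_ge0// mulr_ge0 ?powR_ge0 ?expR_ge0.
  move=> t _; rewrite /tuple_dot big1 ?normr0 ?powR0// ?gt_eqF// => j _.
  by rewrite u0 mul0r.
have sp : 0 < s by rewrite lt_neqAle eq_sym s0 sqrtr_ge0.
pose v : N.-tuple R := [tuple s^-1 * tnth u j | j < N].
pose w : N.-tuple R := [tuple - tnth v j | j < N].
have vE t : tuple_dot v t = s^-1 * tuple_dot u t.
  by rewrite /tuple_dot mulr_sumr; apply: eq_bigr => j _; rewrite tnth_mktuple mulrA.
have wE t : tuple_dot w t = - tuple_dot v t.
  by rewrite /tuple_dot -sumrN; apply: eq_bigr => j _; rewrite tnth_mktuple mulNr.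
have vv : tuple_dot v v = 1.
  rewrite vE; have -> : tuple_dot u v = s^-1 * tuple_dot u u.
    by rewrite /tuple_dot mulr_sumr; apply: eq_bigr => j _; rewrite tnth_mktuple mulrCA.
  rewrite -(sqr_sqrtr uu0) -/s; field; exact: s0.
have ww : tuple_dot w w = 1.
  rewrite wE; have -> : tuple_dot v w = - tuple_dot v v.
    by rewrite /tuple_dot -sumrN; apply: eq_bigr => j _; rewrite [tnth w j]tnth_mktuple mulrN.
  by rewrite opprK.
have mexp z : measurable_fun [set: N.-tuple R] (fun t => (expR (tuple_dot z t))%:E).
  by apply/measurable_EFinP; apply: measurableT_comp => //; exact: measurable_tuple_dot.
apply: (@le_trans _ _ (\int[g]_t ((s `^ q * q `^ q)%:E *
    ((expR (tuple_dot v t))%:E + (expR (tuple_dot w t))%:E))))%E.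
  apply: ge0_le_integral => //.
  - apply/measurable_EFinP; apply: (measurableT_comp (measurable_powR _)).
    by apply: measurableT_comp => //; exact: measurable_tuple_dot.
  - by apply: emeasurable_funM => //; exact: emeasurable_funD.
  - move=> t _; rewrite -EFinD -EFinM lee_fin -mulrA.
    have -> : `|tuple_dot u t| = s * `|tuple_dot v t|.
      rewrite vE normrM gtr0_norm ?invr_gt0// mulVKf//.
    rewrite powRM; [|exact: ltW|by []]; apply: ler_wpM2l; first exact: powR_ge0.
    apply: le_trans (powR_le_expR q0 (normr_ge0 _)) _.
    apply: ler_wpM2l; first exact: powR_ge0.
    rewrite wE; case: (ger0P (tuple_dot v t)) => _; rewrite ?lerDl ?lerDr ?expR_ge0//.
rewrite ge0_integralZl//; last 3 first.
- exact: emeasurable_funD.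
- by move=> t _; rewrite adde_ge0// lee_fin expR_ge0.
- by rewrite lee_fin mulr_ge0// powR_ge0.
rewrite ge0_integralD//.
rewrite !gauss_mgf vv ww div1r -EFinD -EFinM lee_fin le_eqVlt; apply/orP; left.
by apply/eqP; ring.
Qed.

(** The scale against which polynomial growth is measured. *)
Definition weight (x : 'rV[R]_N) : R := 1 + \sum_(j < N) `|x ord0 j|.

Lemma weight_ge1 x : 1 <= weight x. Proof. by rewrite lerDl sumr_ge0. Qed.

Lemma weight_ge0 x : 0 <= weight x. Proof. exact: le_trans (weight_ge1 x). Qed.

Lemma measurable_weight : measurable_fun [set: N.-tuple R] (fun t => weight (vec t)).
Proof.
apply: measurable_funD => //; apply: measurable_sum => j.
apply: measurableT_comp => //.
rewrite (_ : (fun t => _) = (@tnth N R)^~ j); first exact: measurable_tnth.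
by apply/funext => t; rewrite mxE.
Qed.

(** Each coordinate is a linear form, with finite moments. *)
Lemma Lpc_weight_lty (q : R) : 1 <= q -> (Lpc g q (fun t => (weight (vec t))%:C) < +oo)%E.
Proof.
move=> q1; have q0 : 0 < q by exact: lt_le_trans q1.
have mj j : measurable_fun [set: N.-tuple R] (fun t : N.-tuple R => `|tnth t j|).
  by apply: measurableT_comp => //; exact: measurable_tnth.
have mcj j : cmeasurable (fun t : N.-tuple R => (`|tnth t j|)%:C).
  exact: (@cmeasurable_real _ _ _ (fun t : N.-tuple R => `|tnth t j|)).
rewrite (eq_Lpc _ _ (G := fun t => 1 + \sum_(j < N) (`|tnth t j|)%:C)); last first.
  move=> t; rewrite rmorphD rmorph1 rmorph_sum; congr (_ + _).
  by apply: eq_bigr => j _; rewrite mxE.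
apply: le_lt_trans (LpcD _ q1 _ _) _.
- exact: cmeasurable_cst.
- exact: cmeasurable_sum.
apply: lte_add_pinfty.
  rewrite LpcE; under eq_integral do rewrite ComplexField.Normc.normc1 powR1.
  by rewrite integral_cst// mul1e [X in (X `^ _)%E](gauss_measureT R N) poweR_EFin ltry.
apply: le_lt_trans (Lpc_sum _ q1 _ _) _ => //.
apply: lte_sum_pinfty => j _; rewrite LpcE poweR_lty//.
pose u : N.-tuple R := [tuple (k == j)%:R | k < N].
have uE t : tuple_dot u t = tnth t j.
  rewrite /tuple_dot (bigD1 j)//= tnth_mktuple eqxx mul1r big1 ?addr0// => k kj.
  by rewrite tnth_mktuple (negbTE kj) mul0r.
apply: le_lt_trans (ltry (2 * (q `^ q * expR 2^-1) * Num.sqrt (tuple_dot u u) `^ q)).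
apply: le_trans (gauss_linear_moment u q0).
by under eq_integral do rewrite normcR normr_id -uE.
Qed.

Lemma integral_weight_lty (q : R) : 1 <= q -> (\int[g]_t ((weight (vec t)) `^ q)%:E < +oo)%E.
Proof.
move=> q1; have q0 : 0 < q by exact: lt_le_trans q1.
have := poweR_lty q (Lpc_weight_lty q1); rewrite LpcX//.
by under eq_integral do rewrite normcR ger0_norm ?weight_ge0//.
Qed.

End moments.

(** * Complex integrals and means over rotations *)

Section cintegral.
Context (R : realType) d (T : measurableType d) (mu : {measure set T -> \bar R}).
Implicit Types F G : T -> R[i].

Definition Cint F : R[i] := (\int[mu]_t Re (F t)) +i* (\int[mu]_t Im (F t)).

Definition cintegrable F :=
  mu.-integrable [set: T] (EFin \o (Re \o F)) /\
  mu.-integrable [set: T] (EFin \o (Im \o F)).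

Lemma cintegrable_cmeasurable F : cintegrable F -> cmeasurable F.
Proof.
move=> [/measurable_int/measurable_EFinP F1 /measurable_int/measurable_EFinP F2].
by split.
Qed.

Lemma eq_Cint F G : F =1 G -> Cint F = Cint G.
Proof. by move=> /funext ->. Qed.

Lemma eq_cintegrable F G : F =1 G -> cintegrable F -> cintegrable G.
Proof. by move=> /funext ->. Qed.

Lemma cintegrableD F G : cintegrable F -> cintegrable G ->
  cintegrable (fun t => F t + G t).
Proof.
move=> [F1 F2] [G1 G2]; split.
- rewrite (_ : EFin \o _ = (EFin \o (Re \o F)) \+ (EFin \o (Re \o G)))%E; last first.
    by apply/funext => t; rewrite /= ReD.
  exact: integrableD.
- rewrite (_ : EFin \o _ = (EFin \o (Im \o F)) \+ (EFin \o (Im \o G)))%E; last first.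
    by apply/funext => t; rewrite /= ImD.
  exact: integrableD.
Qed.

Lemma CintD F G : cintegrable F -> cintegrable G ->
  Cint (fun t => F t + G t) = Cint F + Cint G.
Proof.
move=> [F1 F2] [G1 G2]; rewrite /Cint.
under eq_Rintegral do rewrite ReD.
under [X in _ +i* X]eq_Rintegral do rewrite ImD.
by rewrite !RintegralD.
Qed.

Lemma ReM (z w : R[i]) : Re (z * w) = Re z * Re w - Im z * Im w.
Proof. by case: z w => ? ? []. Qed.

Lemma ImM (z w : R[i]) : Im (z * w) = Re z * Im w + Im z * Re w.
Proof. by case: z w => ? ? []. Qed.

Lemma cintegrableZ c F : cintegrable F -> cintegrable (fun t => c * F t).
Proof.
move=> [F1 F2]; split.
- rewrite (_ : EFin \o _ = (fun t => (Re c)%:E * (EFin \o (Re \o F)) t) \+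
    (fun t => (- Im c)%:E * (EFin \o (Im \o F)) t))%E; last first.
    by apply/funext => t; rewrite /= ReM -!EFinM -EFinD mulNr.
  by apply: integrableD => //; exact: integrableZl.
- rewrite (_ : EFin \o _ = (fun t => (Re c)%:E * (EFin \o (Im \o F)) t) \+
    (fun t => (Im c)%:E * (EFin \o (Re \o F)) t))%E; last first.
    by apply/funext => t; rewrite /= ImM -!EFinM -EFinD.
  by apply: integrableD => //; exact: integrableZl.
Qed.

Lemma CintZ c F : cintegrable F -> Cint (fun t => c * F t) = c * Cint F.
Proof.
move=> [F1 F2]; rewrite /Cint.
under eq_Rintegral do rewrite ReM.
under [X in _ +i* X]eq_Rintegral do rewrite ImM.
have i1 r (h : T -> R) : mu.-integrable [set: T] (EFin \o h) ->
    mu.-integrable [set: T] (EFin \o (fun t => r * h t)).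
  move=> ih; rewrite (_ : EFin \o _ = fun t => (r%:E * (EFin \o h) t)%E)//.
  exact: integrableZl.
rewrite RintegralB ?RintegralD; try (by []); try (by apply: i1).
by rewrite !RintegralZl//; case: c.
Qed.

Lemma cintegrable0 : cintegrable (fun=> 0).
Proof. by split; rewrite (_ : EFin \o _ = cst 0%E)//; exact: integrable0. Qed.

Lemma Cint0 : Cint (fun=> 0) = 0.
Proof. by rewrite /Cint /= !Rintegral_cst// !mul0r. Qed.

Lemma cintegrable_sum (I : Type) (r : seq I) (F : I -> T -> R[i]) :
  (forall i, cintegrable (F i)) -> cintegrable (fun t => \sum_(i <- r) F i t).
Proof.
move=> iF; elim: r => [|i r IH].
  by apply: eq_cintegrable cintegrable0 => t; rewrite big_nil.
by apply: eq_cintegrable (cintegrableD (iF i) IH) => t; rewrite big_cons.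
Qed.

Lemma Cint_sum (I : Type) (r : seq I) (F : I -> T -> R[i]) :
  (forall i, cintegrable (F i)) ->
  Cint (fun t => \sum_(i <- r) F i t) = \sum_(i <- r) Cint (F i).
Proof.
move=> iF; elim: r => [|i r IH].
  by rewrite big_nil -[RHS]Cint0; apply: eq_Cint => t; rewrite big_nil.
rewrite big_cons -IH -CintD//; last exact: cintegrable_sum.
by apply: eq_Cint => t; rewrite big_cons.
Qed.

Lemma cintegrable_bounded F (h : T -> R) : cmeasurable F ->
  (forall t, normc (F t) <= h t) -> mu.-integrable [set: T] (EFin \o h) -> cintegrable F.
Proof.
move=> [F1 F2] Fh ih.
have h0 t : 0 <= h t by exact: le_trans (normc_ge0 _) (Fh t).
split; apply: le_integrable ih => //.
- exact/measurable_EFinP.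
- move=> t _ /=; rewrite lee_fin (ger0_norm (h0 _)); apply: le_trans (Fh t).
  by rewrite normcE -sqrtr_sqr ler_wsqrtr// lerDl sqr_ge0.
- exact/measurable_EFinP.
- move=> t _ /=; rewrite lee_fin (ger0_norm (h0 _)); apply: le_trans (Fh t).
  by rewrite normcE -sqrtr_sqr ler_wsqrtr// lerDr sqr_ge0.
Qed.

End cintegral.

Section transport.
Context (R : realType) d d' (T : measurableType d) (T' : measurableType d').
Variables (mu : {measure set T -> \bar R}) (nu : {measure set T' -> \bar R}) (h : T -> T').
Hypothesis hE : forall H : T' -> \bar R, measurable_fun [set: T'] H ->
  (forall x, 0 <= H x)%E -> (\int[mu]_t H (h t) = \int[nu]_t H t)%E.

Lemma integral_transport (f : T' -> \bar R) : measurable_fun [set: T'] f ->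
  (\int[mu]_t f (h t) = \int[nu]_t f t)%E.
Proof.
move=> mf; rewrite integralE [RHS]integralE; congr (_ - _)%E.
- rewrite -(hE (measurable_funepos mf) (fun x => funepos_ge0 f x)).
  by apply: eq_integral => x _; rewrite !funeposE.
- rewrite -(hE (measurable_funeneg mf) (fun x => funeneg_ge0 f x)).
  by apply: eq_integral => x _; rewrite !funenegE.
Qed.

Lemma Cint_transport (F : T' -> R[i]) : cmeasurable F -> Cint mu (F \o h) = Cint nu F.
Proof.
move=> [F1 F2]; rewrite /Cint /Rintegral /=.
rewrite (integral_transport (f := EFin \o (Re \o F))); last exact/measurable_EFinP.
by rewrite (integral_transport (f := EFin \o (Im \o F)))//; exact/measurable_EFinP.
Qed.

Lemma cintegrable_transport (F : T' -> R[i]) : measurable_fun [set: T] h ->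
  cintegrable nu F -> cintegrable mu (F \o h).
Proof.
move=> mh iF; have [mF1 mF2] := cintegrable_cmeasurable iF; move: iF => [F1 F2].
split; apply/integrableP; split.
- by apply/measurable_EFinP; exact: (measurableT_comp mF1).
- move/integrableP : F1 => [_]; rewrite -hE//.
  by apply: measurableT_comp => //; exact/measurable_EFinP.
- by apply/measurable_EFinP; exact: (measurableT_comp mF2).
- move/integrableP : F2 => [_]; rewrite -hE//.
  by apply: measurableT_comp => //; exact/measurable_EFinP.
Qed.

End transport.

Section fubini.
Context (R : realType) d d' (T : measurableType d) (T' : measurableType d').
Variables (mu : {sigma_finite_measure set T -> \bar R}) (nu : {sigma_finite_measure set T' -> \bar R}).

Lemma Cint_fubini (F : T * T' -> R[i]) :
  cintegrable (mu \x nu)%E F ->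
  (forall x, cintegrable nu (fun y => F (x, y))) ->
  Cint mu (fun x => Cint nu (fun y => F (x, y))) = Cint (mu \x nu)%E F.
Proof.
move=> [F1 F2] F12; rewrite /Cint /Rintegral /=; congr (_ +i* _); congr fine.
- rewrite -integral12_prod_meas1//; apply: eq_integral => x _.
  have [G1 _] := F12 x; rewrite fineK//; exact: integrable_fin_num.
- rewrite -integral12_prod_meas1//; apply: eq_integral => x _.
  have [_ G2] := F12 x; rewrite fineK//; exact: integrable_fin_num.
Qed.

End fubini.

(** Only the powers divisible by [M] survive the mean over the roots. *)
Lemma root_average (R : realType) M (w : R[i]) (q : {poly R[i]}) :
  M.-primitive_root w -> (size q <= M)%N ->
  M%:R^-1 * \sum_(l < M) q.[w ^+ l] = q`_0.
Proof.
move=> wp sq; have M0 := prim_order_gt0 wp.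
under eq_bigr do rewrite (horner_coef_wide _ sq).
rewrite exchange_big /=.
rewrite (eq_bigr (fun k : 'I_M => q`_k * (if (M %| k)%N then M%:R else 0))); last first.
  move=> k _; rewrite -mulr_sumr; congr (_ * _).
  by rewrite -(sum_prim_root k wp); apply: eq_bigr => l _; rewrite exprM.
case: M M0 wp sq => // M _ wp sq.
rewrite big_ord_recl /= ?dvdn0 big1 ?addr0 => [|k _].
  by rewrite mulrCA mulVf ?mulr1// pnatr_eq0.
by rewrite /bump /= add1n gtnNdvd ?mulr0// ltnS.
Qed.

(** Averaging over a group of roots of unity leaves the integral unchanged and
    reduces the polynomial in the rotation to its constant term. *)
Lemma Cint_rotation_average (R : realType) d (T : measurableType d)
    (mu : probability T R) (F : T -> R[i]) (D : nat) (c : R[i]) (rot : R[i] -> T -> T) :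
  (forall u, measurable_fun [set: T] (rot u)) ->
  (forall u (H : T -> \bar R), normc u = 1 -> measurable_fun [set: T] H ->
    (forall x, 0 <= H x)%E -> (\int[mu]_t H (rot u t) = \int[mu]_t H t)%E) ->
  cintegrable mu F ->
  (forall t, exists q : {poly R[i]}, [/\ (size q <= D)%N, q`_0 = c &
    forall u, normc u = 1 -> F (rot u t) = q.[u]]) ->
  Cint mu F = c.
Proof.
move=> mrot rotE iF Fq.
have [w wp] := complex_prim_root R (ltn0Sn D).
have w1 l : normc (w ^+ l) = 1 by rewrite normcX (normc_unity wp) expr1n.
have D0 : D.+1%:R != 0 :> R[i] by rewrite pnatr_eq0.
have mF := cintegrable_cmeasurable iF.
have iFl l : cintegrable mu (F \o rot (w ^+ l)).
  by apply: (cintegrable_transport (nu := mu)) => // H mH H0; exact: rotE.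
transitivity (D.+1%:R^-1 * \sum_(l < D.+1) Cint mu (F \o rot (w ^+ l))).
  rewrite (eq_bigr (fun=> Cint mu F)) => [|l _].
    by rewrite sumr_const card_ord -[Cint mu F *+ _]mulr_natl mulKf.
  by apply: Cint_transport => // H mH H0; exact: rotE.
rewrite -Cint_sum// -CintZ; last exact: cintegrable_sum.
rewrite (@eq_Cint _ _ _ _ _ (fun=> c)) => [|t].
  have Er (r : R) : \int[mu]_(_ in [set: T]) r = r.
    by rewrite Rintegral_cst// [X in fine X](probability_setT mu) mulr1.
  by rewrite /Cint !Er; case: c {Fq}.
have [q [sq q0 qE]] := Fq t.
under eq_bigr do rewrite /= qE//.
by rewrite (root_average wp)// ltnW// ltnS.
Qed.

(** * Integrability of polynomial functions *)

Section growth.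
Context (R : realType).

Lemma normc_coord_weight N (x : 'rV[R]_N) j : `|x ord0 j| <= weight x.
Proof.
by rewrite /weight (bigD1 j)//= addrCA lerDl addr_ge0// sumr_ge0.
Qed.

Lemma polyfun_growth N (F : 'rV[R]_N -> R[i]) : polyfun F ->
  exists (C : R) (m : nat), 0 <= C /\ forall x, normc (F x) <= C * weight x ^+ m.
Proof.
elim=> [c|j|F1 F2 _ [C1 [m1 [C10 H1]]] _ [C2 [m2 [C20 H2]]]
  |F1 F2 _ [C1 [m1 [C10 H1]]] _ [C2 [m2 [C20 H2]]]].
- by exists (normc c), 0%N; split=> [|x]; rewrite ?normc_ge0// expr0 mulr1.
- exists 1, 1%N; split=> // x; rewrite normcR mul1r expr1.
  exact: normc_coord_weight.
- exists (C1 + C2), (m1 + m2)%N; split=> [|x]; first exact: addr_ge0.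
  apply: le_trans (le_normcD _ _) _; rewrite mulrDl; apply: lerD.
  + apply: le_trans (H1 x) _; apply: ler_wpM2l => //.
    by rewrite ler_weXn2l ?weight_ge1// leq_addr.
  + apply: le_trans (H2 x) _; apply: ler_wpM2l => //.
    by rewrite ler_weXn2l ?weight_ge1// leq_addl.
- exists (C1 * C2), (m1 + m2)%N; split=> [|x]; first exact: mulr_ge0.
  rewrite ComplexField.Normc.normcM exprD mulrACA.
  by apply: ler_pM; rewrite ?normc_ge0.
Qed.

Lemma cintegrable_polyfun N (F : 'rV[R]_N -> R[i]) : polyfun F ->
  cintegrable (gauss_measure R N) (F \o @vec R N).
Proof.
move=> pF; have [C [m [C0 Fm]]] := polyfun_growth pF.
apply: (cintegrable_bounded (h := fun t => C * weight (vec t) `^ m.+1%:R)).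
- exact: cmeasurable_polyfun.
- move=> t; apply: le_trans (Fm _) _; apply: ler_wpM2l => //.
  by rewrite powR_mulrn ?weight_ge0// ler_weXn2l ?weight_ge1.
have mw : measurable_fun [set: N.-tuple R] (fun t : N.-tuple R => (weight (vec t) `^ m.+1%:R)%:E).
  apply/measurable_EFinP; apply: (measurableT_comp (measurable_powR _)).
  exact: measurable_weight.
rewrite (_ : EFin \o _ = fun t => (C%:E * (weight (vec t) `^ m.+1%:R)%:E)%E)//.
apply: integrableZl => //; apply/integrableP; split => //.
under eq_integral do rewrite /= ger0_norm ?powR_ge0//.
by apply: integral_weight_lty; rewrite ler1n.
Qed.

Lemma polyfun_rowmx N M (h1 : 'rV[R]_M -> 'rV[R]_N) (h2 : 'rV[R]_M -> 'rV[R]_N)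
  (F : 'rV[R]_(N + N) -> R[i]) : polyfun F ->
  (forall j, polyfun (fun x => (h1 x ord0 j)%:C)) ->
  (forall j, polyfun (fun x => (h2 x ord0 j)%:C)) ->
  polyfun (fun x => F (row_mx (h1 x) (h2 x))).
Proof.
move=> pF p1 p2; apply: (polyfun_comp (h := fun x => row_mx (h1 x) (h2 x)) pF) => j.
case: (split_ordP j) => k ->.
- by apply: eq_polyfun (p1 k) => x; rewrite row_mxEl.
- by apply: eq_polyfun (p2 k) => x; rewrite row_mxEr.
Qed.

(** This is what makes an integral over the second group of variables
    polynomial in the first one. *)
Lemma polyfun_separate N M (F : 'rV[R]_(N + M) -> R[i]) : polyfun F ->
  exists (k : nat) (A : 'I_k -> 'rV[R]_N -> R[i]) (B : 'I_k -> 'rV[R]_M -> R[i]),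
    [/\ forall i, polyfun (A i), forall i, polyfun (B i) &
        forall x y, F (row_mx x y) = \sum_(i < k) A i x * B i y].
Proof.
elim=> [c|j|F1 F2 _ [k1 [A1 [B1 [pA1 pB1 H1]]]] _ [k2 [A2 [B2 [pA2 pB2 H2]]]]
  |F1 F2 _ [k1 [A1 [B1 [pA1 pB1 H1]]]] _ [k2 [A2 [B2 [pA2 pB2 H2]]]]].
- exists 1%N, (fun _ _ => c), (fun _ _ => 1); split => [i|i|x y]; try exact: polyfun_cst.
  by rewrite big_ord1 mulr1.
- case: (split_ordP j) => k ->.
  + exists 1%N, (fun _ x => (x ord0 k)%:C), (fun _ _ => 1); split => [i|i|x y].
    * exact: polyfun_coord.
    * exact: polyfun_cst.
    * by rewrite big_ord1 mulr1 row_mxEl.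
  + exists 1%N, (fun _ _ => 1), (fun _ y => (y ord0 k)%:C); split => [i|i|x y].
    * exact: polyfun_cst.
    * exact: polyfun_coord.
    * by rewrite big_ord1 mul1r row_mxEr.
- exists (k1 + k2)%N,
    (fun i => match fintype.split i with inl i1 => A1 i1 | inr i2 => A2 i2 end),
    (fun i => match fintype.split i with inl i1 => B1 i1 | inr i2 => B2 i2 end).
  split => [i|i|x y]; try by case: fintype.split.
  rewrite H1 H2 big_split_ord; congr (_ + _); apply: eq_bigr => i _.
  + by rewrite (_ : fintype.split _ = inl i)//; exact: (unsplitK (inl i)).
  + by rewrite (_ : fintype.split _ = inr i)//; exact: (unsplitK (inr i)).
- pose e (i : 'I_#|{: 'I_k1 * 'I_k2}|) : 'I_k1 * 'I_k2 := enum_val i.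
  exists #|{: 'I_k1 * 'I_k2}|, (fun i x => A1 (e i).1 x * A2 (e i).2 x),
    (fun i y => B1 (e i).1 y * B2 (e i).2 y).
  split => [i|i|x y]; try exact: polyfunM.
  rewrite H1 H2 big_distrlr pair_big /=.
  rewrite (reindex e) /=; last by apply: onW_bij; exact: enum_val_bij.
  by apply: eq_bigr => i _; rewrite mulrACA.
Qed.

Lemma polyfun_Cint N M (F : 'rV[R]_(N + M) -> R[i]) : polyfun F ->
  polyfun (fun x => Cint (gauss_measure R M) (fun y => F (row_mx x (vec y)))).
Proof.
move=> /polyfun_separate[k [A [B [pA pB FE]]]].
have iB i : cintegrable (gauss_measure R M) (B i \o @vec R M) by exact: cintegrable_polyfun.
apply: (@eq_polyfun _ _ (fun x => \sum_(i < k) A i x * Cint (gauss_measure R M) (B i \o @vec R M))).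
  move=> x; under eq_bigr do rewrite -CintZ//.
  rewrite -Cint_sum; first by apply: eq_Cint => y; rewrite FE.
  by move=> i; exact: cintegrableZ.
by apply: polyfun_sum => i; apply: polyfunM => //; exact: polyfun_cst.
Qed.

Lemma cintegrable_polyfun2 N M (F : 'rV[R]_(N + M) -> R[i]) : polyfun F ->
  cintegrable (gauss_measure R N \x gauss_measure R M)%E
    (fun z => F (row_mx (vec z.1) (vec z.2))).
Proof.
move=> pF.
apply: (@eq_cintegrable _ _ _ _ ((F \o @vec R (N + M)) \o
  (fun z : N.-tuple R * M.-tuple R => [tuple of z.1 ++ z.2]))).
  by move=> z; rewrite /= vec_cat.
apply: (cintegrable_transport (nu := gauss_measure R (N + M))).
- by move=> H mH H0; rewrite gauss_cat.
- exact: measurable_cat.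
- exact: cintegrable_polyfun.
Qed.

End growth.

(** * Order of vanishing of a Hermite expansion *)

Section hermite.
Context (R : realType).

(** The integrand of the Hermite polynomial, with both groups of variables
    on the same footing. *)
Definition monomial2 N (a : {ffun 'I_N -> nat}) (z : 'rV[R]_(N + N)) : R[i] :=
  \prod_(j < N) ((z ord0 (lshift N j))%:C + 'i%C * (z ord0 (rshift N j))%:C) ^+ a j.

Lemma polyfun_monomial2 N (a : {ffun 'I_N -> nat}) : polyfun (monomial2 a).
Proof.
apply: polyfun_prod => j; apply: polyfunX; apply: polyfunD; first exact: polyfun_coord.
by apply: polyfunM; [exact: polyfun_cst|exact: polyfun_coord].
Qed.

Lemma monomial2_row_mx N (a : {ffun 'I_N -> nat}) (x y : 'rV[R]_N) :
  monomial2 a (row_mx x y) = \prod_(j < N) (x ord0 j +i* y ord0 j) ^+ a j.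
Proof.
apply: eq_bigr => j _; rewrite row_mxEl row_mxEr; congr (_ ^+ _).
by rewrite [RHS]complexE.
Qed.

Lemma hermiteE N (a : {ffun 'I_N -> nat}) x :
  hermite a x = Cint (gauss_measure R N) (fun y => monomial2 a (row_mx x (vec y))).
Proof. by apply: eq_Cint => y; rewrite monomial2_row_mx. Qed.

Lemma polyfun_hermite N (a : {ffun 'I_N -> nat}) : polyfun (@hermite R N a).
Proof.
apply: eq_polyfun (polyfun_Cint (polyfun_monomial2 a)) => x.
by rewrite hermiteE.
Qed.

Lemma polyfun_hermite_ge d N (F : 'rV[R]_N -> R[i]) : hermite_ge d F -> polyfun F.
Proof.
move=> [s [c [_ FE]]].
apply: (@eq_polyfun _ _ (fun x => \sum_(a <- s) c a * hermite a x)) => //.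
by apply: polyfun_sum => a; apply: polyfunM; [exact: polyfun_cst|exact: polyfun_hermite].
Qed.

Lemma polyfun_shift N (F : 'rV[R]_N -> R[i]) u : polyfun F -> polyfun (fun x => F (u + x)).
Proof.
move=> pF; apply: (polyfun_comp (h := fun x => u + x) pF) => j.
apply: (@eq_polyfun _ _ (fun x => (u ord0 j)%:C + (x ord0 j)%:C)).
  by move=> x; rewrite !mxE rmorphD.
by apply: polyfunD; [exact: polyfun_cst|exact: polyfun_coord].
Qed.

(** The Hermite polynomial is itself a mean over [y], so the left-hand side is
    the mean of [(u + x + i y)^a] over the pair [(x, y)], which is invariant
    under the multiplication of [x + i y] by a unit: only the term of degree
    [0] in [x + i y] survives. *)
Lemma hermite_mean N (a : {ffun 'I_N -> nat}) (u : 'rV[R]_N) :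
  Cint (gauss_measure R N) (fun x => hermite a (u + vec x)) =
  \prod_(j < N) (u ord0 j)%:C ^+ a j.
Proof.
pose F (z : 'rV[R]_(N + N)) := monomial2 a (row_mx u 0 + z).
have pF : polyfun F by apply: polyfun_shift; exact: polyfun_monomial2.
have FE x y : F (row_mx x y) = monomial2 a (row_mx (u + x) y).
  by rewrite /F add_row_mx add0r.
have iF := cintegrable_polyfun2 pF.
transitivity (Cint (gauss_measure R N \x gauss_measure R N)%E
    (fun z => F (row_mx (vec z.1) (vec z.2)))).
  rewrite -(Cint_fubini iF) => [|x].
    by apply: eq_Cint => x; rewrite hermiteE; apply: eq_Cint => y; rewrite FE.
  apply: (cintegrable_polyfun (F := fun y => F (row_mx (vec x) y))).
  apply: (polyfun_rowmx (h1 := fun=> vec x) (h2 := id) pF) => j.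
    exact: polyfun_cst.
  exact: polyfun_coord.
have [D HD] := polyfun_on_line (polyfun_monomial2 a).
apply: (@Cint_rotation_average _ _ _ _ _ D _ (fun w => pair_rot (Re w) (Im w))) => //.
- by move=> w; exact: measurable_pair_rot.
- by move=> w H w1 mH H0; apply: gauss2_rot => //; exact: unit_sqr.
move=> [x y].
pose xi : 'rV[R[i]]_N := \row_j (tnth x j +i* tnth y j).
pose uC : 'rV[R[i]]_N := \row_j (u ord0 j)%:C.
pose q : {poly R[i]} := \prod_(j < N) ((uC ord0 j)%:P + xi ord0 j *: 'X) ^+ a j.
have qE w : q.[w] = \prod_(j < N) (uC ord0 j + w * xi ord0 j) ^+ a j.
  by rewrite horner_prod_affine.
exists q; split.
- have [p sp pE] := HD (row_mx u 0) (row_mx (vec x) (vec y)).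
  rewrite (_ : q = p)//; apply: poly_real_inj => t.
  rewrite -pE qE scale_row_mx add_row_mx add0r monomial2_row_mx.
  apply: eq_bigr => j _; rewrite !mxE; congr (_ ^+ _).
  by apply/eqP; rewrite eq_complex /= !mul0r subr0 add0r addr0 !eqxx.
- rewrite -horner_coef0 qE; apply: eq_bigr => j _.
  by rewrite !mxE mul0r addr0.
- move=> w _; rewrite /= FE monomial2_row_mx qE; apply: eq_bigr => j _.
  rewrite !mxE !tuple_linE; congr (_ ^+ _); case: w => c s.
  by apply/eqP; rewrite eq_complex /= add0r mulNr eqxx addrC eqxx.
Qed.

(** A line polynomial equals its own Gaussian mean, so a Hermite expansion
    starting at degree [d] becomes one in monomials of degree at least [d]. *)
Lemma hermite_ge_monomials n d (f : 'rV[R[i]]_n -> R[i]) :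
  hermite_ge d (on_real f) -> line_polynomial f ->
  exists (s : seq {ffun 'I_(n + n) -> nat}) (c : {ffun 'I_(n + n) -> nat} -> R[i]),
    (forall a, a \in s -> (d <= \sum_(j < n + n) a j)%N) /\
    forall x, on_real f x = \sum_(a <- s) c a * \prod_(j < n + n) (x ord0 j)%:C ^+ a j.
Proof.
move=> hf [D HD]; have pf := polyfun_hermite_ge hf.
have [s [c [sd fE]]] := hf.
exists s, c; split => // u.
have pH a : cintegrable (gauss_measure R (n + n)) (fun x => hermite a (u + vec x)).
  exact: (cintegrable_polyfun (polyfun_shift u (polyfun_hermite a))).
transitivity (Cint (gauss_measure R (n + n)) (fun x => on_real f (u + vec x))).
  apply/esym; apply: (@Cint_rotation_average _ _ _ _ _ D _ (fun w => complex_rot (Re w) (Im w))).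
  - by move=> w; exact: measurable_complex_rot.
  - by move=> w H w1 mH H0; apply: gauss_complex_rot => //; exact: unit_sqr.
  - exact: (cintegrable_polyfun (polyfun_shift u pf)).
  move=> t; have [q sq qE] := HD (to_complex u) (to_complex (vec t)).
  exists q; split => //.
    by rewrite -horner_coef0 -qE scale0r addr0.
  by move=> w _; rewrite -qE /on_real /= to_complexD vec_complex_rot; case: w.
rewrite (eq_Cint _ (G := fun x => \sum_(a <- s) c a * hermite a (u + vec x))) => [|x]; last exact: fE.
rewrite Cint_sum => [|a]; last exact: cintegrableZ.
by apply: eq_bigr => a _; rewrite CintZ// hermite_mean.
Qed.

(** Compare the powers of [t] in the value at [t *: Z], for real [t]. *)
Lemma hermite_ge_vanish n d (f : 'rV[R[i]]_n -> R[i]) :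
  hermite_ge d (on_real f) -> line_polynomial f ->
  forall Z (q : {poly R[i]}), (forall u, f (u *: Z) = q.[u]) ->
  forall k, (k < d)%N -> q`_k = 0.
Proof.
move=> hf lf Z q qE k kd; have [s [c [sd fE]]] := hermite_ge_monomials hf lf.
pose m (a : {ffun 'I_(n + n) -> nat}) := \prod_(j < n + n) (of_complex Z ord0 j)%:C ^+ a j.
have -> : q = \sum_(a <- s) (c a * m a) *: 'X^(\sum_(j < n + n) a j).
  apply: poly_real_inj => t; rewrite -qE horner_sum.
  have -> : t%:C *: Z = to_complex (t *: of_complex Z) by rewrite to_complexZ of_complexK.
  rewrite -[LHS]/(on_real f _) fE; apply: eq_bigr => a _.
  rewrite hornerZ hornerXn -mulrA; congr (_ * _); rewrite -prodrXr -big_split.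
  by apply: eq_bigr => j _; rewrite !mxE rmorphM exprMn mulrC.
rewrite coef_sum big1_seq// => a /andP[_ /sd da].
by rewrite coefZ coefXn ltn_eqF ?mulr0// (leq_trans kd).
Qed.

End hermite.

(** * The generator on analytic functions *)

Section generator.
Context (R : realType) (n : nat).
Implicit Types (f : 'rV[R[i]]_n -> R[i]).

(** The polynomial [q (c X)]. *)
Definition dilate (q : {poly R[i]}) (c : R[i]) : {poly R[i]} :=
  \poly_(k < size q) (q`_k * c ^+ k).

Lemma horner_dilate q c u : (dilate q c).[u] = q.[c * u].
Proof.
rewrite horner_poly horner_coef; apply: eq_bigr => k _.
by rewrite exprMn mulrA.
Qed.

Lemma coef_dilate q c k : (dilate q c)`_k = q`_k * c ^+ k.
Proof.
rewrite coef_poly; case: ltnP => // sk.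
by rewrite nth_default// mul0r.
Qed.

Lemma partial2_on_line N (F : 'rV[R]_N -> R[i]) x j p :
  on_line F x (delta_mx ord0 j) p -> partial j (partial j F) x = p`_2 *+ 2.
Proof.
move=> Fp; rewrite (partial_on_line (p := p^`())) ?coef_deriv// => t.
rewrite (partial_on_line (p := p \Po (t%:C%:P + 1 *: 'X))).
  by rewrite comp_affine1 mulr1.
move=> s; rewrite -addrA -scalerDl Fp horner_comp hornerD hornerZ hornerC hornerX.
by rewrite mul1r rmorphD.
Qed.

Lemma to_complex_delta_l j : to_complex (delta_mx ord0 (lshift n j)) =
  delta_mx ord0 j :> 'rV[R[i]]_n.
Proof.
apply/rowP => k; rewrite !mxE eqxx /= (inj_eq (@lshift_inj _ _)).
by rewrite eq_rlshift; case: (k == j).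
Qed.

Lemma to_complex_delta_r j : to_complex (delta_mx ord0 (rshift n j)) =
  'i%C *: delta_mx ord0 j :> 'rV[R[i]]_n.
Proof.
apply/rowP => k; rewrite !mxE eqxx /= (inj_eq (@rshift_inj _ _)).
by rewrite eq_lrshift; case: (k == j); rewrite ?mulr1 ?mulr0.
Qed.

Lemma to_complexK (x : 'rV[R]_(n + n)) : of_complex (to_complex x) = x.
Proof.
apply/rowP => j; case: (split_ordP j) => k ->.
  by rewrite /of_complex row_mxEl !mxE.
by rewrite /of_complex row_mxEr !mxE.
Qed.

(** Along each complex coordinate line the function is a polynomial in one
    complex variable, hence harmonic. *)
Lemma laplacian_line_polynomial f x : line_polynomial f -> laplacian (on_real f) x = 0.
Proof.
move=> [D HD]; rewrite /laplacian big_split_ord /= -big_split big1//= => j _.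
have [q _ qE] := HD (to_complex x) (delta_mx ord0 j).
rewrite (partial2_on_line (p := q)); last first.
  by move=> t; rewrite -qE /on_real /= to_complexD to_complexZ to_complex_delta_l.
rewrite (partial2_on_line (p := dilate q 'i%C)); last first.
  move=> t; rewrite horner_dilate -qE /on_real /= to_complexD to_complexZ.
  by rewrite to_complex_delta_r scalerA (mulrC 'i%C).
by rewrite coef_dilate sqr_i mulrN1 mulNrn subrr.
Qed.

Lemma ou_generatorE f x : line_polynomial f ->
  ou_generator (on_real f) x = dir_deriv (on_real f) x x.
Proof. by move=> lf; rewrite /ou_generator laplacian_line_polynomial// sub0r opprK. Qed.

(** Euler's identity: the generator multiplies the homogeneous component of
    degree [k] by [k]. *)
Lemma ou_generator_coef f x (q : {poly R[i]}) M : polyfun (on_real f) ->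
  line_polynomial f -> (forall u, f (u *: to_complex x) = q.[u]) -> (size q <= M)%N ->
  ou_generator (on_real f) x = \sum_(k < M) q`_k *+ k.
Proof.
move=> pf lf qE sM; rewrite ou_generatorE//.
rewrite -(dir_deriv_on_line (p := q \Po (1%:P + 1 *: 'X)) pf); last first.
  move=> t; rewrite -[x in x + _]scale1r -scalerDl /on_real /= to_complexZ qE.
  by rewrite horner_comp hornerD hornerZ hornerC hornerX mul1r rmorphD.
rewrite comp_affine1 mulr1 (horner_coef_wide (n := M)); last first.
  by rewrite (leq_trans (size_poly _ _))// (leq_trans (leq_pred _)).
under eq_bigr do rewrite expr1n mulr1 coef_deriv.
case: M sM => [|M] sM; first by rewrite !big_ord0.
rewrite big_ord_recr [RHS]big_ord_recl /= mulr0n add0r nth_default ?mul0rn ?addr0//.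
Qed.

Lemma polyfun_dir_deriv_self N (F : 'rV[R]_N -> R[i]) : polyfun F -> polyfun (fun x => dir_deriv F x x).
Proof.
move=> pF; apply: polyfun_sum => j.
by apply: polyfunM; [exact: polyfun_coord|exact: polyfun_partial].
Qed.

(** The multiplier [1 / (d + j)] inverts the generator on degrees at least
    [d], and its first value is [1 / d]. *)
Lemma generator_lower_bound (p : R) (d : nat) f : 1 <= p ->
  hermite_ge d (on_real f) -> line_polynomial f ->
  (d%:R%:E * Lpc (gauss_measure R (n + n)) p (on_real f \o vec) <=
   Lpc (gauss_measure R (n + n)) p (ou_generator (on_real f) \o vec))%E.
Proof.
move=> p1 hf lf.
have [->|d0] := posnP d; first by rewrite mul0e Lpc_ge0.
have pf := polyfun_hermite_ge hf.
have [D HD] := lf.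
pose F Z := ou_generator (on_real f) (of_complex Z).
have FE : on_real F = ou_generator (on_real f).
  by apply/funext => x; rewrite /on_real /F /= to_complexK.
pose a j : R := (d + j)%:R^-1.
have dj j : 0 < (d + j)%:R :> R by rewrite ltr0n addn_gt0 d0.
have key : (Lpc (gauss_measure R (n + n)) p (on_real f \o vec) <=
    (a 0%N)%:E * Lpc (gauss_measure R (n + n)) p (on_real F \o vec))%E.
  apply: (@Lpc_multiplier _ n p p1 F f a d D).
  - by move=> j; rewrite invr_ge0 ltW.
  - by move=> j; rewrite lef_pV2 ?posrE// ler_nat leq_add2l.
  - move=> j; rewrite /a !addnS -!natr1.
    have := dj j; set m : R := (d + j)%:R => m0.
    have m1 : 0 < m + 1 by rewrite addr_gt0.
    have m2 : 0 < m + 1 + 1 by rewrite addr_gt0.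
    rewrite -subr_ge0.
    have -> : m^-1 + (m + 1 + 1)^-1 - (m + 1)^-1 *+ 2 = 2 / (m * (m + 1) * (m + 1 + 1)).
      by field; rewrite -natrD -/m !gt_eqF.
    by rewrite divr_ge0// !mulr_ge0// ltW.
  - rewrite FE; apply: cmeasurable_polyfun.
    apply: eq_polyfun (polyfun_dir_deriv_self pf) => x.
    by rewrite ou_generatorE.
  move=> Z; have [q sq qE] := HD 0 Z.
  have {}qE u : f (u *: Z) = q.[u] by rewrite -qE add0r.
  have q0 k : (k < d)%N -> q`_k = 0 by exact: hermite_ge_vanish qE _.
  have sD : (D <= d + D.+1)%N by rewrite (leq_trans (leqnSn D))// leq_addl.
  exists (fun j => q`_(d + j) *+ (d + j)) => [u|].
    rewrite /F (ou_generator_coef (q := dilate q u) (M := d + D.+1))//; last 2 first.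
    - by move=> v; rewrite of_complexK horner_dilate -qE scalerA mulrC.
    - by rewrite (leq_trans (size_poly _ _))// (leq_trans sq).
    rewrite big_split_ord /= big1 ?add0r => [|k _].
      by apply: eq_bigr => j _; rewrite coef_dilate mulrnAl.
    by rewrite coef_dilate q0// mul0r mul0rn.
  have := qE 1; rewrite scale1r => ->.
  rewrite (horner_coef_wide (n := d + D.+1)); last exact: leq_trans sD.
  rewrite big_split_ord /= big1 ?add0r => [|k _]; last by rewrite q0// mul0r.
  apply: eq_bigr => j _; rewrite expr1n mulr1 /a fmorphV rmorph_nat -(mulr_natl q`_(d + j)) mulKf//.
  by rewrite pnatr_eq0 -lt0n addn_gt0 d0.
rewrite FE in key.
have d0' : 0 < d%:R :> R by rewrite ltr0n.
apply: le_trans (lee_wpmul2l _ key) _; first by rewrite lee_fin ltW.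
by rewrite muleA -EFinM /a addn0 mulfV ?mul1e// gt_eqF.
Qed.

End generator.

(** * Taylor expansion along a circle *)

Section trigonometric_bounds.
Context (R : realType).
Implicit Types h : R.

Lemma sin_mean_value h : 0 < h -> exists2 x, 0 < x < h & sin h = cos x * h.
Proof.
move=> h0.
have [x] := @MVT R sin cos 0 h h0 (fun x _ => is_derive_sin x)
  (continuous_subspaceT (@continuous_sin R)).
by rewrite in_itv /= sin0 !subr0 => xh ->; exists x.
Qed.

Lemma cos_half h : 1 - cos h = sin (h / 2) ^+ 2 *+ 2.
Proof.
have {1}-> : h = (h / 2) *+ 2 by rewrite -mulr_natr divfK.
rewrite cos_mulr2n !mulr2n; have := cos2Dsin2 (h / 2).
by set c := _ ^+ 2; set s := _ ^+ 2 => cs; rewrite -cs; ring.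
Qed.

Lemma sin_bound h : 0 <= h -> `|sin h| <= h.
Proof.
rewrite le_eqVlt => /predU1P[<-|h0]; first by rewrite sin0 normr0.
have [x _ ->] := sin_mean_value h0.
rewrite normrM (gtr0_norm h0) ler_piMl ?(ltW h0)//.
by rewrite ler_norml cos_geN1 cos_le1.
Qed.

Lemma cos_bound h : 0 <= h -> 0 <= 1 - cos h <= h ^+ 2 / 2.
Proof.
move=> h0; rewrite cos_half mulrn_wge0 ?sqr_ge0//=.
have /sin_bound : 0 <= h / 2 by rewrite divr_ge0.
rewrite -(@ler_pXn2r _ 2)// ?nnegrE ?divr_ge0// real_normK ?num_real// => H.
rewrite -mulr_natr (le_trans (ler_wpM2r _ H))//.
by rewrite le_eqVlt; apply/orP; left; apply/eqP; field.
Qed.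

Lemma sin_lower h : 0 <= h <= 1 -> h - h ^+ 2 / 2 <= sin h <= h.
Proof.
move=> /andP[]; rewrite le_eqVlt => /predU1P[<- _|h0 h1].
  by rewrite sin0 expr0n mul0r subr0 lexx.
have [x /andP[x0 xh] ->] := sin_mean_value h0.
have /andP[c0 c1] := cos_bound (ltW x0).
have x2 : x ^+ 2 <= h.
  rewrite expr2 (le_trans (ler_wpM2l (ltW x0) (le_trans (ltW xh) h1)))//.
  by rewrite mulr1 ltW.
have lo : 1 - h / 2 <= cos x by lra.
have := ler_wpM2l (ltW h0) lo; have := ler_wpM2r (ltW h0) (cos_le1 x).
by rewrite mul1r mulrBr mulr1 mulrA -expr2 (mulrC h (cos x)) => -> ->.
Qed.

(** The half-angle formula with [sin (h / 2) >= h / 4], which leaves room in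
    the constant. *)
Lemma cos_upper h : 0 <= h <= 1 -> cos h <= 1 - h ^+ 2 / 32.
Proof.
move=> /andP[h0 h1].
have h2 : 0 <= h / 2 <= 1 by apply/andP; split; lra.
have /andP[s0 _] := sin_lower h2.
have := cos_half h; rewrite mulr2n; set c := cos h; set s := sin _ in s0 * => H.
have s4 : h / 4 <= s by nra.
have : (h / 4) ^+ 2 <= s ^+ 2 by rewrite ler_pXn2r ?nnegrE//; lra.
by have := sqr_ge0 h; lra.
Qed.

End trigonometric_bounds.

Section taylor.
Context (R : realType).

Definition weight2 N (x w : 'rV[R]_N) : R := weight (row_mx x w).

Lemma weight2E N (x w : 'rV[R]_N) :
  weight2 x w = 1 + (\sum_(j < N) `|x ord0 j| + \sum_(j < N) `|w ord0 j|).
Proof.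
rewrite /weight2 /weight big_split_ord /=; congr (1 + (_ + _)).
  by apply: eq_bigr => j _; rewrite row_mxEl.
by apply: eq_bigr => j _; rewrite row_mxEr.
Qed.

Lemma weight2_ge1 N (x w : 'rV[R]_N) : 1 <= weight2 x w. Proof. exact: weight_ge1. Qed.

Definition circle_point N (x w : 'rV[R]_N) (h : R) := cos h *: x + sin h *: w.

(** First order expansion along the circle through [x] and [w], with a
    remainder of polynomial growth.  The bounds on the value and on the
    derivative make the property stable under products. *)
Definition taylor_bound N (F : 'rV[R]_N -> R[i]) := exists (C : R) (m : nat), 0 <= C /\
  forall x w h, 0 <= h <= 1 ->
  [/\ normc (F x) <= C * weight2 x w ^+ m,
      normc (dir_deriv F x w) <= C * weight2 x w ^+ m &
      normc (F (circle_point x w h) - F x - h%:C * dir_deriv F x w) <= C * h ^+ 2 * weight2 x w ^+ m].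

(** For a product, three terms of second order remain, with constants [1], [3]
    and [2]. *)
Lemma polyfun_taylor_bound N (F : 'rV[R]_N -> R[i]) : polyfun F -> taylor_bound F.
Proof.
elim=> [c|j|F1 F2 p1 [C1 [m1 [C10 H1]]] p2 [C2 [m2 [C20 H2]]]
  |F1 F2 p1 [C1 [m1 [C10 H1]]] p2 [C2 [m2 [C20 H2]]]].
- exists (normc c), 0%N; split=> [|x w h h01]; first exact: normc_ge0.
  rewrite dir_deriv_cst mulr0 !subr0 subrr ComplexField.Normc.normc0 expr0 !mulr1.
  by rewrite lexx mulr_ge0 ?normc_ge0 ?sqr_ge0.
- exists 1, 1%N; split=> // x w h h01.
  have xW : `|x ord0 j| + `|w ord0 j| <= weight2 x w.
    rewrite weight2E (bigD1 j)//= [X in _ + (_ + X)](bigD1 j)//=.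
    have : 0 <= \sum_(i < N | i != j) `|x ord0 i| by exact: sumr_ge0.
    have : 0 <= \sum_(i < N | i != j) `|w ord0 i| by exact: sumr_ge0.
    by move=> ? ?; lra.
  have x0 := normr_ge0 (x ord0 j); have w0 := normr_ge0 (w ord0 j).
  rewrite dir_deriv_coord !normcR !mul1r expr1; split; [lra|lra|].
  have foldC (y1 y2 y3 : R) : y1%:C - y2%:C - h%:C * y3%:C = (y1 - y2 - h * y3)%:C :> R[i].
    by rewrite !rmorphB rmorphM.
  rewrite foldC normcR !mxE.
  have /andP[h0 h1] := h01.
  have /andP[c0 c1] := cos_bound h0; have /andP[s0 s1] := sin_lower h01.
  have -> : cos h * x ord0 j + sin h * w ord0 j - x ord0 j - h * w ord0 j =
    - ((1 - cos h) * x ord0 j + (h - sin h) * w ord0 j) by ring.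
  rewrite normrN (le_trans (ler_normD _ _))// !normrM.
  rewrite (ger0_norm c0) (ger0_norm (x := h - sin h)) ?subr_ge0//.
  by have := sqr_ge0 h; nra.
- exists (C1 + C2), (m1 + m2)%N; split=> [|x w h h01]; first exact: addr_ge0.
  have [a1 b1 r1] := H1 x w h h01; have [a2 b2 r2] := H2 x w h h01.
  have W1 : weight2 x w ^+ m1 <= weight2 x w ^+ (m1 + m2).
    by rewrite ler_weXn2l ?weight2_ge1// leq_addr.
  have W2 : weight2 x w ^+ m2 <= weight2 x w ^+ (m1 + m2).
    by rewrite ler_weXn2l ?weight2_ge1// leq_addl.
  have hh := sqr_ge0 h.
  have up (C B : R) W V : 0 <= C -> B <= C * W -> W <= V -> B <= C * V.
    by move=> C0 BW WV; apply: le_trans BW _; exact: ler_wpM2l.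
  rewrite dir_derivD//; split.
  + apply: le_trans (le_normcD _ _) _; rewrite mulrDl.
    by apply: lerD; [exact: up a1 W1|exact: up a2 W2].
  + apply: le_trans (le_normcD _ _) _; rewrite mulrDl.
    by apply: lerD; [exact: up b1 W1|exact: up b2 W2].
  + have -> : F1 (circle_point x w h) + F2 (circle_point x w h) - (F1 x + F2 x) -
      h%:C * (dir_deriv F1 x w + dir_deriv F2 x w) =
      (F1 (circle_point x w h) - F1 x - h%:C * dir_deriv F1 x w) +
      (F2 (circle_point x w h) - F2 x - h%:C * dir_deriv F2 x w) by ring.
    apply: le_trans (le_normcD _ _) _; rewrite mulrDl mulrDl.
    apply: lerD; [apply: up r1 W1|apply: up r2 W2]; exact: mulr_ge0.
- exists (6 * (C1 * C2)), (m1 + m2)%N; split=> [|x w h h01].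
    by rewrite !mulr_ge0.
  have [a1 b1 r1] := H1 x w h h01; have [a2 b2 r2] := H2 x w h h01.
  rewrite dir_derivM// exprD.
  set V1 := weight2 x w ^+ m1 in a1 b1 r1 *; set V2 := weight2 x w ^+ m2 in a2 b2 r2 *.
  have V10 : 0 <= V1 by rewrite exprn_ge0// (le_trans _ (weight2_ge1 x w)).
  have V20 : 0 <= V2 by rewrite exprn_ge0// (le_trans _ (weight2_ge1 x w)).
  have CV1 : 0 <= C1 * V1 by exact: mulr_ge0.
  have CV2 : 0 <= C2 * V2 by exact: mulr_ge0.
  have CV : 0 <= (C1 * V1) * (C2 * V2) by exact: mulr_ge0.
  have -> : 6 * (C1 * C2) * (V1 * V2) = 6 * ((C1 * V1) * (C2 * V2)) by ring.
  have -> : 6 * (C1 * C2) * h ^+ 2 * (V1 * V2) = 6 * h ^+ 2 * ((C1 * V1) * (C2 * V2)) by ring.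
  have pM (z1 z2 : R[i]) (u1 u2 : R) : normc z1 <= u1 -> normc z2 <= u2 ->
      normc (z1 * z2) <= u1 * u2.
    by move=> zu1 zu2; rewrite ComplexField.Normc.normcM; apply: ler_pM; rewrite ?normc_ge0.
  have /andP[h0 h1] := h01.
  have hh : 0 <= h ^+ 2 <= 1 by rewrite sqr_ge0 expr_le1.
  split.
  + by apply: le_trans (pM _ _ _ _ a1 a2) _; lra.
  + apply: le_trans (le_normcD _ _) _.
    by have := pM _ _ _ _ a1 b2; have := pM _ _ _ _ b1 a2; lra.
  set A1 := F1 x in a1 r1 *; set A2 := F2 x in a2 r2 *.
  set B1 := dir_deriv F1 x w in b1 r1 *; set B2 := dir_deriv F2 x w in b2 r2 *.
  set P1 := F1 _ in r1 *; set P2 := F2 _ in r2 *.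
  set r1' := P1 - A1 - _ in r1; set r2' := P2 - A2 - _ in r2.
  have nP2 : normc P2 <= 3 * (C2 * V2).
    have -> : P2 = A2 + h%:C * B2 + r2' by rewrite /r2'; ring.
    apply: le_trans (le_normcD _ _) _.
    have := le_normcD A2 (h%:C * B2).
    rewrite ComplexField.Normc.normcM normcR (ger0_norm h0).
    have := ler_wpM2l h0 b2; have : C2 * h ^+ 2 * V2 <= C2 * V2 by nra.
    by have := ler_piMl CV2 h1; lra.
  have nAB1 : normc (A1 + h%:C * B1) <= 2 * (C1 * V1).
    apply: le_trans (le_normcD _ _) _.
    rewrite ComplexField.Normc.normcM normcR (ger0_norm h0).
    have := ler_wpM2l h0 b1.
    by have := ler_piMl CV1 h1; lra.
  have -> : P1 * P2 - A1 * A2 - h%:C * (A1 * B2 + B1 * A2) =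
    (h ^+ 2)%:C * (B1 * B2) + (r1' * P2 + (A1 + h%:C * B1) * r2').
    by rewrite /r1' /r2' rmorphXn /=; ring.
  apply: le_trans (le_normcD _ _) _.
  have := le_normcD (r1' * P2) ((A1 + h%:C * B1) * r2').
  have := pM _ _ _ _ r1 nP2; have := pM _ _ _ _ nAB1 r2.
  rewrite [normc ((h ^+ 2)%:C * _)]ComplexField.Normc.normcM normcR ger0_norm ?sqr_ge0//.
  have := ler_wpM2l (sqr_ge0 h) (pM _ _ _ _ b1 b2).
  by lra.
Qed.

End taylor.

(** * Gaussian directional derivatives *)

Section pair.
Context (R : realType) (N : nat) (p : R).
Hypothesis p1 : 1 <= p.
Local Notation T := (N.-tuple R).
Local Notation g := (gauss_measure R N).
Local Notation g2 := (gauss_measure R N \x gauss_measure R N)%E.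

Let p0 : 0 < p. Proof. exact: lt_le_trans p1. Qed.

Lemma Lpc_fst (H : T -> R[i]) : cmeasurable H -> Lpc g2 p (fun z => H z.1) = Lpc g p H.
Proof.
move=> mH; apply: (@Lpc_map _ _ _ _ _ g2 g fst p H) => // K mK K0.
rewrite (fubini_tonelli1 (fun z => K z.1))//; last exact: measurableT_comp.
apply: eq_integral => x _; rewrite /fubini_F /= integral_cst//.
by rewrite [X in (_ * X)%E](gauss_measureT R N) mule1.
Qed.

Lemma Lpc_pair_rot (c s : R) (F : T * T -> R[i]) : c ^+ 2 + s ^+ 2 = 1 -> cmeasurable F ->
  Lpc g2 p (F \o pair_rot c s) = Lpc g2 p F.
Proof. by move=> cs mF; apply: Lpc_map => // H mH H0; exact: gauss2_rot. Qed.

Lemma Lpc_snd (tau : T -> T) (F : T * T -> R[i]) :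
  measurable_fun [set: T] tau ->
  (forall H : T -> \bar R, measurable_fun [set: T] H -> (forall x, 0 <= H x)%E ->
    (\int[g]_t H (tau t) = \int[g]_t H t)%E) -> cmeasurable F ->
  Lpc g2 p (fun z => F (z.1, tau z.2)) = Lpc g2 p F.
Proof.
move=> mt tE mF.
apply: (@Lpc_map _ _ _ _ _ g2 g2 (fun z => (z.1, tau z.2)) p F) => // H mH H0.
have mz : measurable_fun [set: T * T] (fun z : T * T => (z.1, tau z.2)).
  by apply: measurable_fun_pair => //; exact: measurableT_comp.
rewrite (fubini_tonelli1 H mH H0) (fubini_tonelli1 (fun z => H (z.1, tau z.2)))//; last first.
  exact: (measurableT_comp mH mz).
apply: eq_integral => x _; rewrite /fubini_F /=.
apply: (tE (fun y => H (x, y))) => //.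
by apply: (measurableT_comp mH); exact: measurable_fun_pair.
Qed.

Lemma cmeasurable_tuple_lin (F : 'rV[R]_N -> R[i]) (a b : R) : polyfun F ->
  cmeasurable (fun z : T * T => F (a *: vec z.1 + b *: vec z.2)).
Proof.
move=> /cmeasurable_polyfun mF.
rewrite (_ : (fun z => _) = (F \o vec) \o (fun z : T * T => tuple_lin a b z.1 z.2)).
  by apply: (cmeasurable_comp mF); exact: measurable_tuple_lin.
by apply/funext => z; rewrite /= vec_tuple_lin.
Qed.

Lemma cmeasurable_fst (F : 'rV[R]_N -> R[i]) : polyfun F ->
  cmeasurable (fun z : T * T => F (vec z.1)).
Proof. by move=> /cmeasurable_polyfun mF; exact: (cmeasurable_comp mF). Qed.

Lemma cmeasurable_snd (F : 'rV[R]_N -> R[i]) : polyfun F ->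
  cmeasurable (fun z : T * T => F (vec z.2)).
Proof. by move=> /cmeasurable_polyfun mF; exact: (cmeasurable_comp mF). Qed.

Lemma cmeasurable_dir_deriv (F : 'rV[R]_N -> R[i]) : polyfun F ->
  cmeasurable (fun z : T * T => dir_deriv F (vec z.1) (vec z.2)).
Proof.
move=> pF; apply: cmeasurable_sum => j; apply: cmeasurableM.
  exact: (@cmeasurable_snd (fun x => (x ord0 j)%:C) (polyfun_coord _ j)).
exact: (cmeasurable_fst (polyfun_partial j pF)).
Qed.

Lemma Lpc_weightX_lty K m :
  (Lpc (gauss_measure R K) p (fun t => (weight (vec t) ^+ m)%:C) < +oo)%E.
Proof.
have mw k : cmeasurable (fun t : K.-tuple R => (weight (vec t) ^+ k)%:C).
  by apply: cmeasurable_real; apply: measurable_funX; exact: measurable_weight.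
apply: (@le_lt_trans _ _ (Lpc (gauss_measure R K) p (fun t => (weight (vec t) ^+ m.+1)%:C))).
  apply: Lpc_le => // t; rewrite !normcR !ger0_norm ?exprn_ge0 ?weight_ge0//.
  by rewrite ler_weXn2l ?weight_ge1.
rewrite LpcE poweR_lty//.
have q1 : 1 <= m.+1%:R * p.
  by rewrite (le_trans p1)// ler_peMl ?(ltW p0)// ler1n.
under eq_integral => t _.
  rewrite normcR ger0_norm ?exprn_ge0 ?weight_ge0// -powR_mulrn ?weight_ge0// -powRrM.
  over.
exact: integral_weight_lty.
Qed.

Lemma Lpc_weight2_lty m :
  (Lpc g2 p (fun z => (weight2 (vec z.1) (vec z.2) ^+ m)%:C) < +oo)%E.
Proof.
apply: le_lt_trans (Lpc_weightX_lty (N + N) m).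
have mw : cmeasurable (fun t : (N + N).-tuple R => (weight (vec t) ^+ m)%:C).
  by apply: cmeasurable_real; apply: measurable_funX; exact: measurable_weight.
rewrite -(@Lpc_map _ _ _ _ _ g2 _ (fun z : T * T => [tuple of z.1 ++ z.2]) p _ _ mw).
  by rewrite le_eqVlt; apply/orP; left; apply/eqP; apply: eq_Lpc => z; rewrite /= vec_cat.
by move=> H mH H0; rewrite gauss_cat.
Qed.

Lemma Lpc_polyfun_lty (F : 'rV[R]_N -> R[i]) : polyfun F -> (Lpc g p (F \o vec) < +oo)%E.
Proof.
move=> pF; have [C [m [C0 Fm]]] := polyfun_growth pF.
have mw : cmeasurable (fun t : T => (weight (vec t) ^+ m)%:C).
  by apply: cmeasurable_real; apply: measurable_funX; exact: measurable_weight.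
apply: (@le_lt_trans _ _ (Lpc g p (fun t => C%:C * (weight (vec t) ^+ m)%:C))).
  apply: Lpc_le => //.
  - exact: cmeasurable_polyfun.
  - by apply: cmeasurableM => //; exact: cmeasurable_cst.
  - move=> t; rewrite ComplexField.Normc.normcM !normcR (ger0_norm C0).
    by rewrite ger0_norm ?exprn_ge0 ?weight_ge0//; exact: Fm.
rewrite LpcZ// lte_mul_pinfty ?lee_fin ?normc_ge0//.
exact: Lpc_weightX_lty.
Qed.

(** Bound for the [p]-th moment of a complex linear form in Gaussian
    variables whose coefficient vector has length [1]. *)
Definition linear_form_cst : R := 2 `^ p * (2 * (2 * (p `^ p * expR 2^-1))).

Lemma linear_form_cst_ge0 : 0 <= linear_form_cst.
Proof. by rewrite !mulr_ge0 ?powR_ge0 ?expR_ge0. Qed.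

(** The real and imaginary parts are real linear forms, with shorter
    coefficient vectors. *)
Lemma complex_linear_moment (v : 'I_N -> R[i]) :
  (\int[g]_t ((normc (\sum_(j < N) (tnth t j)%:C * v j)) `^ p)%:E <=
   (linear_form_cst * (Num.sqrt (\sum_(j < N) normc (v j) ^+ 2)) `^ p)%:E)%E.
Proof.
set S := fun t : T => _; set s := Num.sqrt _.
pose a : T := [tuple Re (v j) | j < N]; pose b : T := [tuple Im (v j) | j < N].
have SE (t : T) : \sum_(j < N) (tnth t j)%:C * v j = tuple_dot a t +i* tuple_dot b t.
  rewrite /tuple_dot; elim/big_ind3 : _ => //=.
    by move=> x1 x2 x3 y1 y2 y3 -> ->.
  move=> j _; rewrite !tnth_mktuple; case: (v j) => x y /=.
  by apply/eqP; rewrite eq_complex /= !mul0r subr0 addr0 mulrC eqxx mulrC eqxx.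
have sa : Num.sqrt (tuple_dot a a) <= s.
  apply: ler_wsqrtr; apply: ler_sum => j _; rewrite !tnth_mktuple -expr2 normcE.
  by rewrite sqr_sqrtr ?addr_ge0 ?sqr_ge0// lerDl sqr_ge0.
have sb : Num.sqrt (tuple_dot b b) <= s.
  apply: ler_wsqrtr; apply: ler_sum => j _; rewrite !tnth_mktuple -expr2 normcE.
  by rewrite sqr_sqrtr ?addr_ge0 ?sqr_ge0// lerDr sqr_ge0.
have ab (c : T) : Num.sqrt (tuple_dot c c) <= s ->
    (\int[g]_t (`|tuple_dot c t| `^ p)%:E <= (2 * (p `^ p * expR 2^-1) * s `^ p)%:E)%E.
  move=> cs; apply: le_trans (gauss_linear_moment c p0) _; rewrite lee_fin.
  apply: ler_wpM2l; first by rewrite !mulr_ge0 ?powR_ge0 ?expR_ge0.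
  by apply: ge0_ler_powR => //; rewrite ?nnegrE ?sqrtr_ge0 ?(ltW p0).
have md (c : T) : measurable_fun [set: T] (fun t => (`|tuple_dot c t| `^ p)%:E).
  apply/measurable_EFinP; apply: (measurableT_comp (measurable_powR _)).
  by apply: measurableT_comp => //; exact: measurable_tuple_dot.
apply: (@le_trans _ _ (\int[g]_t ((2 `^ p)%:E *
    ((`|tuple_dot a t| `^ p)%:E + (`|tuple_dot b t| `^ p)%:E)))%E).
  apply: ge0_le_integral => //.
  - by move=> t _; rewrite lee_fin powR_ge0.
  - apply: measurable_normcX.
    rewrite (_ : (fun t => _) = (fun t : T => (tuple_dot a t)%:C + 'i%C * (tuple_dot b t)%:C)).
      apply: cmeasurableD; first by apply: cmeasurable_real; exact: measurable_tuple_dot.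
      apply: cmeasurableM; first exact: cmeasurable_cst.
      by apply: cmeasurable_real; exact: measurable_tuple_dot.
    by apply/funext => t; rewrite SE [LHS]complexE.
  - by apply: emeasurable_funM => //; exact: emeasurable_funD.
  move=> t _; rewrite SE -EFinD -EFinM lee_fin.
  set x := tuple_dot a t; set y := tuple_dot b t.
  have nxy : normc (x +i* y) <= 2 * Num.max `|x| `|y|.
    have -> : x +i* y = x%:C + 'i%C * y%:C := complexE _.
    apply: le_trans (le_normcD _ _) _.
    rewrite ComplexField.Normc.normcM !normcR [normc 'i%C]normcE /= expr0n expr1n add0r sqrtr1 mul1r.
    by rewrite mulr_natl mulr2n; apply: lerD; rewrite le_max lexx ?orbT.
  apply: (@le_trans _ _ ((2 * Num.max `|x| `|y|) `^ p)).
    by apply: ge0_ler_powR; rewrite ?nnegrE ?normc_ge0 ?(ltW p0).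
  rewrite powRM// ?le_max ?normr_ge0//; apply: ler_wpM2l; first exact: powR_ge0.
  by rewrite /Num.max; case: ifP => _; rewrite ?lerDl ?lerDr powR_ge0.
rewrite ge0_integralZl//; last 2 first.
- exact: emeasurable_funD.
- by move=> t _; rewrite adde_ge0// lee_fin powR_ge0.
rewrite ge0_integralD//.
rewrite /linear_form_cst -mulrA EFinM; apply: lee_wpmul2l; first by rewrite lee_fin powR_ge0.
rewrite -mulrA mulr_natl mulr2n EFinD.
by apply: leeD; exact: ab.
Qed.

Lemma measurable_grad_mod (F : 'rV[R]_N -> R[i]) : polyfun F ->
  measurable_fun [set: T] (fun t => grad_mod F (vec t)).
Proof.
move=> pF.
rewrite (_ : (fun t => _) = (fun x => x `^ 2^-1) \o
    (fun t : T => \sum_(j < N) normc (partial j F (vec t)) ^+ 2)); last first.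
  by apply/funext => t; rewrite /= powR12_sqrt// sumr_ge0// => j _; rewrite sqr_ge0.
apply: (measurableT_comp (measurable_powR _)); apply: measurable_sum => j.
apply: measurable_funX; apply: (measurable_normc (F := partial j F \o vec)).
exact: (cmeasurable_polyfun (polyfun_partial j pF)).
Qed.

(** Integrate over the direction first: for a fixed point the directional
    derivative is a linear form in Gaussian variables, whose coefficient
    vector is the gradient. *)
Lemma Lpc_dir_deriv (F : 'rV[R]_N -> R[i]) : polyfun F ->
  (Lpc g2 p (fun z => dir_deriv F (vec z.1) (vec z.2)) <=
   (linear_form_cst `^ p^-1)%:E * gauss_norm p (grad_mod F))%E.
Proof.
move=> pF; have mg := cmeasurable_dir_deriv pF.
have mG := measurable_grad_mod pF.
have G0 x : 0 <= grad_mod F x by exact: sqrtr_ge0.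
have mGp : measurable_fun [set: T] (fun t => (grad_mod F (vec t) `^ p)%:E).
  by apply/measurable_EFinP; exact: (measurableT_comp (measurable_powR _) mG).
have -> : gauss_norm p (grad_mod F) = ((\int[g]_t (grad_mod F (vec t) `^ p)%:E) `^ p^-1)%E.
  rewrite /gauss_norm Lnorm.unlock; congr (_ `^ _)%E; apply: eq_integral => t _.
  by rewrite /= ger0_norm.
rewrite LpcE -poweR_EFin -poweRM; last 2 first.
- by rewrite lee_fin linear_form_cst_ge0.
- by apply: integral_ge0 => t _; rewrite lee_fin powR_ge0.
have i0 (K : T -> \bar R) : (forall t, 0 <= K t)%E -> (0 <= \int[g]_t K t)%E.
  by move=> K0; apply: integral_ge0.
apply: gt0_ler_poweR.
- by rewrite invr_ge0 (ltW p0).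
- by rewrite in_itv /= leey integral_ge0// => t _; rewrite lee_fin powR_ge0.
- rewrite in_itv /= leey mule_ge0// ?lee_fin ?linear_form_cst_ge0// i0// => t.
  by rewrite lee_fin powR_ge0.
rewrite fubini_tonelli1; last 2 first.
- exact: measurable_normcX.
- by move=> z; rewrite lee_fin powR_ge0.
rewrite -ge0_integralZl//; last 2 first.
- by move=> t _; rewrite lee_fin powR_ge0.
- by rewrite lee_fin linear_form_cst_ge0.
apply: ge0_le_integral => //.
- by move=> x _; apply: i0 => y; rewrite lee_fin powR_ge0.
- apply: measurable_fun_fubini_tonelli_F => //.
    exact: measurable_normcX.
  by move=> z; rewrite lee_fin powR_ge0.
- exact: emeasurable_funM.
move=> x _; rewrite /fubini_F /= -EFinM.
apply: le_trans (complex_linear_moment (fun j => partial j F (vec x))).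
rewrite le_eqVlt; apply/orP; left; apply/eqP; apply: eq_integral => y _.
by congr (_ `^ _)%:E; congr normc; apply: eq_bigr => j _; rewrite mxE.
Qed.

End pair.

(** * The reverse gradient inequality *)

Lemma sume_cst (R : realType) K (x : \bar R) : (0 <= x)%E ->
  (\sum_(i < K) x = K%:R%:E * x)%E.
Proof.
move=> x0; rewrite (eq_bigr (fun=> 1%:E * x)%E) => [|i _]; last by rewrite mul1e.
by rewrite -ge0_sume_distrl// sumEFin sumr_const card_ord.
Qed.

Section chord.
Context (R : realType) (N : nat) (p : R).
Hypothesis p1 : 1 <= p.
Local Notation T := (N.-tuple R).
Local Notation g2 := (gauss_measure R N \x gauss_measure R N)%E.
Variable F : 'rV[R]_N -> R[i].
Hypothesis pF : polyfun F.

Definition chord (h : R) (z : T * T) : R[i] :=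
  F (vec z.1) - F (circle_point (vec z.1) (vec z.2) h).

Let arc (h : R) (z : T * T) : R[i] := F (circle_point (vec z.1) (vec z.2) h).

Let marc h : cmeasurable (arc h). Proof. exact: cmeasurable_tuple_lin. Qed.

Lemma cmeasurable_chord h : cmeasurable (chord h).
Proof.
rewrite (_ : chord h = fun z => F (vec z.1) + (-1) * arc h z).
  apply: cmeasurableD; first exact: cmeasurable_fst.
  by apply: cmeasurableM => //; exact: cmeasurable_cst.
by apply/funext => z; rewrite mulN1r.
Qed.

(** An arc is cut in [K] arcs of angle [h], whose chords have the same law
    by rotation invariance of the pair. *)
Lemma Lpc_chord_split h K : (Lpc g2 p (chord (h *+ K)) <= K%:R%:E * Lpc g2 p (chord h))%E.
Proof.
have cE z : chord (h *+ K) z =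
    \sum_(i < K) (chord h \o pair_rot (cos (h *+ i)) (- sin (h *+ i))) z.
  have step i : (chord h \o pair_rot (cos (h *+ i)) (- sin (h *+ i))) z =
      arc (h *+ i) z - arc (h *+ i.+1) z.
    rewrite /chord /arc /= !vec_tuple_lin opprK; congr (F _ - F _).
    rewrite /circle_point mulrSr cosD sinD; case: z => x y /=.
    by apply/rowP => j; rewrite !mxE; ring.
  under eq_bigr do rewrite step.
  rewrite -(big_mkord xpredT (fun i => arc (h *+ i) z - arc (h *+ i.+1) z)).
  rewrite -[RHS]opprK -sumrN; under eq_bigr do rewrite opprB.
  rewrite telescope_sumr// opprB mulr0n /arc /chord; congr (F _ - _).
  by rewrite /circle_point cos0 sin0 scale1r scale0r addr0.
have mc i : cmeasurable (chord h \o pair_rot (cos (h *+ i)) (- sin (h *+ i))).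
  by apply: cmeasurable_comp; [exact: cmeasurable_chord|exact: measurable_pair_rot].
rewrite (eq_Lpc _ _ cE); apply: le_trans (Lpc_sum _ p1 _ _) _ => //.
rewrite (eq_bigr (fun=> Lpc g2 p (chord h))) => [|i _].
  by rewrite sume_cst// Lpc_ge0.
apply: Lpc_pair_rot; first by rewrite sqrrN cos2Dsin2.
exact: cmeasurable_chord.
Qed.

(** By Taylor expansion the chord of angle [a / K] has norm
    [(a / K) G + O (K^-2)], where [G] is the norm of the derivative; multiply
    by [K] and let [K] grow. *)
Lemma Lpc_chord (a : R) : 0 <= a <= 1 ->
  (Lpc g2 p (chord a) <= a%:E * Lpc g2 p (fun z => dir_deriv F (vec z.1) (vec z.2)))%E.
Proof.
move=> /andP[a0 a1].
have mg := cmeasurable_dir_deriv pF.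
set G := Lpc g2 p (fun z => dir_deriv F (vec z.1) (vec z.2)).
have [C [m [C0 HC]]] := polyfun_taylor_bound pF.
have Boo := Lpc_weight2_lty N p1 m; set B := Lpc _ _ _ in Boo.
have B0 : (0 <= B)%E by exact: Lpc_ge0.
have mW : cmeasurable (fun z : T * T => (weight2 (vec z.1) (vec z.2) ^+ m)%:C).
  apply: cmeasurable_real; apply: measurable_funX.
  rewrite (_ : (fun z => _) = (fun t : (N + N).-tuple R => weight (vec t)) \o
      (fun z : T * T => [tuple of z.1 ++ z.2])).
    by apply: (measurableT_comp (@measurable_weight _ _)); exact: measurable_cat.
  by apply/funext => z; rewrite /= vec_cat.
have small h : 0 <= h <= 1 -> (Lpc g2 p (chord h) <= h%:E * G + (C * h ^+ 2)%:E * B)%E.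
  move=> h01; have /andP[h0 h1] := h01.
  pose rem z := chord h z + h%:C * dir_deriv F (vec z.1) (vec z.2).
  have mrem : cmeasurable rem.
    apply: cmeasurableD; first exact: cmeasurable_chord.
    by apply: cmeasurableM => //; exact: cmeasurable_cst.
  rewrite (eq_Lpc _ _ (G := fun z => (- h%:C) * dir_deriv F (vec z.1) (vec z.2) + rem z)); last first.
    by move=> z; rewrite /rem; ring.
  apply: le_trans (LpcD _ p1 _ _) _ => //.
    by apply: cmeasurableM => //; exact: cmeasurable_cst.
  rewrite LpcZ// normcN normcR (ger0_norm h0); apply: leeD => //.
  apply: (@le_trans _ _ (Lpc g2 p (fun z => (C * h ^+ 2)%:C * (weight2 (vec z.1) (vec z.2) ^+ m)%:C))).
    apply: Lpc_le => //.
      by apply: cmeasurableM => //; exact: cmeasurable_cst.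
    move=> z; have [_ _ H] := HC (vec z.1) (vec z.2) h h01.
    rewrite ComplexField.Normc.normcM !normcR [X in _ <= X * _]ger0_norm ?mulr_ge0 ?sqr_ge0//.
    rewrite ger0_norm ?exprn_ge0 ?(le_trans _ (weight2_ge1 _ _))//.
    rewrite -normcN (_ : - rem z = F (circle_point (vec z.1) (vec z.2) h) -
      F (vec z.1) - h%:C * dir_deriv F (vec z.1) (vec z.2))//.
    by rewrite /rem /chord; ring.
  by rewrite LpcZ// normcR ger0_norm ?mulr_ge0 ?sqr_ge0.
have G0 : (0 <= G)%E by exact: Lpc_ge0.
apply/lee_addgt0Pr => e e0.
pose b := fine B; have BE : B = b%:E by rewrite fineK// ge0_fin_numE.
have b0 : 0 <= b by rewrite fine_ge0.
have X0 : 0 <= C * a ^+ 2 * b by rewrite !mulr_ge0// sqr_ge0.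
(* enough arcs for the second order terms to add up to at most [e] *)
pose K := (Num.truncn (C * a ^+ 2 * b / e)).+1.
have KX : C * a ^+ 2 * b / e < K%:R by rewrite truncnS_gt.
have K0 : 0 < K%:R :> R by rewrite ltr0n.
have aK : a = (a / K%:R) *+ K by rewrite -mulr_natr divfK// gt_eqF.
rewrite {1}aK; apply: le_trans (Lpc_chord_split _ _) _.
have aK01 : 0 <= a / K%:R <= 1.
  by rewrite divr_ge0 ?(ltW K0)//= ler_pdivrMr// mul1r (le_trans a1)// ler1n.
apply: le_trans (lee_wpmul2l _ (small _ aK01)) _; first by rewrite lee_fin ltW.
rewrite ge0_muleDr; last 2 first.
- by rewrite mule_ge0// lee_fin divr_ge0 ?(ltW K0).
- by rewrite mule_ge0// lee_fin mulr_ge0// sqr_ge0.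
rewrite !muleA -!EFinM mulrCA mulfV ?gt_eqF// mulr1; apply: leeD => //.
rewrite BE -EFinM lee_fin.
have -> : K%:R * (C * (a / K%:R) ^+ 2) * b = C * a ^+ 2 * b / K%:R.
  by field; rewrite gt_eqF.
by rewrite ler_pdivrMr// (mulrC e) -ler_pdivrMr// ltW.
Qed.

End chord.

Section reverse_gradient.
Context (R : realType) (n : nat) (p : R).
Hypothesis p1 : 1 <= p.
Local Notation g := (gauss_measure R (n + n)).
Local Notation g2 := (gauss_measure R (n + n) \x gauss_measure R (n + n))%E.
Variables (f : 'rV[R[i]]_n -> R[i]) (d : nat).
Hypotheses (hf : hermite_ge d (on_real f)) (lf : line_polynomial f).
Let pf := polyfun_hermite_ge hf.

Lemma polyfun_scaled (r : R) : polyfun (fun x => on_real f (r *: x)).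
Proof.
apply: (polyfun_comp (h := fun x => r *: x) pf) => j.
apply: (@eq_polyfun _ _ (fun x => r%:C * (x ord0 j)%:C)).
  by move=> x; rewrite !mxE rmorphM.
by apply: polyfunM; [exact: polyfun_cst|exact: polyfun_coord].
Qed.

(** The multiplier [r^(d + j)]. *)
Lemma Lpc_dilation (r : R) : 0 <= r <= 1 ->
  (Lpc g p (fun t => on_real f (r *: vec t)) <= (r ^+ d)%:E * Lpc g p (on_real f \o vec))%E.
Proof.
move=> /andP[r0 r1]; have [D HD] := lf.
pose G Z := f (r%:C *: Z).
rewrite (eq_Lpc _ _ (G := on_real G \o vec)); last first.
  by move=> t; rewrite /= /on_real /= to_complexZ.
have -> : r ^+ d = r ^+ (d + 0) by rewrite addn0.
apply: (@Lpc_multiplier _ n p p1 f G (fun j => r ^+ (d + j)) d D).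
- by move=> j; rewrite exprn_ge0.
- by move=> j; rewrite addnS exprS ler_piMl// exprn_ge0.
- move=> j; rewrite -subr_ge0.
  have -> : r ^+ (d + j) + r ^+ (d + j.+2) - r ^+ (d + j.+1) *+ 2 =
      r ^+ (d + j) * (1 - r) ^+ 2 by rewrite !addnS !exprS; ring.
  by apply: mulr_ge0; [exact: exprn_ge0|exact: sqr_ge0].
- exact: cmeasurable_polyfun.
move=> Z; have [q sq qE] := HD 0 Z.
have {}qE u : f (u *: Z) = q.[u] by rewrite -qE add0r.
have q0 k : (k < d)%N -> q`_k = 0 by exact: hermite_ge_vanish qE _.
have qsum u : q.[u] = \sum_(j < D.+1) q`_(d + j) * u ^+ (d + j).
  rewrite (horner_coef_wide (n := d + D.+1)); last first.
    by rewrite (leq_trans sq)// (leq_trans (leqnSn D))// leq_addl.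
  by rewrite big_split_ord /= big1 ?add0r => [//|k _]; rewrite q0// mul0r.
exists (fun j => q`_(d + j)) => [u|]; first by rewrite qE qsum.
by rewrite /G qE qsum; apply: eq_bigr => j _; rewrite rmorphXn mulrC.
Qed.

(** Averaging the chord over the rotations of its direction: the mean of
    [f (cos a z + u sin a w)] over unit [u] is [f (cos a z)], and each rotated
    direction has the same law. *)
Lemma Lpc_radial_difference (a : R) :
  (Lpc g p (fun t => on_real f (vec t) - on_real f (cos a *: vec t))%R <=
   Lpc g2 p (chord (on_real f) a))%E.
Proof.
have [D HD] := lf.
have [w wp] := complex_prim_root R (ltn0Sn D).
have w1 l : normc (w ^+ l) = 1 by rewrite normcX (normc_unity wp) expr1n.
pose F := on_real f.
have mr := cmeasurable_polyfun (polyfun_scaled (cos a)).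
have md : cmeasurable (fun t : (n + n).-tuple R => F (vec t) - F (cos a *: vec t)).
  rewrite (_ : (fun t => _) = fun t => F (vec t) + (-1) * F (cos a *: vec t)).
    apply: cmeasurableD; first exact: cmeasurable_polyfun.
    by apply: cmeasurableM => //; exact: cmeasurable_cst.
  by apply/funext => t; rewrite mulN1r.
rewrite -(Lpc_fst p md).
pose tau l := complex_rot (n := n) (Re (w ^+ l)) (Im (w ^+ l)).
have mt l : measurable_fun [set: (n + n).-tuple R] (tau l) by exact: measurable_complex_rot.
have mc := cmeasurable_chord pf a.
have mch l : cmeasurable (fun z => chord F a (z.1, tau l z.2)).
  apply: (cmeasurable_comp mc); apply: measurable_fun_pair => //.
  exact: measurableT_comp.
have E (z : (n + n).-tuple R * (n + n).-tuple R) :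
    F (vec z.1) - F (cos a *: vec z.1) =
    \sum_(l < D.+1) D.+1%:R^-1 * chord F a (z.1, tau l z.2).
  have [q sq qE] := HD (to_complex (cos a *: vec z.1)) (to_complex (sin a *: vec z.2)).
  have chE l : chord F a (z.1, tau l z.2) = F (vec z.1) - q.[w ^+ l].
    rewrite /chord; congr (_ - _); rewrite -qE /F /on_real /= /circle_point to_complexD.
    congr (f (_ + _)); rewrite !to_complexZ /tau vec_complex_rot scalerA mulrC -scalerA.
    by congr (_ *: (_ *: _)); case: (w ^+ l).
  rewrite -mulr_sumr; under eq_bigr do rewrite chE.
  rewrite sumrB mulrBr (root_average wp); last by rewrite (leq_trans sq).
  rewrite sumr_const card_ord -[F _ *+ _]mulr_natl mulKf ?pnatr_eq0//.
  by rewrite -horner_coef0 -qE scale0r addr0.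
rewrite (eq_Lpc _ _ E); apply: le_trans (Lpc_sum _ p1 _ _) _.
  by move=> l; apply: cmeasurableM => //; exact: cmeasurable_cst.
rewrite (eq_bigr (fun=> ((D.+1%:R^-1)%:E * Lpc g2 p (chord F a))%E)) => [|l _].
  rewrite sume_cst ?mule_ge0 ?lee_fin ?invr_ge0 ?Lpc_ge0// muleA -EFinM mulfV ?pnatr_eq0//.
  by rewrite mul1e.
rewrite LpcZ// -(rmorph_nat (real_complex R)) -fmorphV normcR ger0_norm; last first.
  by rewrite invr_ge0.
congr (_ * _)%E; apply: Lpc_snd => // H mH H0.
by apply: gauss_complex_rot => //; exact: unit_sqr.
Qed.

(** The denominator bounds [1 - cos a ^+ d] from below when
    [a = 1 / sqrt d]. *)
Definition reverse_gradient_cst : R := linear_form_cst p `^ p^-1 / (1 - expR (- 32^-1)).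

(** The part of [f] that the dilation by [cos a] retains is absorbed in the
    left-hand side, and what it removes is controlled by the chord of angle
    [a = 1 / sqrt d]. *)
Lemma reverse_gradient :
  ((Num.sqrt (d%:R : R))%:E * Lpc g p (on_real f \o vec) <=
   reverse_gradient_cst%:E * gauss_norm p (grad_mod (on_real f)))%E.
Proof.
have eta0 : 0 < 1 - expR (- 32^-1) :> R by rewrite subr_gt0 expR_lt1 oppr_lt0 invr_gt0.
have GM0 : (0 <= gauss_norm p (grad_mod (on_real f)))%E by exact: Lnorm_ge0.
have K0 : 0 <= reverse_gradient_cst by rewrite divr_ge0 ?powR_ge0 ?(ltW eta0).
have [->|d0] := posnP d.
  by rewrite sqrtr0 mul0e mule_ge0.
have dR : 1 <= d%:R :> R by rewrite ler1n.
have sd1 : 1 <= Num.sqrt (d%:R : R) by rewrite -[X in X <= _]sqrtr1 ler_wsqrtr.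
have sd0 : 0 < Num.sqrt (d%:R : R) by exact: lt_le_trans sd1.
pose a : R := (Num.sqrt (d%:R : R))^-1.
have a01 : 0 <= a <= 1 by rewrite invr_ge0 (ltW sd0) invf_le1.
have a2 : a ^+ 2 = d%:R^-1 by rewrite exprVn sqr_sqrtr// (le_trans _ dR).
have r0 : 0 <= cos a.
  have /andP[a0 a1] := a01; have /andP[_ c] := cos_bound a0.
  by have : a ^+ 2 <= 1 by [rewrite expr_le1]; move=> ?; lra.
have r01 : 0 <= cos a <= 1 by rewrite r0 cos_le1.
have rd : cos a ^+ d <= expR (- 32^-1).
  have c1 : cos a <= expR (- (a ^+ 2 / 32)).
    exact: le_trans (cos_upper a01) (expR_ge1Dx _).
  have : cos a ^+ d <= expR (- (a ^+ 2 / 32)) ^+ d by rewrite lerXn2r ?nnegrE ?expR_ge0.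
  rewrite -expRM_natl a2 => /le_trans; apply.
  rewrite le_eqVlt; apply/orP; left; apply/eqP; congr expR.
  by field; rewrite gt_eqF// (lt_le_trans _ dR).
set X := Lpc g p (on_real f \o vec).
have Xoo : (X < +oo)%E by exact: Lpc_polyfun_lty.
have X0 : (0 <= X)%E by exact: Lpc_ge0.
set Y := gauss_norm _ _ in GM0 *.
have mr := cmeasurable_polyfun (polyfun_scaled (cos a)).
have split : (X <= (cos a ^+ d)%:E * X + (a * linear_form_cst p `^ p^-1)%:E * Y)%E.
  have XE : X = Lpc g p (fun t => on_real f (cos a *: vec t) +
      (on_real f (vec t) - on_real f (cos a *: vec t))).
    by apply: eq_Lpc => t; rewrite addrC subrK.
  rewrite {1}XE.
  apply: le_trans (LpcD _ p1 _ _) _ => //.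
    rewrite (_ : (fun t => _) = fun t => on_real f (vec t) + (-1) * on_real f (cos a *: vec t)).
      apply: cmeasurableD; first exact: cmeasurable_polyfun.
      by apply: cmeasurableM => //; exact: cmeasurable_cst.
    by apply/funext => t; rewrite mulN1r.
  apply: leeD; first exact: Lpc_dilation.
  apply: le_trans (Lpc_radial_difference a) _.
  apply: le_trans (Lpc_chord p1 pf a01) _.
  rewrite EFinM -muleA; apply: lee_wpmul2l; first by rewrite lee_fin; case/andP: a01.
  exact: Lpc_dir_deriv.
case: (eqVneq Y +oo%E) => [->|Ynoo].
  have [K00|Kn0] := eqVneq reverse_gradient_cst 0; last first.
    by rewrite gt0_muley ?leey// lte_fin lt_neqAle eq_sym Kn0.
  (* the comparison constant is positive *)
  exfalso; move/eqP: K00; rewrite mulf_eq0 invr_eq0 (gt_eqF eta0) orbF powR_eq0.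
  rewrite /linear_form_cst !mulf_eq0 !powR_eq0 (gt_eqF (expR_gt0 _)) !pnatr_eq0 /=.
  by rewrite (gt_eqF (lt_le_trans ltr01 p1)).
have Yfin : Y \is a fin_num by rewrite ge0_fin_numE// ltey.
have Xfin : X \is a fin_num by rewrite ge0_fin_numE.
move: split; rewrite -(fineK Xfin) -(fineK Yfin) -!EFinM -EFinD !lee_fin.
set x := fine X; set y := fine Y; set r := cos a ^+ d => split.
have x0 : 0 <= x by rewrite fine_ge0.
rewrite /reverse_gradient_cst mulrAC ler_pdivlMr//.
have h1 : x * (1 - expR (- 32^-1)) <= a * linear_form_cst p `^ p^-1 * y.
  by have := ler_wpM2l x0 rd; rewrite -/r; lra.
have := ler_wpM2l (ltW sd0) h1.
by rewrite !mulrA /a mulfV ?gt_eqF// mul1r.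
Qed.

End reverse_gradient.

(** * The two inequalities *)

Local Close Scope complex_scope.
Unset Implicit Arguments.
Set Strict Implicit.
Set Printing Implicit Defensive.

Theorem theorem3 (R : realType) :
  (forall (n : nat) (p : R) (d : nat) (f : 'rV[R[i]]_n -> R[i]),
    (1 <= n)%N -> 1 <= p ->
    analytic f -> hermite_ge d (on_real f) ->
    (d%:R%:E * gauss_norm p (fun x => ComplexField.Normc.normc (on_real f x)) <=
     gauss_norm p (fun x => ComplexField.Normc.normc (ou_generator (on_real f) x)))%E) /\
  (forall p : R, 1 < p ->
    exists K : R,
      forall (n d : nat) (f : 'rV[R[i]]_n -> R[i]),
        (1 <= n)%N ->
        analytic_polynomial f -> hermite_ge d (on_real f) ->
        ((Num.sqrt (d%:R : R))%:E * gauss_norm p (fun x => ComplexField.Normc.normc (on_real f x)) <=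
         K%:E * gauss_norm p (grad_mod (on_real f)))%E).
Proof.
split=> [n p d f _ p1 af hf|p p1].
  have lf := analytic_line_polynomial af (polyfun_hermite_ge hf).
  exact: generator_lower_bound p1 hf lf.
exists (reverse_gradient_cst p) => n d f _ af hf.
have lf := analytic_polynomial_line af (polyfun_hermite_ge hf).
exact: (reverse_gradient (ltW p1) hf lf).
Qed.
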